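(* Let $T,T'$ be CM-types. If $|T\cap T'|=k$, then the line $\phi(\ell_T\otimes\tau(\ell_{T'}))$ belongs to $F_{dk}(\wedge^*V_{\mathbb C})$ and it projects onto the line $\wedge^{dk}[W_T\cap W_{T'}]$ in $\wedge^{dk}V_{\mathbb C}$. The image of the composition $$BB_1\xrightarrow{\ \phi\circ(id\otimes\tau)\ }F_d(\wedge^*V_{\mathbb Q})\to\wedge^dV_{\mathbb Q}$$ (the second arrow being the projection) is $HW$.
   Context: $K$ is a CM-field, $F$ its maximal totally real subfield, $\iota$ the generator of $\mathrm{Gal}(K/F)$, $e=[K:\mathbb Q]$, $\Sigma$ the set of embeddings $K\to\mathbb C$, $\hat\Sigma$ the set of embeddings $F\to\mathbb R$. A CM-type is a map $T:\hat\Sigma\to\Sigma$ with $T(\hat\sigma)|_F=\hat\sigma$; $|T\cap T'|$ is the number of $\hat\sigma$ with $T(\hat\sigma)=T'(\hat\sigma)$. $d$ is a positive even integer, $X$ is a complex abelian variety of dimension $n=de/4$ with an algebra embedding $\hat\eta:F\to\mathrm{End}_{\mathbb Q}(X)$, so $\dim_FH^1(X,\mathbb Q)=d$; $\hat X$ is the dual abelian variety. $V=H^1(X,\mathbb Z)\oplus H^1(\hat X,\mathbb Z)=H^1(X\times\hat X,\mathbb Z)$, with $H^1(\hat X,\mathbb Z)=H^1(X,\mathbb Z)^*$ and pairing $((w_1,\theta_1),(w_2,\theta_2))_V=\theta_1(w_2)+\theta_2(w_1)$; $V_L=V\otimes_{\mathbb Z}L$; $H^*(X\times\hat X,\mathbb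 Q)=\wedge^*V_{\mathbb Q}$. $F_k(\wedge^*V_L)=\bigoplus_{i\ge k}\wedge^iV_L$. $F$ acts on $V_{\mathbb Q}$ via $\hat\eta$, acting on $H^1(\hat X,\mathbb Q)$ by $\theta\mapsto\theta\circ\hat\eta(a)$; $(\cdot,\cdot)_{V_{\hat\eta}}$ is the unique $F$-valued symmetric $F$-bilinear form on $V_{\mathbb Q}$ with $\mathrm{tr}_{F/\mathbb Q}\circ(\cdot,\cdot)_{V_{\hat\eta}}=(\cdot,\cdot)_V$. $\iota$ acts on $V_{\mathbb Q}\otimes_FK$ through the second factor. $W=\rho_{g_0}(H^1(\hat X,\mathbb Q)\otimes_FK)$ for some $g_0$ in the spin group of $V_{\mathbb Q}\otimes_FK$ (with the $K$-bilinear extension of $(\cdot,\cdot)_{V_{\hat\eta}}$; $\rho$ is the vector representation), and it is assumed that $W\cap\iota(W)=0$. Then $V_{\mathbb Q}=\{w+\iota(w):w\in W\}$, and $\eta:K\to\mathrm{End}_{\mathbb Q}(V_{\mathbb Q})$ is $\eta(t)(w+\iota(w))=tw+\iota(tw)$. $V_\sigma\subset V_{\mathbb C}$ is the ($d$-dimensional) subspace on which $\eta(t)$ acts by $\sigma(t)$ for all $t\in K$; $W_T=\bigoplus_{\hat\sigma}V_{T(\hat\sigma)}$. $HW=\wedge^d_{\eta(K)}V_{\mathbb Q}$, i.e. $\wedge^dV_{\mathbb Q}\cap\bigoplus_{\sigma\in\Sigma}\wedge^dV_\sigma$. $V$ acts on $H^*(X)$ by $(w,\theta)\cdot s=w\wedge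 s+\theta\rfloor s$; $\ell_T\subset H^{ev}(X,\mathbb C)$ is the pure spinor line of $W_T$ (all $s$ with $v\cdot s=0$ for $v\in W_T$). $B\subset H^{ev}(X,\mathbb Q)$ is the rational subspace such that $B\otimes\mathbb C$ is the span of all $\ell_T$ (these are linearly independent). $BB_1\subset B\otimes_{\mathbb Q}B$ is the rational subspace with $BB_1\otimes\mathbb C=\bigoplus_{|T\cap T'|=1}\ell_T\otimes\ell_{T'}$. $\mathcal P$ is the normalized Poincaré bundle on $\hat X\times X$; $\phi_{\mathcal P}:H^*(\hat X)\to H^*(X)$, $\gamma\mapsto\pi_{X,*}(\pi_{\hat X}^*\gamma\cup ch(\mathcal P))$; $\mu(x,y)=(x+y,y)$ on $X\times X$; $\phi:H^*(X\times X)\to H^*(X\times\hat X)$ is the inverse of $\mu_*\circ(id\otimes\phi_{\mathcal P})$ (the isomorphism induced by Orlov's equivalence $D^b(X\times X)\to D^b(X\times\hat X)$). $\tau$ acts on $H^i(X)$ by $(-1)^{i(i-1)/2}$. *)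

(* Defs.v *)
From HB Require Import structures.
From mathcomp Require Import all_boot all_order all_algebra all_field.
From mathcomp Require Import boolp classical_sets cardinality reals.
From mathcomp Require Import complex.

Set Implicit Arguments.
Unset Strict Implicit.
Unset Printing Implicit Defensive.

Import Order.TTheory GRing.Theory Num.Theory.

Local Open Scope classical_set_scope.
Local Open Scope ring_scope.

Definition lspan (L : fieldType) (U : lmodType L) (A : set U) : set U :=
  [set x | exists2 s : seq (L * U),
     (forall p, p \in s -> A p.2) & x = \sum_(p <- s) p.1 *: p.2].

Definition is_line (L : fieldType) (U : lmodType L) (A : set U) : Prop :=
  exists2 x : U, x <> 0 & A = [set a *: x | a in [set: L]].

(* The trace of L over Q: the trace of multiplication by a. *)
Definition tr_rat (L : fieldExtType rat) (a : L) : rat :=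
  \sum_(i < \dim {:L}) coord (vbasis {:L}) i (a * (vbasis {:L})`_i).

(* [ext L m] is the exterior algebra of L^m = 'rV[L]_m: the value of x at a set
   I = {i_1 < ... < i_k} is the coefficient of e_{i_1} /\ ... /\ e_{i_k}. *)

Notation ext L m := {ffun {set 'I_m} -> L^o}.

Section Exterior.
Variable L : fieldType.

Definition ext_basis m (I : {set 'I_m}) : ext L m := [ffun J : {set 'I_m} => (J == I)%:R].

Definition ext_one m : ext L m := ext_basis finset.set0.

Definition ext_vec m (v : 'rV[L]_m) : ext L m :=
  \sum_(i < m) v 0 i *: ext_basis [set i]%SET.

(* The number of transpositions that sort the concatenation of I and J. *)
Definition inversions m (I J : {set 'I_m}) : nat :=
  #|[set p : 'I_m * 'I_m | [&& p.1 \in I, p.2 \in J & (p.2 < p.1)%N]]%SET|.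

Definition wedge m (x y : ext L m) : ext L m :=
  [ffun I : {set 'I_m} => \sum_(A : {set 'I_m} | A \subset I)
     (-1) ^+ inversions A (I :\: A) * x A * y (I :\: A)].

Definition wedge_seq m (s : seq 'rV[L]_m) : ext L m :=
  foldr (fun v x => wedge (ext_vec v) x) (ext_one m) s.

(* Left contraction with the linear form sending e_i to u 0 i. *)
Definition contract m (u : 'rV[L]_m) (x : ext L m) : ext L m :=
  [ffun I : {set 'I_m} => \sum_(i < m | i \notin I)
     u 0 i * (-1) ^+ inversions [set i]%SET I * x (i |: I)%SET].

Definition ext_exp m (x : ext L m) : ext L m :=
  \sum_(k < m.+1) (k`!%:R : L)^-1 *: iter k (wedge x) (ext_one m).

(* The algebra homomorphism induced by v |-> v *m M. *)
Definition ext_map m p (M : 'M[L]_(m, p)) (x : ext L m) : ext L p :=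
  \sum_(I : {set 'I_m}) x I *: wedge_seq [seq row i M | i <- enum I].

Definition ext_part m (k : nat) (x : ext L m) : ext L m :=
  [ffun I : {set 'I_m} => if #|I| == k then x I else 0].

Definition ext_degree m (k : nat) : set (ext L m) :=
  [set x : ext L m | forall I : {set 'I_m}, x I != 0 -> #|I| = k].

Definition ext_even m : set (ext L m) :=
  [set x : ext L m | forall I : {set 'I_m}, x I != 0 -> ~~ odd #|I|].

Definition ext_filtration m (k : nat) : set (ext L m) :=
  [set x : ext L m | forall I : {set 'I_m}, x I != 0 -> (k <= #|I|)%N].

Definition ext_power m (k : nat) (U : set 'rV[L]_m) : set (ext L m) :=
  lspan [set wedge_seq s | s in
    [set s : seq 'rV[L]_m | size s = k /\ forall v, v \in s -> U v]].

End Exterior.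

Definition ext_ratr (L : fieldType) m (x : ext rat m) : ext L m :=
  [ffun I : {set 'I_m} => ratr (x I)].

(* A complex torus of dimension n is presented by its lattice H_1(X, Z),
   identified with the columns Z^(2n), and the complex structure on H_1(X, R).
   It is an abelian variety when it has a Riemann form. *)

Record abelian_variety (R : realType) (n : nat) := AbelianVariety {
  av_cplx : 'M[R]_(n.*2);
  av_cplx_sq : av_cplx *m av_cplx = - 1%:M;
  av_polarized : exists E : 'M[int]_(n.*2), let ER := map_mx intr E : 'M[R]_(n.*2) in
    [/\ E^T = - E,
        av_cplx^T *m ER *m av_cplx = ER
      & forall x : 'cV[R]_(n.*2), x != 0 -> 0 < (x^T *m ER *m av_cplx *m x) 0 0]
}.

(* Elements of End_Q(X), acting on H_1(X, Q) by x |-> M *m x, hence on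
   H^1(X, Q), which is the space of rows, by w |-> w *m M. *)
Definition in_EndQ (R : realType) n (X : abelian_variety R n)
    (M : 'M[rat]_(n.*2)) : Prop :=
  map_mx ratr M *m av_cplx X = av_cplx X *m map_mx ratr M.

(* With N = 2n, H^*(X, L) and H^*(X^, L) are both ext L N, where the basis of
   H^1(X^, Z) = H^1(X, Z)^* is dual to the basis of H^1(X, Z).  In ext L (N + N)
   the coordinates of the first factor of a product come first; as the cohomology
   of X x X^ it is the exterior algebra of V_L = 'rV[L]_(N + N), whose elements
   are (w, theta) = row_mx w theta. *)

Section Cohomology.
Variables (L : fieldType) (N : nat).

Definition pairingV (v1 v2 : 'rV[L]_(N + N)) : L :=
  (lsubmx v2 *m (rsubmx v1)^T + lsubmx v1 *m (rsubmx v2)^T) 0 0.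

(* The action of V on H^*(X): (w, theta) . s = w /\ s + theta _| s *)
Definition spinor_act (v : 'rV[L]_(N + N)) (s : ext L N) : ext L N :=
  wedge (ext_vec (lsubmx v)) s + contract (rsubmx v) s.

Definition tau (s : ext L N) : ext L N :=
  [ffun I : {set 'I_N} => (-1) ^+ (#|I| * #|I|.-1)./2 * s I].

Definition pull1 : ext L N -> ext L (N + N) := ext_map (row_mx 1%:M 0).
Definition pull2 : ext L N -> ext L (N + N) := ext_map (row_mx 0 1%:M).

Definition ext_prod (x y : ext L N) : ext L (N + N) := wedge (pull1 x) (pull2 y).

(* A (x) B as a subspace of the cohomology of the product, by Kuenneth *)
Definition tensor (A B : set (ext L N)) : set (ext L (N + N)) :=
  lspan [set z | exists x y, [/\ A x, B y & z = ext_prod x y]].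

(* id (x) f on the cohomology of the product *)
Definition id_tensor (f : ext L N -> ext L N) (z : ext L (N + N)) : ext L (N + N) :=
  \sum_(I : {set 'I_N}) \sum_(J : {set 'I_N})
    z (lshift N @: I :|: @rshift N N @: J) *:
      ext_prod (ext_basis L I) (f (ext_basis L J)).

(* Integration over the first factor of a product, normalized so that the
   product of the lattice basis of its H^1 has integral 1: the basis of the
   lattice is chosen so that this is the complex orientation. *)
Definition push2 (z : ext L (N + N)) : ext L N :=
  [ffun J : {set 'I_N} => z (lshift N @: [set: 'I_N]%SET :|: @rshift N N @: J)].

(* The first Chern class of the Poincare bundle on X^ x X, that is, the identity
   in H^1(X) (x) H^1(X)^* = H^1(X) (x) H^1(X^), placed in H^2(X^ x X). *)
Definition c1_poincare : ext L (N + N) :=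
  \sum_(i < N) wedge (pull2 (ext_vec (delta_mx 0 i))) (pull1 (ext_vec (delta_mx 0 i))).

Definition phi_poincare (gamma : ext L N) : ext L N :=
  push2 (wedge (pull1 gamma) (ext_exp c1_poincare)).

(* Gysin map of the automorphism mu(x, y) = (x + y, y) of X x X, i.e., pullback
   by its inverse (x, y) |-> (x - y, y). *)
Definition mu_push : ext L (N + N) -> ext L (N + N) :=
  ext_map (block_mx 1%:M (- 1%:M) 0 1%:M).

(* The inverse of the isomorphism mu_* o (id (x) phi_P). *)
Definition phi : 'End(ext L (N + N)) :=
  ((linfun (mu_push \o id_tensor phi_poincare))^-1)%VF.

End Cohomology.

Definition is_clifford_algebra (k : fieldType) (U : lmodType k) (q : U -> k)
    (A : algType k) (c : {linear U -> A}) : Prop :=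
  (forall u, c u * c u = (q u)%:A) /\
  (forall (B : algType k) (f : {linear U -> B}),
     (forall u, f u * f u = (q u)%:A) ->
     exists g : {lrmorphism A -> B}, (forall u, g (c u) = f u) /\
       forall g' : {lrmorphism A -> B}, (forall u, g' (c u) = f u) -> g' =1 g).

Section Spin.
Variables (k : fieldType) (U : lmodType k) (A : algType k) (c : {linear U -> A}).

Definition clifford_sum (s : seq (k * seq U)) : A :=
  \sum_(p <- s) p.1 *: \prod_(u <- p.2) c u.

(* g is even, g * g^* = 1 and g U g^-1 is contained in U, where ^* is the
   anti-automorphism u_1 ... u_r |-> u_r ... u_1. *)
Definition spin_group : set A :=
  [set g | exists s : seq (k * seq U),
     [/\ forall p, p \in s -> ~~ odd (size p.2),
         g = clifford_sum s,
         g * clifford_sum [seq (p.1, rev p.2) | p <- s] = 1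
       & forall u, exists u', g * c u = c u' * g]].

(* The image of S by the vector representation u |-> g u g^-1 of g. *)
Definition vector_rep_image (g : A) (S : set U) : set U :=
  [set u' | exists2 u, S u & g * c u = c u' * g].

End Spin.

Section CM.
Variables (R : realType) (K : fieldExtType rat).

Definition totally_real (E : {subfield K}) : Prop :=
  forall (s : {rmorphism subvs_of E -> R[i]}) a, s a \is Num.real.

Definition totally_imaginary : Prop :=
  forall s : {rmorphism K -> R[i]}, ~ (forall a, s a \is Num.real).

Definition CM_field : Prop :=
  totally_imaginary /\
  exists2 E : {subfield K}, totally_real E & \dim {:K} = (2 * \dim E)%N.

Definition max_totally_real (F : {subfield K}) : Prop :=
  totally_real F /\ forall E : {subfield K}, totally_real E -> (E <= F)%VS.

Variable F : {subfield K}.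

(* Gal(K/F) has order two. *)
Definition generates_Gal (iota : {rmorphism K -> K}) : Prop :=
  (forall a, a \in F -> iota a = a) /\ (exists a, iota a != a).

Definition embK := {rmorphism K -> R[i]}.
Definition embF := {rmorphism subvs_of F -> R}.

Definition is_CM_type (T : embF -> embK) : Prop :=
  forall (s : embF) (a : subvs_of F), T s (vsval a) = (s a)%:C%C.

Definition card_meet (T T' : embF -> embK) (k : nat) : Prop :=
  ([set s | T s = T' s] #= `I_k)%card.

End CM.

Section FSpace.
Variables (N : nat) (K : fieldExtType rat) (F : {subfield K}).
Variable etahat : {rmorphism subvs_of F -> 'M[rat]_N}.

(* theta o etahat(a) is the column etahat(a) *m theta, hence the transpose. *)
Definition actV (a : subvs_of F) (v : 'rV[rat]_(N + N)) : 'rV[rat]_(N + N) :=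
  v *m block_mx (etahat a) 0 0 (etahat a)^T.

(* bF is the form (.,.)_{V_etahat}. *)
Definition is_F_form (bF : 'rV[rat]_(N + N) -> 'rV[rat]_(N + N) -> subvs_of F) : Prop :=
  [/\ forall x y, bF x y = bF y x,
      forall x y z, bF (x + y) z = bF x z + bF y z,
      forall a x y, bF (actV a x) y = a * bF x y
    & forall x y, tr_rat (bF x y) = pairingV x y].

Definition F_linear (U : lmodType K) (f : 'rV[rat]_(N + N) -> U) : Prop :=
  (forall x y, f (x + y) = f x + f y) /\
  (forall a x, f (actV a x) = vsval a *: f x).

(* VK, with j : x |-> x (x) 1, is the tensor product of V_Q and K over F. *)
Definition is_tensor_K (VK : lmodType K) (j : 'rV[rat]_(N + N) -> VK) : Prop :=
  F_linear j /\
  (forall (U : lmodType K) (f : 'rV[rat]_(N + N) -> U), F_linear f ->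
     exists g : {linear VK -> U}, (forall x, g (j x) = f x) /\
       forall g' : {linear VK -> U}, (forall x, g' (j x) = f x) -> g' =1 g).

(* H^1(X^, Q) (x)_F K as a subspace of VK. *)
Definition H1dual_K (VK : lmodType K) (j : 'rV[rat]_(N + N) -> VK) : set VK :=
  lspan [set j (row_mx 0 theta) | theta in [set: 'rV[rat]_N]].

End FSpace.

Section Weil.
Variables (R : realType) (N : nat) (K : fieldExtType rat) (F : {subfield K}).
Variable eta : K -> 'M[rat]_(N + N).

Definition Vsigma (sigma : embK R K) : set 'rV[R[i]]_(N + N) :=
  [set v | forall t, v *m map_mx ratr (eta t) = sigma t *: v].

Definition W_ (T : embF R F -> embK R K) : set 'rV[R[i]]_(N + N) :=
  lspan (\bigcup_(s in [set: embF R F]) Vsigma (T s)).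

Definition spinor_line (T : embF R F -> embK R K) : set (ext R[i] N) :=
  [set s | forall v, W_ T v -> spinor_act v s = 0].

Definition HW (d : nat) : set (ext rat (N + N)) :=
  [set x | ext_degree d x /\
     lspan (\bigcup_(sigma in [set: embK R K]) ext_power d (Vsigma sigma))
       (ext_ratr R[i] x)].

End Weil.

(* Main.v *)
Require Import Defs.
From HB Require Import structures.
From mathcomp Require Import all_boot all_order all_algebra all_field.
From mathcomp Require Import boolp classical_sets cardinality reals.
From mathcomp Require Import complex ring fintype finset bigop.

Set Implicit Arguments.
Unset Strict Implicit.
Unset Printing Implicit Defensive.

Import Order.TTheory GRing.Theory Num.Theory.

Local Open Scope ring_scope.

(** Write Phi for the inverse of phi, that is, mu_* composed with id (x) phi_P.
    The space H^*(X x X) carries two actions of the Clifford algebra of V, one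
    for each factor, and H^*(X x X^) is the exterior algebra of V.  The Fourier
    transform phi_P exchanges exterior multiplication and contraction, and mu_*
    is an algebra map; hence Phi carries the action of v = (w, theta) on the
    first factor to the operator
      (w, 0) /\ + contraction with (v, .)
    and its action on the second factor, seen through tau, to
      contraction with (v, .) - (0, theta) /\ ,
    see [Phi_left] and [Phi_right].  The two operators differ by v /\, and up to
    terms of higher degree both are the contraction with (v, .).

    So let z = phi(s (x) tau t) with s in l_T and t in l_T'.  Then v /\ z = 0 for
    every v in W_T meet W_T', and the component of z of lowest degree is killed
    by the contractions with W_T + W_T', which is the orthogonal of W_T meet
    W_T'.  In a basis of V adapted to the intersection these conditions force
    the lowest component of z, unless z = 0, to be a multiple of the top exterior
    power of the intersection: this is [lowest_part].  The filtration statement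
    and the leading term follow, and also that such z fill at most a line,
    because z is determined by its leading term.  They fill a line because an
    isotropic subspace always annihilates some nonzero spinor
    ([isotropic_spinor_exists]).  All this is [pure_spinor_line].

    The adapted basis comes from the K-action.  Since W and iota W are isotropic
    complementary subspaces of V (x)_F K, one has (eta(t) x, y) = (x, eta(iota t) y)
    ([weil_action]).  With K = Q(a), the characteristic polynomial of eta(a) is
    the d-th power of the minimal polynomial of a, so V_C has a basis of
    eigenvectors in which each embedding of K occurs d times ([eigenbasis]).  By
    the adjunction formula V_sigma is orthogonal to all V_sigma' except for
    sigma' = sigma o iota; a CM-type picks one embedding from each such pair, so
    W_T is isotropic, W_T meet W_T' has dimension d |T meet T'|, and the linear
    forms vanishing on it are the (v, .) with v in W_T + W_T'.

    For the last claim, every embedding sigma is the only common value of two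
    CM-types ([CM_type_meeting_at]), so the image of BB_1 and HW have the same
    complex span, the sum of the top exterior powers of the V_sigma.  As phi and
    tau are defined over Q, the image of BB_1 is a rational subspace, and a
    rational vector in its complex span belongs to it ([rational_descent]). *)

(** * Creation and annihilation operators on the exterior algebra *)

Section FockSpace.
Variables (L : fieldType) (m : nat).
Implicit Types (x y : ext L m) (I J A B : {set 'I_m}) (i k : 'I_m) (u v : 'rV[L]_m).

Lemma ext_scaleE (a : L) x I : (a *: x) I = a * x I.
Proof. by rewrite ffunE. Qed.

Lemma ext_addE x y I : (x + y) I = x I + y I.
Proof. by rewrite ffunE. Qed.

Lemma ext_sumE (T : Type) (r : seq T) (P : pred T) (f : T -> ext L m) I :
  (\sum_(t <- r | P t) f t) I = \sum_(t <- r | P t) f t I.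
Proof. by elim/big_rec2: _ => [|t a b _ <-]; rewrite !ffunE. Qed.

Lemma ext_basisE x : x = \sum_(I : {set 'I_m}) x I *: ext_basis L I.
Proof.
apply/ffunP => J; rewrite ext_sumE (bigD1 J) //= ext_scaleE ffunE eqxx mulr1.
rewrite big1 ?addr0 // => I nIJ.
by rewrite ext_scaleE ffunE eq_sym (negPf nIJ) mulr0.
Qed.

Lemma ext_basis_ind (P : ext L m -> Prop) :
  (forall a x y, P x -> P y -> P (a *: x + y)) -> (forall I, P (ext_basis L I)) ->
  forall x, P x.
Proof.
move=> Plin Pb x; rewrite (ext_basisE x); elim/big_rec: _ => [|I y _ Py]; last exact: Plin.
by rewrite -(subrr (ext_basis L finset.set0)) addrC -scaleN1r; apply: Plin.
Qed.

(** The sign by which e_i /\ e_A differs from the sorted monomial on the set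
    obtained by adding i to A. *)
Definition sg i A : L := \prod_(k in A) (-1) ^+ (k < i)%N.

Lemma sg_sqr i A : sg i A * sg i A = 1.
Proof. by rewrite -big_split big1 // => k _ /=; rewrite -expr2 sqrr_sign. Qed.

Lemma sgU1 i k A : k \notin A -> sg i (k |: A)%SET = (-1) ^+ (k < i)%N * sg i A.
Proof. by move=> kA; rewrite /sg big_setU1. Qed.

Lemma sgU1id i A : sg i (i |: A)%SET = sg i A.
Proof.
have [iA|iA] := boolP (i \in A); last by rewrite sgU1 // ltnn mul1r.
by rewrite (finset.setUidPr _) // sub1set.
Qed.

Lemma sgD1 i k A : k \in A -> sg i A = (-1) ^+ (k < i)%N * sg i (A :\ k)%SET.
Proof. by move=> kA; rewrite /sg (big_setD1 k). Qed.

Lemma sgD1id i A : sg i (A :\ i)%SET = sg i A.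
Proof.
have [iA|iA] := boolP (i \in A); first by rewrite (sgD1 i iA) ltnn mul1r.
by congr sg; apply/finset.setDidPl; rewrite disjoint_sym disjoints1.
Qed.

(** Exterior multiplication by e_i and, next, contraction with the i-th
    coordinate form.  Signs are computed once, for these operators; the rest of
    the exterior calculus follows from their anticommutation relations. *)
Definition cre i x : ext L m :=
  [ffun I : {set 'I_m} => if i \in I then sg i I * x (I :\ i)%SET else 0].

Definition ann i x : ext L m :=
  [ffun I : {set 'I_m} => if i \in I then 0 else sg i I * x (i |: I)%SET].

Fact cre_is_linear i : linear (cre i).
Proof.
move=> a x y; apply/ffunP => I; rewrite ?(ext_addE, ext_scaleE, ffunE).
by case: ifP => _; rewrite ?mulr0 ?addr0 // mulrDr mulrCA.
Qed.
HB.instance Definition _ i :=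
  GRing.isLinear.Build L (ext L m) (ext L m) *:%R (cre i) (cre_is_linear i).

Fact ann_is_linear i : linear (ann i).
Proof.
move=> a x y; apply/ffunP => I; rewrite ?(ext_addE, ext_scaleE, ffunE).
by case: ifP => _; rewrite ?mulr0 ?addr0 // mulrDr mulrCA.
Qed.
HB.instance Definition _ i :=
  GRing.isLinear.Build L (ext L m) (ext L m) *:%R (ann i) (ann_is_linear i).

Lemma cre_basis i I : i \notin I -> cre i (ext_basis L I) = sg i I *: ext_basis L (i |: I)%SET.
Proof.
move=> iI; apply/ffunP => J; rewrite ext_scaleE !ffunE.
have [->|nJ] := eqVneq J (i |: I)%SET.
  by rewrite finset.setU11 setU1K // eqxx sgU1id.
case: ifP => iJ; rewrite ?mulr0 //.
by case: eqP => e; rewrite ?mulr0 //; case/eqP: nJ; rewrite -e setD1K.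
Qed.

Lemma sign_anti i k : i != k -> (-1) ^+ (k < i)%N = - (-1) ^+ (i < k)%N :> L.
Proof.
rewrite -val_eqE neq_ltn => /orP[h|h]; rewrite h ltnNge (ltnW h) /= expr0 expr1 //.
by rewrite opprK.
Qed.

Lemma cre_anticomm i k x : cre i (cre k x) = - cre k (cre i x).
Proof.
apply/ffunP => I; rewrite !ffunE.
have [->|nik] := eqVneq i k; first by rewrite !inE eqxx /=; case: ifP; rewrite ?mulr0 oppr0.
rewrite !inE nik [k == i]eq_sym nik /=.
case: ifP => iI; case: ifP => kI; rewrite ?mulr0 ?oppr0 //.
rewrite (sgD1 i kI) (sgD1 k iI) (sign_anti nik) !finset.setDDl finset.setUC.
by ring.
Qed.

Lemma ann_anticomm i k x : ann i (ann k x) = - ann k (ann i x).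
Proof.
apply/ffunP => I; rewrite !ffunE.
have [->|nik] := eqVneq i k.
  by rewrite !inE eqxx /= ; case: ifP; rewrite ?mulr0 oppr0.
rewrite !inE (negPf nik) eq_sym (negPf nik) /=.
case: ifP => iI; case: ifP => kI; rewrite ?mulr0 ?oppr0 //.
rewrite !sgU1 ?iI ?kI // (sign_anti nik) finset.setUCA.
by ring.
Qed.

Lemma ann_cre i k x : ann i (cre k x) = (i == k)%:R *: x - cre k (ann i x).
Proof.
apply/ffunP => I; rewrite !ffunE.
have [->|nik] := eqVneq i k.
  rewrite !inE eqxx /= scale1r; case: ifP => kI.
    by rewrite sgD1id setD1K // mulrA sg_sqr mul1r subrr.
  by rewrite sgU1id setU1K ?kI // mulrA sg_sqr mul1r subr0.
rewrite !inE scale0r add0r nik eq_sym (negPf nik) /=.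
case: ifP => iI; case: ifP => kI; rewrite ?mulr0 ?oppr0 //.
rewrite (sgD1 i kI) sgU1 ?iI // (sign_anti nik).
rewrite (_ : (i |: I) :\ k = i |: (I :\ k))%SET; last first.
  by apply/setP=> l; rewrite !inE; case: (eqVneq l i) => // ->; rewrite ?nik ?(negPf nik).
by case: (i < k)%N; rewrite ?expr0 ?expr1; ring.
Qed.

Lemma ann_one i : ann i (ext_one L m) = 0.
Proof.
apply/ffunP => I; rewrite !ffunE; case: ifP => // _.
case: eqP => [/setP/(_ i)|]; rewrite ?mulr0 //.
by rewrite !inE eqxx.
Qed.

(** The unit and the operators [cre i] generate the exterior algebra, so that
    identities between linear maps only have to be propagated along [cre i]. *)
Lemma ext_ind (P : ext L m -> Prop) :
  (forall a x y, P x -> P y -> P (a *: x + y)) -> P (ext_one L m) ->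
  (forall i x, P x -> P (cre i x)) -> forall x, P x.
Proof.
move=> Plin P1 Pcre.
have P0 : P 0 by rewrite -(subrr (ext_one L m)) addrC -scaleN1r; apply: Plin.
have Pb n I : #|I| = n -> P (ext_basis L I).
  elim: n I => [|n IH] I; first by move/cards0_eq ->.
  case: (set_0Vmem I) => [->|[i iI] cI]; first by rewrite finset.cards0.
  have -> : ext_basis L I = sg i I *: cre i (ext_basis L (I :\ i)%SET) + 0.
    rewrite cre_basis; last by rewrite !inE eqxx.
    by rewrite setD1K // scalerA sgD1id sg_sqr scale1r addr0.
  apply: Plin => //; apply: Pcre; apply: IH.
  by move: cI; rewrite (cardsD1 i) iI => -[].
by apply: ext_basis_ind => // I; apply: Pb.
Qed.

Lemma inversionsE A B : (-1) ^+ inversions A B = \prod_(i in A) sg i B :> L.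
Proof.
rewrite /inversions -sum1_card -prodrXr.
rewrite (eq_bigl (fun p : 'I_m * 'I_m => (p.1 \in A) && ((p.2 \in B) && (p.2 < p.1)%N))); last first.
  by move=> p; rewrite inE.
rewrite -(pair_big_dep (mem A) (fun i k => (k \in B) && (k < i)%N) (fun _ _ => (-1) ^+ 1)) /=.
apply: eq_bigr => i _; rewrite big_mkcondr /= /sg; apply: eq_bigr => k _.
by case: ifP; rewrite ?expr0.
Qed.

Fact wedge_is_linear x : linear (wedge x).
Proof.
move=> a y z; apply/ffunP => I; rewrite ?(ext_addE, ext_scaleE, ffunE).
rewrite mulr_sumr -big_split; apply: eq_bigr => A _.
by rewrite !ffunE mulrDr mulrCA.
Qed.
HB.instance Definition _ x :=
  GRing.isLinear.Build L (ext L m) (ext L m) *:%R (wedge x) (wedge_is_linear x).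

Lemma wedgeDl x y z : wedge (x + y) z = wedge x z + wedge y z.
Proof.
apply/ffunP => I; rewrite ?(ext_addE, ext_scaleE, ffunE).
rewrite -big_split; apply: eq_bigr => A _.
by rewrite !ffunE mulrDr mulrDl.
Qed.

Lemma wedgeZl a x y : wedge (a *: x) y = a *: wedge x y.
Proof.
apply/ffunP => I; rewrite ?(ext_addE, ext_scaleE, ffunE).
rewrite mulr_sumr; apply: eq_bigr => A _.
rewrite ext_scaleE; ring.
Qed.

Lemma wedge0l x : wedge 0 x = 0.
Proof. by have := wedgeZl 0 x x; rewrite !scale0r. Qed.

Lemma wedge_suml (T : Type) (r : seq T) (P : pred T) (f : T -> ext L m) y :
  wedge (\sum_(t <- r | P t) f t) y = \sum_(t <- r | P t) wedge (f t) y.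
Proof. by elim/big_rec2: _ => [|t a b _ <-]; rewrite ?wedge0l ?wedgeDl. Qed.

Lemma wedge1x x : wedge (ext_one L m) x = x.
Proof.
apply/ffunP => I; rewrite ffunE (bigD1 finset.set0) ?finset.sub0set //=.
rewrite big1 => [|A /andP[_ nA]]; last by rewrite ffunE (negPf nA) mulr0 mul0r.
by rewrite ffunE eqxx mulr1 inversionsE big_set0 mul1r finset.setD0 addr0.
Qed.

Lemma wedge_basis1 i x : wedge (ext_basis L [set i]%SET) x = cre i x.
Proof.
apply/ffunP => I; rewrite !ffunE; case: ifP => iI; last first.
  rewrite big1 // => A AI; rewrite ffunE; case: eqP => [eA|]; last by rewrite mulr0 mul0r.
  by move: AI; rewrite eA sub1set iI.
rewrite (bigD1 [set i]%SET) ?sub1set //= big1 => [|A /andP[_ nA]]; last first.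
  by rewrite ffunE (negPf nA) mulr0 mul0r.
by rewrite addr0 ffunE eqxx mulr1 inversionsE big_set1 sgD1id.
Qed.

Lemma wedge_vecE v x : wedge (ext_vec v) x = \sum_i v 0 i *: cre i x.
Proof.
by rewrite wedge_suml; apply: eq_bigr => i _; rewrite wedgeZl wedge_basis1.
Qed.

Lemma wedge_cre i x y : wedge (cre i x) y = cre i (wedge x y).
Proof.
apply/ffunP => I; rewrite !ffunE; case: ifP => iI; last first.
  rewrite big1 // => A AI; rewrite ffunE; case: ifP => [iA|]; last by rewrite mulr0 mul0r.
  by rewrite (subsetP AI _ iA) in iI.
rewrite (bigID (fun A : {set _} => i \in A)) /= [X in _ + X]big1 ?addr0; last first.
  by move=> A /andP[_ /negPf iA]; rewrite ffunE iA mulr0 mul0r.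
rewrite (reindex_onto (fun A => i |: A)%SET (fun A => A :\ i)%SET) /=; last first.
  by move=> A /andP[_ iA]; rewrite setD1K.
rewrite mulr_sumr; apply: eq_big => A.
  rewrite finset.setU11 andbT subUset sub1set iI /= subsetD1.
  congr (_ && _); apply/eqP/idP => [<-|iA]; first by rewrite !inE eqxx.
  by rewrite setU1K.
rewrite finset.setU11 andbT => /andP[]; rewrite subUset sub1set iI /= => AI /eqP eA.
have iA : i \notin A by rewrite -eA !inE eqxx.
rewrite ffunE finset.setU11 setU1K // !inversionsE big_setU1 //=.
have -> : (I :\: (i |: A) = I :\ i :\: A)%SET by rewrite finset.setDDl.
set B := (I :\ i :\: A)%SET.
have -> : sg i I = sg i A * sg i B.
  have -> : I = (i |: (A :|: B))%SET.
    apply/setP => k; rewrite !inE; case: (eqVneq k i) => [->|nki] //=.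
    by have [kA|//] := boolP (k \in A); rewrite (subsetP AI).
  rewrite sgU1id /sg (eq_bigl [predU A & B]) => [|k]; last by rewrite in_setU.
  rewrite bigU //= -setI_eq0; apply/eqP/setP=> k; rewrite !inE.
  by case: (k \in A); rewrite ?andbF.
rewrite sgU1id; ring.
Qed.

Lemma wedgeA x y z : wedge (wedge x y) z = wedge x (wedge y z).
Proof.
elim/ext_ind: x => [a x x' IH IH'||i x IH].
- by rewrite !(wedgeDl, wedgeZl) IH IH'.
- by rewrite !wedge1x.
- by rewrite !wedge_cre IH.
Qed.

Lemma wedgex1 x : wedge x (ext_one L m) = x.
Proof.
elim/ext_ind: x => [a x x' IH IH'||i x IH].
- by rewrite !(wedgeDl, wedgeZl) IH IH'.
- by rewrite wedge1x.
- by rewrite wedge_cre IH.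
Qed.

(** The parity involution, the sign picked up by an element when an odd
    operator passes over it. *)
Definition parity x : ext L m := [ffun I : {set 'I_m} => (-1) ^+ #|I| * x I].

Fact parity_is_linear : linear parity.
Proof.
move=> a y z; apply/ffunP => I; rewrite ?(ext_addE, ext_scaleE, ffunE).
by rewrite mulrDr mulrCA.
Qed.
HB.instance Definition _ :=
  GRing.isLinear.Build L (ext L m) (ext L m) *:%R parity parity_is_linear.

Lemma parity_cre i x : parity (cre i x) = - cre i (parity x).
Proof.
apply/ffunP => I; rewrite !ffunE; case: ifP => iI; last by rewrite ?mulr0 oppr0.
by rewrite [in LHS](cardsD1 i) iI exprS; ring.
Qed.

Lemma parity_ann i x : parity (ann i x) = - ann i (parity x).
Proof.
apply/ffunP => I; rewrite !ffunE; case: ifP => iI; first by rewrite mulr0 oppr0.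
by rewrite cardsU1 iI exprS; ring.
Qed.

Lemma parity_one : parity (ext_one L m) = ext_one L m.
Proof.
apply/ffunP => I; rewrite !ffunE; case: eqP => [->|]; last by rewrite mulr0.
by rewrite cards0 mul1r.
Qed.

Lemma ann_wedge i x y : ann i (wedge x y) = wedge (ann i x) y + wedge (parity x) (ann i y).
Proof.
elim/ext_ind: x => [a x x' IH IH'||k x IH].
- rewrite !linearP !(wedgeDl, wedgeZl) linearP /= IH IH'.
  by rewrite scalerDr addrACA.
- by rewrite parity_one ann_one wedge0l add0r !wedge1x.
- rewrite wedge_cre !ann_cre IH parity_cre linearD /= -!scaleN1r !wedgeDl !wedgeZl !wedge_cre.
  by rewrite scalerDr addrA.
Qed.

Lemma cre_wedge i x y : cre i (wedge x y) = wedge (parity x) (cre i y).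
Proof.
elim/ext_ind: x => [a x x' IH IH'||k x IH].
- by rewrite !linearP !(wedgeDl, wedgeZl) linearP /= IH IH'.
- by rewrite parity_one !wedge1x.
- by rewrite wedge_cre cre_anticomm IH parity_cre -!scaleN1r !wedgeZl !wedge_cre.
Qed.

Lemma contractE u x : contract u x = \sum_i u 0 i *: ann i x.
Proof.
apply/ffunP => I; rewrite ffunE ext_sumE big_mkcond; apply: eq_bigr => i _.
rewrite ext_scaleE ffunE; case: (boolP (i \in I)) => iI /=; first by rewrite mulr0.
by rewrite inversionsE big_set1 mulrA.
Qed.

Fact contract_is_linear u : linear (contract u).
Proof.
move=> a x y; rewrite !contractE scaler_sumr -big_split; apply: eq_bigr => i _.
by rewrite linearP /= scalerDr scalerA mulrC -scalerA.
Qed.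
HB.instance Definition _ u :=
  GRing.isLinear.Build L (ext L m) (ext L m) *:%R (contract u) (contract_is_linear u).

Lemma contract_delta i x : contract (delta_mx 0 i) x = ann i x.
Proof.
rewrite contractE (bigD1 i) //= big1 ?mxE ?eqxx ?addr0 ?scale1r // => k nk.
by rewrite mxE eqxx (negPf nk) scale0r.
Qed.

Lemma wedge_delta i x : wedge (ext_vec (delta_mx 0 i)) x = cre i x.
Proof.
rewrite wedge_vecE (bigD1 i) //= big1 ?mxE ?eqxx ?addr0 ?scale1r // => k nk.
by rewrite mxE eqxx (negPf nk) scale0r.
Qed.

Fact ext_vec_is_linear : linear (@ext_vec L m).
Proof.
move=> a x y; rewrite /ext_vec scaler_sumr -big_split; apply: eq_bigr => i _ /=.
by rewrite !mxE scalerDl scalerA.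
Qed.
HB.instance Definition _ :=
  GRing.isLinear.Build L 'rV[L]_m (ext L m) *:%R (@ext_vec L m) ext_vec_is_linear.

Lemma contractDl u v x : contract (u + v) x = contract u x + contract v x.
Proof.
by rewrite !contractE -big_split; apply: eq_bigr => i _; rewrite mxE scalerDl.
Qed.

Lemma contractZl a u x : contract (a *: u) x = a *: contract u x.
Proof.
by rewrite !contractE scaler_sumr; apply: eq_bigr => i _; rewrite mxE scalerA.
Qed.

Lemma contract_one u : contract u (ext_one L m) = 0.
Proof. by rewrite contractE big1 // => i _; rewrite ann_one scaler0. Qed.

Lemma vec_cre_anticomm v i x :
  wedge (ext_vec v) (cre i x) = - cre i (wedge (ext_vec v) x).
Proof.
rewrite !wedge_vecE linear_sum -sumrN; apply: eq_bigr => k _.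
by rewrite linearZ /= cre_anticomm scalerN.
Qed.

Lemma vec_anticomm v w x :
  wedge (ext_vec v) (wedge (ext_vec w) x) = - wedge (ext_vec w) (wedge (ext_vec v) x).
Proof.
rewrite [in LHS](wedge_vecE w) [in RHS](wedge_vecE w) linear_sum -sumrN.
by apply: eq_bigr => k _; rewrite linearZ /= vec_cre_anticomm scalerN.
Qed.

Lemma contract_cre u i x : contract u (cre i x) = u 0 i *: x - cre i (contract u x).
Proof.
rewrite !contractE.
rewrite (eq_bigr (fun k => (u 0 k * (k == i)%:R) *: x - cre i (u 0 k *: ann k x))); last first.
  by move=> k _; rewrite ann_cre scalerBr scalerA (linearZ_LR (cre i)).
rewrite sumrB -linear_sum -scaler_suml; congr (_ *: _ - _).
by rewrite (bigD1 i) //= eqxx mulr1 big1 ?addr0 // => k /negPf->; rewrite mulr0.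
Qed.

Lemma contract_vec u v x :
  contract u (wedge (ext_vec v) x) =
  (u *m v^T) 0 0 *: x - wedge (ext_vec v) (contract u x).
Proof.
rewrite !wedge_vecE linear_sum mxE scaler_suml -sumrB; apply: eq_bigr => k _.
by rewrite linearZ /= contract_cre scalerBr scalerA mxE [v _ _ * _]mulrC.
Qed.

Lemma parity_vec v x : parity (wedge (ext_vec v) x) = - wedge (ext_vec v) (parity x).
Proof.
rewrite !wedge_vecE linear_sum -sumrN; apply: eq_bigr => i _.
by rewrite linearZ /= parity_cre scalerN.
Qed.

Lemma parity_contract u x : parity (contract u x) = - contract u (parity x).
Proof.
rewrite !contractE linear_sum -sumrN; apply: eq_bigr => i _.
by rewrite linearZ /= parity_ann scalerN.
Qed.

Lemma parityK : involutive parity.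
Proof. by move=> x; apply/ffunP => I; rewrite !ffunE mulrA -expr2 sqrr_sign mul1r. Qed.

Lemma contract0l x : contract 0 x = 0.
Proof. by rewrite contractE big1 // => i _; rewrite mxE scale0r. Qed.

(** Let e_I be a monomial of lowest degree in x.  Multiplying x by the basis
    vectors outside I turns e_I into the top form and kills every other
    monomial, since each of them contains one of these vectors. *)
Lemma top_of_cre_closed (P : ext L m -> Prop) x :
  (forall i x, P x -> P (cre i x)) -> P x -> x <> 0 ->
  exists2 a, a != 0 & P (a *: ext_basis L [set: 'I_m]%SET).
Proof.
move=> Pcre Px x0.
have main n (I : {set 'I_m}) y : #|~: I|%SET = n -> P y -> y I != 0 ->
    (forall J, y J != 0 -> (#|I| <= #|J|)%N) ->
    exists2 a, a != 0 & P (a *: ext_basis L [set: 'I_m]%SET).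
  elim: n I y => [|n IH] I y cI Py yI minI.
    move/eqP: cI; rewrite cards_eq0 => /eqP/(congr1 (@setC _)); rewrite finset.setCK finset.setC0 => eI.
    exists (y I) => //; suff <- : y = y I *: ext_basis L [set: 'I_m]%SET by [].
    apply/ffunP => J; rewrite ext_scaleE ffunE; have [->|nJ] := eqVneq J finset.setT.
      by rewrite eI mulr1.
    rewrite mulr0; apply/eqP; apply: contraNT nJ => /minI.
    by rewrite eI => h; rewrite eqEcard h finset.subsetT.
  have [i iI] : exists i, i \in (~: I)%SET by apply/set0Pn; rewrite -card_gt0 cI.
  have iI' : i \notin I by rewrite inE in iI.
  apply: (IH (i |: I)%SET (cre i y)).
  - by move: cI; rewrite (cardsD1 i) iI finset.setCU finset.setIC -setDE => -[].
  - exact: Pcre.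
  - by rewrite ffunE setU11 setU1K // mulf_neq0 // /sg prodf_seq_neq0; apply/allP => k _; rewrite signr_eq0 implybT.
  - move=> J; rewrite ffunE; case: ifP => iJ; last by rewrite eqxx.
    rewrite mulf_eq0 => /norP[_ /minI].
    by rewrite cardsU1 iI' (cardsD1 i J) iJ !add1n.
have [I0 xI0] : exists I, x I != 0.
  apply/existsP; apply: contraPT x0; rewrite negb_exists => /forallP h; apply.
  by apply/ffunP => I; rewrite [RHS]ffunE; have := h I; rewrite negbK => /eqP.
by case: (@arg_minnP _ I0 (fun I : {set 'I_m} => x I != 0) (fun I : {set 'I_m} => #|I|) xI0) => I xI h; apply: (main _ I x).
Qed.

End FockSpace.

(** * Functoriality of the exterior algebra *)

Section ExtMap.
Variable L : numFieldType.

Lemma vec_sqr m (v : 'rV[L]_m) x : wedge (ext_vec v) (wedge (ext_vec v) x) = 0.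
Proof.
have /eqP := vec_anticomm v v x.
by rewrite -subr_eq0 opprK -mulr2n -scaler_nat scaler_eq0 pnatr_eq0 => /eqP.
Qed.

Lemma enum_ord_sorted m (A : {set 'I_m}) : sorted (fun i k : 'I_m => i < k)%N (enum A).
Proof.
rewrite /enum_mem; apply: sorted_filter; first by move=> i k l; apply: ltn_trans.
have := iota_ltn_sorted 0 m; rewrite -val_enum_ord.
by rewrite sorted_map enumT; apply.
Qed.

Lemma enum_split m (i : 'I_m) (A : {set 'I_m}) : i \in A ->
  exists s1 s2, [/\ enum A = s1 ++ i :: s2, {in s1, forall k : 'I_m, (k < i)%N}
    & {in s2, forall k : 'I_m, (i < k)%N}].
Proof.
rewrite -mem_enum => iA; case/splitPr eA: _ / iA (enum_ord_sorted A) => [s1 s2] so.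
exists s1, s2; split=> // k ks; move: so;
  rewrite sorted_pairwise; try (by move=> ? ? ?; apply: ltn_trans);
  rewrite pairwise_cat /= => /and3P[/allrelP h1 _ /andP[/allP h2 _]].
  by apply: h1; rewrite ?mem_head.
by apply: h2.
Qed.

Lemma wedge_seq_cons m (v : 'rV[L]_m) s : wedge_seq (v :: s) = wedge (ext_vec v) (wedge_seq s).
Proof. by []. Qed.

Lemma wedge_seq_insert m (v : 'rV[L]_m) s1 s2 :
  wedge_seq (s1 ++ v :: s2) = (-1) ^+ size s1 *: wedge (ext_vec v) (wedge_seq (s1 ++ s2)).
Proof.
elim: s1 => [|w s1 IH]; first by rewrite scale1r.
rewrite !cat_cons !wedge_seq_cons IH linearZ /= vec_anticomm scalerN exprS mulN1r.
by rewrite scaleNr.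
Qed.

Variables (m p : nat) (M : 'M[L]_(m, p)).

Let F (A : {set 'I_m}) := wedge_seq [seq row i M | i <- enum A].

Fact ext_map_is_linear : linear (ext_map M).
Proof.
move=> a x y; rewrite /ext_map scaler_sumr -big_split; apply: eq_bigr => A _ /=.
by rewrite ext_addE ext_scaleE scalerDl scalerA.
Qed.
HB.instance Definition _ :=
  GRing.isLinear.Build L (ext L m) (ext L p) *:%R (ext_map M) ext_map_is_linear.

Lemma ext_map_basis A : ext_map M (ext_basis L A) = F A.
Proof.
rewrite /ext_map (bigD1 A) //= ffunE eqxx scale1r big1 ?addr0 // => B nB.
by rewrite ffunE (negPf nB) scale0r.
Qed.

Lemma ext_map_one : ext_map M (ext_one L m) = ext_one L p.
Proof. by rewrite ext_map_basis /F enum_set0. Qed.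

(** If i is in A, a factor is repeated and both sides vanish; otherwise moving
    row i to its place in the sorted product costs exactly the sign [sg i A]. *)
Lemma ext_map_cre i x : ext_map M (cre i x) = wedge (ext_vec (row i M)) (ext_map M x).
Proof.
elim/ext_basis_ind: x => [a x y IH IH'|A]; first by rewrite !linearP /= IH IH'.
rewrite ext_map_basis /F.
have [iA|iA] := boolP (i \in A).
  have [s1 [s2 [-> _ _]]] := enum_split iA.
  rewrite map_cat /= wedge_seq_insert linearZ /= vec_sqr scaler0.
  rewrite (_ : cre i _ = 0) ?linear0 //; apply/ffunP => I; rewrite !ffunE.
  case: ifP => // _; case: eqP => [e|]; rewrite ?mulr0 //.
  by move: iA; rewrite -e !inE eqxx.
rewrite cre_basis // linearZ /= ext_map_basis /F.
have iA' : i \in (i |: A)%SET by rewrite setU11.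
have [s1 [s2 [e h1 h2]]] := enum_split iA'.
have u : uniq (s1 ++ i :: s2) by rewrite -e enum_uniq.
have eA : enum A = s1 ++ s2.
  have -> : enum A = [seq k <- enum (i |: A)%SET | k != i].
    rewrite /enum_mem -filter_predI; apply: eq_filter => k /=; rewrite !inE.
    by case: eqVneq => // ->; rewrite (negPf iA).
  move: u; rewrite e filter_cat /= eqxx cat_uniq /= => /and3P[_ u1 /andP[u2 _]].
  congr (_ ++ _); apply/all_filterP/allP => k ks; apply/eqP => ki; subst k.
    by rewrite ks in u1.
  by rewrite ks in u2.
have -> : sg L i A = (-1) ^+ size s1.
  rewrite /sg -big_enum /= eA big_cat /= [X in _ * X]big_seq [X in _ * X]big1.
    rewrite mulr1 big_seq (eq_bigr (fun _ => -1)) => [|k /h1 ->] //.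
    by rewrite -big_seq big_const_seq count_predT -Monoid.iteropE.
  by move=> k /h2 h; rewrite ltnNge (ltnW h).
rewrite e eA map_cat /= wedge_seq_insert size_map scalerA -expr2 sqrr_sign scale1r.
by rewrite map_cat.
Qed.

Lemma ext_map_vec v x : ext_map M (wedge (ext_vec v) x) = wedge (ext_vec (v *m M)) (ext_map M x).
Proof.
have -> : ext_vec (v *m M) = \sum_i v 0 i *: ext_vec (row i M).
  by rewrite mulmx_sum_row linear_sum; apply: eq_bigr => i _; rewrite linearZ.
rewrite wedge_vecE linear_sum wedge_suml; apply: eq_bigr => i _.
by rewrite linearZ /= ext_map_cre wedgeZl.
Qed.

(** Both sides satisfy the same commutation rule with exterior multiplication
    and vanish on the unit. *)
Lemma ext_map_contract u x :
  contract u (ext_map M x) = ext_map M (contract (u *m M^T) x).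
Proof.
elim/ext_ind: x => [a x y IH IH'||i x IH].
- by rewrite !linearP /= IH IH'.
- by rewrite ext_map_one !contract_one linear0.
- rewrite ext_map_cre contract_vec IH contract_cre linearB linearZ /= ext_map_cre.
  by congr (_ *: _ - _); rewrite !mxE; apply: eq_bigr => k _; rewrite !mxE.
Qed.

Lemma ext_map_parity x : ext_map M (parity x) = parity (ext_map M x).
Proof.
elim/ext_ind: x => [a x x' IH IH'||i x IH].
- by rewrite !linearP /= IH IH'.
- by rewrite parity_one ext_map_one parity_one.
- by rewrite parity_cre linearN /= !ext_map_cre IH parity_vec.
Qed.

Lemma ext_map_ext_vec v : ext_map M (ext_vec v) = ext_vec (v *m M).
Proof.
by rewrite -(wedgex1 (ext_vec v)) ext_map_vec ext_map_one wedgex1.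
Qed.

Lemma ext_map_seq s : ext_map M (wedge_seq s) = wedge_seq [seq v *m M | v <- s].
Proof.
elim: s => [|v s IH]; first exact: ext_map_one.
by rewrite wedge_seq_cons ext_map_vec IH.
Qed.

End ExtMap.

Lemma ext_map_comp (L : numFieldType) m p q (M : 'M[L]_(m, p)) (M' : 'M[L]_(p, q)) x :
  ext_map M' (ext_map M x) = ext_map (M *m M') x.
Proof.
elim/ext_ind: x => [a x x' IH IH'||i x IH].
- by rewrite !linearP /= IH IH'.
- by rewrite !ext_map_one.
- by rewrite !ext_map_cre ext_map_vec IH row_mul.
Qed.

Lemma ext_map1 (L : numFieldType) m (x : ext L m) : ext_map 1%:M x = x.
Proof.
elim/ext_ind: x => [a x x' IH IH'||i x IH].
- by rewrite !linearP /= IH IH'.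
- by rewrite !ext_map_one.
- by rewrite !ext_map_cre IH row1 wedge_delta.
Qed.

(** * The exterior algebra of a direct sum *)

Section Product.
Variables (L : numFieldType) (N : nat).
Implicit Types (x y : ext L N) (z : ext L (N + N)) (I J : {set 'I_N}) (i : 'I_N).

Local Notation lft := (lshift N).
Local Notation rgt := (@rshift N N).

(** The set whose monomial is e_I (x) e_J: no sign occurs, as the indices of the
    first summand come first. *)
Definition sum_set I J : {set 'I_(N + N)} := (lshift N @: I :|: @rshift N N @: J)%SET.

Lemma mem_sum_set_l i I J : (lft i \in sum_set I J) = (i \in I).
Proof.
rewrite inE mem_imset; last exact: lshift_inj.
by apply/orb_idr => /imsetP[j _ /eqP]; rewrite eq_lrshift.
Qed.

Lemma mem_sum_set_r i I J : (rgt i \in sum_set I J) = (i \in J).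
Proof.
rewrite inE orbC mem_imset; last exact: rshift_inj.
by apply/orb_idr => /imsetP[j _ /eqP]; rewrite eq_rlshift.
Qed.

Lemma sum_setP (K1 K2 : {set 'I_(N + N)}) :
  (forall i, (lft i \in K1) = (lft i \in K2)) ->
  (forall i, (rgt i \in K1) = (rgt i \in K2)) -> K1 = K2.
Proof. by move=> h1 h2; apply/setP => k; case: (split_ordP k) => i ->. Qed.

Lemma sum_set_surj (K : {set 'I_(N + N)}) :
  K = sum_set [set i | lft i \in K]%SET [set i | rgt i \in K]%SET.
Proof. by apply: sum_setP => i; rewrite ?mem_sum_set_l ?mem_sum_set_r inE. Qed.

Lemma sum_set_eq I J I' J' : (sum_set I J == sum_set I' J') = (I == I') && (J == J').
Proof.
apply/eqP/andP => [/setP e|[/eqP-> /eqP->]//].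
split; apply/eqP/setP => i; first by have := e (lft i); rewrite !mem_sum_set_l.
by have := e (rgt i); rewrite !mem_sum_set_r.
Qed.

Lemma sum_setD1l i I J : (sum_set I J :\ lft i)%SET = sum_set (I :\ i)%SET J.
Proof.
apply: sum_setP => k; rewrite in_setD1 ?mem_sum_set_l ?mem_sum_set_r ?in_setD1.
  by rewrite (inj_eq (@lshift_inj _ _)).
by rewrite eq_rlshift.
Qed.

Lemma sum_setD1r i I J : (sum_set I J :\ rgt i)%SET = sum_set I (J :\ i)%SET.
Proof.
apply: sum_setP => k; rewrite in_setD1 ?mem_sum_set_l ?mem_sum_set_r ?in_setD1.
  by rewrite eq_lrshift.
by rewrite (inj_eq (@rshift_inj _ _)).
Qed.

Lemma prod_sum_set (f : 'I_(N + N) -> L) I J :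
  \prod_(k in sum_set I J) f k = (\prod_(i in I) f (lft i)) * \prod_(j in J) f (rgt j).
Proof.
rewrite big_mkcond big_split_ord [in RHS]big_mkcond [in X in _ = _ * X]big_mkcond /=.
by congr (_ * _); apply: eq_bigr => i _; rewrite ?mem_sum_set_l ?mem_sum_set_r.
Qed.

Lemma sg_sum_set_l i I J : sg L (lft i) (sum_set I J) = sg L i I.
Proof.
rewrite /sg prod_sum_set [X in _ * X]big1 ?mulr1 // => k _ /=.
by rewrite ltnNge ltnW // (leq_trans (ltn_ord i)) ?leq_addr.
Qed.

Lemma sg_sum_set_r i I J : sg L (rgt i) (sum_set I J) = (-1) ^+ #|I| * sg L i J.
Proof.
rewrite /sg prod_sum_set; congr (_ * _); last by apply: eq_bigr => k _ /=; rewrite ltn_add2l.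
rewrite (eq_bigr (fun _ => -1)) ?prodr_const // => k _ /=.
by rewrite (leq_trans (ltn_ord k)) ?leq_addr.
Qed.

Fact pull1_is_linear : linear (@pull1 L N).
Proof. exact: ext_map_is_linear. Qed.
HB.instance Definition _ :=
  GRing.isLinear.Build L (ext L N) (ext L (N + N)) *:%R (@pull1 L N) pull1_is_linear.

Fact pull2_is_linear : linear (@pull2 L N).
Proof. exact: ext_map_is_linear. Qed.
HB.instance Definition _ :=
  GRing.isLinear.Build L (ext L N) (ext L (N + N)) *:%R (@pull2 L N) pull2_is_linear.

Lemma pull1_cre i x : pull1 (cre i x) = cre (lft i) (pull1 x).
Proof.
rewrite /pull1 ext_map_cre row_row_mx row1 row0 -wedge_delta; congr (wedge (ext_vec _) _).
apply/rowP => k; case: (split_ordP k) => l ->; rewrite ?row_mxEl ?row_mxEr !mxE ?eqxx /=.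
  by rewrite (inj_eq (@lshift_inj _ _)).
by rewrite eq_rlshift.
Qed.

Lemma pull2_cre i x : pull2 (cre i x) = cre (rgt i) (pull2 x).
Proof.
rewrite /pull2 ext_map_cre row_row_mx row1 row0 -wedge_delta; congr (wedge (ext_vec _) _).
apply/rowP => k; case: (split_ordP k) => l ->; rewrite ?row_mxEl ?row_mxEr !mxE ?eqxx /=.
  by rewrite eq_lrshift.
by rewrite (inj_eq (@rshift_inj _ _)).
Qed.

Lemma contract_pull1 u u' x : contract (row_mx u u') (pull1 x) = pull1 (contract u x).
Proof.
by rewrite /pull1 ext_map_contract tr_row_mx trmx1 trmx0 mul_row_col mulmx1 mulmx0 addr0.
Qed.

Lemma contract_pull2 u u' x : contract (row_mx u u') (pull2 x) = pull2 (contract u' x).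
Proof.
by rewrite /pull2 ext_map_contract tr_row_mx trmx1 trmx0 mul_row_col mulmx1 mulmx0 add0r.
Qed.

Lemma delta_lft i : delta_mx 0 (lft i) = row_mx (delta_mx 0 i) 0 :> 'rV[L]_(N + N).
Proof.
apply/rowP => k; case: (split_ordP k) => l ->; rewrite ?row_mxEl ?row_mxEr !mxE ?eqxx /=.
  by rewrite (inj_eq (@lshift_inj _ _)).
by rewrite eq_rlshift.
Qed.

Lemma delta_rgt i : delta_mx 0 (rgt i) = row_mx 0 (delta_mx 0 i) :> 'rV[L]_(N + N).
Proof.
apply/rowP => k; case: (split_ordP k) => l ->; rewrite ?row_mxEl ?row_mxEr !mxE ?eqxx /=.
  by rewrite eq_lrshift.
by rewrite (inj_eq (@rshift_inj _ _)).
Qed.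

Lemma ann_pull1l i x : ann (lft i) (pull1 x) = pull1 (ann i x).
Proof. by rewrite -!contract_delta delta_lft contract_pull1. Qed.

Lemma ann_pull1r i x : ann (rgt i) (pull1 x) = 0.
Proof. by rewrite -!contract_delta delta_rgt contract_pull1 contract0l linear0. Qed.

Lemma ann_pull2r i x : ann (rgt i) (pull2 x) = pull2 (ann i x).
Proof. by rewrite -!contract_delta delta_rgt contract_pull2. Qed.

Lemma ann_pull2l i x : ann (lft i) (pull2 x) = 0.
Proof. by rewrite -!contract_delta delta_lft contract_pull2 contract0l linear0. Qed.

Lemma ext_prodDl x x' y : ext_prod (x + x') y = ext_prod x y + ext_prod x' y.
Proof. by rewrite /ext_prod linearD wedgeDl. Qed.

Lemma ext_prodZl a x y : ext_prod (a *: x) y = a *: ext_prod x y.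
Proof. by rewrite /ext_prod linearZ wedgeZl. Qed.

Fact ext_prod_is_linear x : linear (ext_prod x).
Proof. by move=> a y y'; rewrite /ext_prod !linearP. Qed.
HB.instance Definition _ x :=
  GRing.isLinear.Build L (ext L N) (ext L (N + N)) *:%R (ext_prod x) (ext_prod_is_linear x).

Lemma ext_prod_suml (T : Type) (r : seq T) (P : pred T) (f : T -> ext L N) y :
  ext_prod (\sum_(t <- r | P t) f t) y = \sum_(t <- r | P t) ext_prod (f t) y.
Proof. by rewrite /ext_prod (linear_sum (@pull1 L N)) wedge_suml. Qed.

Lemma ext_prod_cre_l i x y : ext_prod (cre i x) y = cre (lft i) (ext_prod x y).
Proof. by rewrite /ext_prod pull1_cre wedge_cre. Qed.

Lemma ext_prod_cre_r i x y : ext_prod (parity x) (cre i y) = cre (rgt i) (ext_prod x y).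
Proof. by rewrite /ext_prod pull2_cre cre_wedge /pull1 ext_map_parity. Qed.

Lemma ext_prod_ann_l i x y : ext_prod (ann i x) y = ann (lft i) (ext_prod x y).
Proof. by rewrite /ext_prod ann_wedge ann_pull1l ann_pull2l linear0 addr0. Qed.

Lemma ext_prod_ann_r i x y : ext_prod (parity x) (ann i y) = ann (rgt i) (ext_prod x y).
Proof. by rewrite /ext_prod ann_wedge ann_pull1r ann_pull2r wedge0l add0r /pull1 ext_map_parity. Qed.

Lemma ext_prod_one : ext_prod (ext_one L N) (ext_one L N) = ext_one L (N + N).
Proof. by rewrite /ext_prod /pull1 /pull2 !ext_map_one wedge1x. Qed.

Lemma ext_prodE x y I J : ext_prod x y (sum_set I J) = x I * y J.
Proof.
elim/ext_ind: x I J => [a x x' IH IH'||i x IH] I J.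
- by rewrite ext_prodDl ext_prodZl !(ext_addE, ext_scaleE) IH IH' mulrDl mulrA.
- elim/ext_ind: y I J => [a y y' IH IH'||i y IH] I J.
  + by rewrite linearP !(ext_addE, ext_scaleE) IH IH' mulrDr mulrCA.
  + rewrite ext_prod_one !ffunE (_ : finset.set0 = sum_set finset.set0 finset.set0).
      by rewrite sum_set_eq -mulnb natrM.
    by apply: sum_setP => i; rewrite ?mem_sum_set_l ?mem_sum_set_r !inE.
  + rewrite -parity_one ext_prod_cre_r parity_one ffunE [in X in _ = _ * X]ffunE mem_sum_set_r.
    case: ifP => iJ; last by rewrite mulr0.
    rewrite sum_setD1r IH sg_sum_set_r !ffunE; case: eqP => [->|_]; last by rewrite !mul0r mulr0.
    by rewrite cards0 !mul1r.
- rewrite ext_prod_cre_l ffunE [in X in _ = X * _]ffunE mem_sum_set_l; case: ifP => iI; last by rewrite mul0r.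
  by rewrite sum_setD1l IH sg_sum_set_l mulrA.
Qed.

(** Every monomial of the sum is a product, so products span. *)
Lemma ext_prod_ind (P : ext L (N + N) -> Prop) :
  (forall a z z', P z -> P z' -> P (a *: z + z')) ->
  (forall x y, P (ext_prod x y)) -> forall z, P z.
Proof.
move=> Plin Pb; apply: ext_basis_ind => // K.
have -> : ext_basis L K = ext_prod (ext_basis L [set i | lft i \in K]%SET)
                                   (ext_basis L [set i | rgt i \in K]%SET).
  apply/ffunP => K'; rewrite (sum_set_surj K') ext_prodE [in LHS](sum_set_surj K) !ffunE sum_set_eq.
  by rewrite -mulnb natrM.
exact: Pb.
Qed.

Fact id_tensor_is_linear (f : ext L N -> ext L N) : linear (id_tensor f).
Proof.
move=> a z z'; rewrite /id_tensor scaler_sumr -big_split; apply: eq_bigr => I _ /=.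
rewrite scaler_sumr -big_split; apply: eq_bigr => J _ /=.
by rewrite ext_addE ext_scaleE scalerDl scalerA.
Qed.
HB.instance Definition _ f :=
  GRing.isLinear.Build L (ext L (N + N)) (ext L (N + N)) *:%R (id_tensor f) (id_tensor_is_linear f).

Lemma id_tensor_prod (f : {linear ext L N -> ext L N}) x y :
  id_tensor f (ext_prod x y) = ext_prod x (f y).
Proof.
rewrite [in RHS](ext_basisE x) ext_prod_suml; apply: eq_bigr => I _.
rewrite ext_prodZl [in RHS](ext_basisE y) (linear_sum f) linear_sum scaler_sumr.
apply: eq_bigr => J _; rewrite -/(sum_set I J) ext_prodE (linearZ_LR f).
by rewrite (linearZ_LR (ext_prod _)) scalerA; reflexivity.
Qed.

Fact push2_is_linear : linear (@push2 L N).
Proof. by move=> a x y; apply/ffunP => J; rewrite !(ext_addE, ext_scaleE, ffunE). Qed.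
HB.instance Definition _ :=
  GRing.isLinear.Build L (ext L (N + N)) (ext L N) *:%R (@push2 L N) push2_is_linear.

Lemma push2_prod x y : push2 (ext_prod x y) = x [set: 'I_N]%SET *: y.
Proof. by apply/ffunP => J; rewrite ffunE -/(sum_set _ J) ext_prodE ext_scaleE. Qed.

Lemma push2_cre_r i z : push2 (cre (rgt i) z) = (-1) ^+ N *: cre i (push2 z).
Proof.
elim/ext_prod_ind: z => [a z z' IH IH'|x y].
  rewrite (linearP (cre (rgt i))) !(linearP (@push2 L N)) /= IH IH' (linearP (cre i)) /=.
  by rewrite scalerDr !scalerA mulrC.
by rewrite -ext_prod_cre_r !push2_prod ffunE cardsT card_ord linearZ /= scalerA.
Qed.

Lemma push2_ann_r i z : push2 (ann (rgt i) z) = (-1) ^+ N *: ann i (push2 z).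
Proof.
elim/ext_prod_ind: z => [a z z' IH IH'|x y].
  rewrite (linearP (ann (rgt i))) !(linearP (@push2 L N)) /= IH IH' (linearP (ann i)) /=.
  by rewrite scalerDr !scalerA mulrC.
by rewrite -ext_prod_ann_r !push2_prod ffunE cardsT card_ord linearZ /= scalerA.
Qed.

Lemma push2_ann_l i z : push2 (ann (lft i) z) = 0.
Proof. by apply/ffunP => J; rewrite !ffunE -/(sum_set _ J) mem_sum_set_l inE. Qed.

End Product.

(** * The Fourier transform and the inverse of phi *)

Section Fourier.
Variables (L : numFieldType) (N : nat).
Implicit Types (x y : ext L N) (z : ext L (N + N)) (I J : {set 'I_N}) (i : 'I_N).

Local Notation lft := (lshift N).
Local Notation rgt := (@rshift N N).
Local Notation c1 := (c1_poincare L N).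
Local Notation pw k := (iter k (wedge c1) (ext_one L (N + N))).

Lemma wedge_c1 z : wedge c1 z = \sum_(i < N) cre (rgt i) (cre (lft i) z).
Proof.
rewrite wedge_suml; apply: eq_bigr => i _; rewrite /pull1 /pull2 !ext_map_ext_vec.
rewrite !mul_mx_row !mulmx0 !mulmx1 -delta_lft -delta_rgt.
by rewrite wedgeA !wedge_delta.
Qed.

(** Contraction is an odd derivation and c1 is even, so contraction of a power
    of c1 obeys the usual rule for derivatives; this and [ann_l_c1] give the
    derivatives of c1 itself. *)
Lemma ann_r_c1 i z : ann (rgt i) (wedge c1 z) = cre (lft i) z + wedge c1 (ann (rgt i) z).
Proof.
rewrite !wedge_c1 linear_sum /=.
rewrite (eq_bigr (fun k => (i == k)%:R *: cre (lft k) z + cre (rgt k) (cre (lft k) (ann (rgt i) z)))).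
  rewrite big_split; congr (_ + _); rewrite (bigD1 i) //= eqxx scale1r big1 ?addr0 // => k nk.
  by rewrite eq_sym (negPf nk) scale0r.
move=> k _; rewrite ann_cre (inj_eq (@rshift_inj _ _)) ann_cre eq_rlshift scale0r add0r.
by rewrite linearN opprK.
Qed.

Lemma ann_l_c1 i z : ann (lft i) (wedge c1 z) = - cre (rgt i) z + wedge c1 (ann (lft i) z).
Proof.
rewrite !wedge_c1 linear_sum /=.
rewrite (eq_bigr (fun k => - ((i == k)%:R *: cre (rgt k) z) + cre (rgt k) (cre (lft k) (ann (lft i) z)))).
  rewrite big_split; congr (_ + _); rewrite (bigD1 i) //= eqxx scale1r big1 ?addr0 // => k nk.
  by rewrite eq_sym (negPf nk) scale0r oppr0.
move=> k _; rewrite ann_cre eq_lrshift scale0r add0r ann_cre (inj_eq (@lshift_inj _ _)).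
by rewrite linearB linearZ opprB addrC.
Qed.

Lemma cre_c1 k z : cre k (wedge c1 z) = wedge c1 (cre k z).
Proof.
rewrite !wedge_c1 linear_sum; apply: eq_bigr => i _ /=.
by rewrite cre_anticomm [cre k (cre (lft i) _)]cre_anticomm linearN opprK.
Qed.

Lemma ann_r_pow i k : ann (rgt i) (pw k) = k%:R *: cre (lft i) (pw k.-1).
Proof.
elim: k => [|k IH] /=; first by rewrite ann_one scale0r.
rewrite ann_r_c1 IH linearZ /= -cre_c1 -natr1 scalerDl scale1r addrC; congr (_ + _).
by case: k {IH} => [|k]; rewrite ?scale0r.
Qed.

Lemma ann_l_pow i k : ann (lft i) (pw k) = - (k%:R *: cre (rgt i) (pw k.-1)).
Proof.
elim: k => [|k IH] /=; first by rewrite ann_one scale0r oppr0.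
rewrite ann_l_c1 IH linearN linearZ /= -cre_c1 -natr1 scalerDl scale1r opprD addrC.
by congr (_ + _); case: k {IH} => [|k]; rewrite ?scale0r.
Qed.

(** The k-th power of c1 has degree 2k, too large when k is at least N + N. *)
Lemma pow_top k : (0 < N)%N -> (N + N <= k)%N -> pw k = 0.
Proof.
move=> N0 kN.
have cre_deg n (l : 'I_(N + N)) z : (forall K, z K != 0 -> #|K| = n) ->
    forall K, cre l z K != 0 -> #|K| = n.+1.
  move=> h K; rewrite ffunE; case: ifP => lK; last by rewrite eqxx.
  by rewrite mulf_eq0 => /norP[_ /h]; rewrite (cardsD1 l K) lK => ->.
have deg j K : pw j K != 0 -> #|K| = j.*2.
  elim: j K => [|j IH] K /=.
    by rewrite ffunE; case: (eqVneq K finset.set0) => [->|]; rewrite ?cards0 ?eqxx.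
  rewrite -/(pw j) wedge_c1 ext_sumE => nz.
  have [i h] : exists i : 'I_N, cre (rgt i) (cre (lft i) (pw j)) K != 0.
    apply/existsP; apply: contraNT nz; rewrite negb_exists => /forallP h.
    by rewrite big1 // => i _; have := h i; rewrite negbK => /eqP.
  by rewrite doubleS; apply: (cre_deg _ _ _ _ _ h); apply: cre_deg.
apply/ffunP => K; rewrite ffunE; apply/eqP/negP => /negP /deg cK.
have := max_card (mem K); rewrite cK card_ord => le.
have := leq_trans le kN; rewrite -addnn -[X in (_ <= X)%N]addn0 leq_add2l leqn0 => /eqP k0.
by move: kN; rewrite k0 leqn0 addn_eq0 (gtn_eqF N0).
Qed.

Local Notation E := (ext_exp c1).

(** The derivative of the exponential series is the series shifted by one; the
    term lost to the truncation at N + N vanishes by [pow_top]. *)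
Lemma exp_shift (f : {linear ext L (N + N) -> ext L (N + N)}) : (0 < N)%N ->
  \sum_(k < (N + N).+1) (k`!%:R : L)^-1 *: (k%:R *: f (pw k.-1)) = f E.
Proof.
move=> N0; rewrite /ext_exp big_ord_recl /= scale0r scaler0 add0r linear_sum.
rewrite big_ord_recr /= pow_top // scaler0 linear0 addr0; apply: eq_bigr => k _ /=.
rewrite (linearZ_LR f) scalerA /bump /= add0n add1n factS natrM invfM mulrAC.
by rewrite mulVf ?mul1r ?pnatr_eq0.
Qed.

Lemma ann_r_exp i : ann (rgt i) E = cre (lft i) E.
Proof.
rewrite -(exp_shift (cre (lft i))); last exact: leq_trans (ltn_ord i).
by rewrite /ext_exp linear_sum; apply: eq_bigr => k _; rewrite (linearZ_LR (ann (rgt i))) /= ann_r_pow.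
Qed.

Lemma ann_l_exp i : ann (lft i) E = - cre (rgt i) E.
Proof.
rewrite -(exp_shift (cre (rgt i))); last exact: leq_trans (ltn_ord i).
rewrite -sumrN [in LHS]/ext_exp linear_sum; apply: eq_bigr => k _.
by rewrite (linearZ_LR (ann (lft i))) /= ann_l_pow scalerN.
Qed.

Fact phi_poincare_is_linear : linear (@phi_poincare L N).
Proof. by move=> a x y; rewrite /phi_poincare linearP wedgeDl wedgeZl linearP. Qed.
HB.instance Definition _ :=
  GRing.isLinear.Build L (ext L N) (ext L N) *:%R (@phi_poincare L N) phi_poincare_is_linear.

Hypothesis evenN : ~~ odd N.

Let sgnN : (-1) ^+ N = 1 :> L.
Proof. by rewrite -signr_odd (negPf evenN). Qed.

(** Multiplication by e_i of the first factor is the contraction of the kernel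
    along the second factor, which commutes with the integral up to (-1)^N.  In
    [phi_poincare_ann] the contraction is integrated by parts instead. *)
Lemma phi_poincare_cre i x : phi_poincare (cre i x) = ann i (phi_poincare x).
Proof.
rewrite /phi_poincare pull1_cre wedge_cre cre_wedge -ann_r_exp.
rewrite -[RHS]scale1r -sgnN -push2_ann_r ann_wedge ann_pull1r wedge0l add0r.
by [].
Qed.

Lemma phi_poincare_ann i x : phi_poincare (ann i x) = cre i (phi_poincare x).
Proof.
rewrite /phi_poincare -[RHS]scale1r -sgnN -push2_cre_r cre_wedge.
apply/eqP; rewrite -subr_eq0 -(raddfB (@push2 L N)) -(raddfN (wedge (parity (pull1 x)))) -ann_l_exp -ann_pull1l -ann_wedge.
by rewrite /= push2_ann_l.
Qed.

(** On the top form every positive power of c1 vanishes, so only the constant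
    term of the exponential contributes. *)
Lemma phi_poincare_top : phi_poincare (ext_basis L [set: 'I_N]%SET) = ext_one L N.
Proof.
have h i : cre i (ext_basis L [set: 'I_N]%SET) = 0.
  apply/ffunP => I; rewrite !ffunE; case: ifP => // iI; case: eqP => [/setP/(_ i)|]; rewrite ?mulr0 //.
  by rewrite !inE eqxx.
have h2 z : wedge (pull1 (ext_basis L [set: 'I_N]%SET)) (wedge c1 z) = 0.
  rewrite wedge_c1 linear_sum big1 // => i _ /=.
  rewrite cre_anticomm linearN /= -[pull1 _]parityK -cre_wedge -wedge_cre.
  by rewrite -[cre _ (parity _)]opprK -parity_cre -pull1_cre h !linear0 ?oppr0 wedge0l ?oppr0.
rewrite /phi_poincare /ext_exp linear_sum big_ord_recl big1 ?addr0 => [|k _]; last first.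
  by rewrite linearZ /= h2 scaler0.
rewrite linearZ /= invr1 scale1r wedgex1.
rewrite -[pull1 _]wedgex1 -(ext_map_one (row_mx 0 1%:M)) -/(ext_prod _ _) push2_prod.
by rewrite ffunE eqxx scale1r.
Qed.

(** The isomorphism of which phi is the inverse. *)
Definition Phi : ext L (N + N) -> ext L (N + N) := @mu_push L N \o id_tensor (@phi_poincare L N).

Local Notation T := (id_tensor (@phi_poincare L N)).

Lemma id_phi_cre_l i z : T (cre (lft i) z) = cre (lft i) (T z).
Proof.
elim/ext_prod_ind: z => [a z z' IH IH'|x y]; first by rewrite !linearP /= IH IH'.
by rewrite -ext_prod_cre_l !id_tensor_prod ext_prod_cre_l.
Qed.

Lemma id_phi_ann_l i z : T (ann (lft i) z) = ann (lft i) (T z).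
Proof.
elim/ext_prod_ind: z => [a z z' IH IH'|x y]; first by rewrite !linearP /= IH IH'.
by rewrite -ext_prod_ann_l !id_tensor_prod ext_prod_ann_l.
Qed.

Lemma id_phi_cre_r i z : T (cre (rgt i) z) = ann (rgt i) (T z).
Proof.
elim/ext_prod_ind: z => [a z z' IH IH'|x y]; first by rewrite !linearP /= IH IH'.
by rewrite -ext_prod_cre_r !id_tensor_prod /= phi_poincare_cre ext_prod_ann_r.
Qed.

Lemma id_phi_ann_r i z : T (ann (rgt i) z) = cre (rgt i) (T z).
Proof.
elim/ext_prod_ind: z => [a z z' IH IH'|x y]; first by rewrite !linearP /= IH IH'.
by rewrite -ext_prod_ann_r !id_tensor_prod /= phi_poincare_ann ext_prod_cre_r.
Qed.

Lemma vec_row_mx (w t : 'rV[L]_N) z : wedge (ext_vec (row_mx w t)) z =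
  \sum_i w 0 i *: cre (lft i) z + \sum_i t 0 i *: cre (rgt i) z.
Proof.
by rewrite wedge_vecE big_split_ord; congr (_ + _); apply: eq_bigr => i _; rewrite ?row_mxEl ?row_mxEr.
Qed.

Lemma contract_row_mx (w t : 'rV[L]_N) z : contract (row_mx w t) z =
  \sum_i w 0 i *: ann (lft i) z + \sum_i t 0 i *: ann (rgt i) z.
Proof.
by rewrite contractE big_split_ord; congr (_ + _); apply: eq_bigr => i _; rewrite ?row_mxEl ?row_mxEr.
Qed.

Lemma id_phi_vec (w t : 'rV[L]_N) z : T (wedge (ext_vec (row_mx w t)) z) =
  wedge (ext_vec (row_mx w 0)) (T z) + contract (row_mx 0 t) (T z).
Proof.
rewrite !vec_row_mx contract_row_mx linearD !linear_sum /=.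
rewrite [X in _ = (_ + X) + _]big1 => [|i _]; last by rewrite mxE scale0r.
rewrite [X in _ = _ + (X + _)]big1 => [|i _]; last by rewrite mxE scale0r.
by rewrite addr0 add0r; congr (_ + _); apply: eq_bigr => i _; rewrite linearZ /= ?id_phi_cre_l ?id_phi_cre_r.
Qed.

Lemma id_phi_contract (t w : 'rV[L]_N) z : T (contract (row_mx t w) z) =
  contract (row_mx t 0) (T z) + wedge (ext_vec (row_mx 0 w)) (T z).
Proof.
rewrite !contract_row_mx vec_row_mx linearD !linear_sum /=.
rewrite [X in _ = (_ + X) + _]big1 => [|i _]; last by rewrite mxE scale0r.
rewrite [X in _ = _ + (X + _)]big1 => [|i _]; last by rewrite mxE scale0r.
by rewrite addr0 add0r; congr (_ + _); apply: eq_bigr => i _; rewrite linearZ /= ?id_phi_ann_l ?id_phi_ann_r.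
Qed.

Fact mu_push_is_linear : linear (@mu_push L N).
Proof. exact: ext_map_is_linear. Qed.
HB.instance Definition _ :=
  GRing.isLinear.Build L (ext L (N + N)) (ext L (N + N)) *:%R (@mu_push L N) mu_push_is_linear.
HB.instance Definition _ := GRing.Linear.copy Phi (@mu_push L N \o T).

Lemma mu_push_vec (w t : 'rV[L]_N) z :
  mu_push (wedge (ext_vec (row_mx w t)) z) = wedge (ext_vec (row_mx w (t - w))) (mu_push z).
Proof.
by rewrite /mu_push ext_map_vec mul_row_block mulmxN !mulmx1 mulmx0 addr0 [- w + t]addrC.
Qed.

Lemma mu_push_contract (t w : 'rV[L]_N) z :
  mu_push (contract (row_mx t w) z) = contract (row_mx (t + w) w) (mu_push z).
Proof.
rewrite /mu_push ext_map_contract tr_block_mx !trmx1 trmx0 linearN /= trmx1 mul_row_block.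
by rewrite !mulmx1 mulmxN mulmx1 mulmx0 add0r addrK.
Qed.

Lemma PhiE z : Phi z = mu_push (T z).
Proof. by []. Qed.

Lemma Phi_vec (w t : 'rV[L]_N) z : Phi (wedge (ext_vec (row_mx w t)) z) =
  wedge (ext_vec (row_mx w (- w))) (Phi z) + contract (row_mx t t) (Phi z).
Proof.
by rewrite !PhiE id_phi_vec (raddfD (@mu_push L N)) /= mu_push_vec mu_push_contract sub0r add0r.
Qed.

Lemma Phi_contract (t w : 'rV[L]_N) z : Phi (contract (row_mx t w) z) =
  contract (row_mx t 0) (Phi z) + wedge (ext_vec (row_mx 0 w)) (Phi z).
Proof.
by rewrite !PhiE id_phi_contract (raddfD (@mu_push L N)) /= mu_push_vec mu_push_contract subr0 addr0.
Qed.

Lemma wedge_vecD m (u v : 'rV[L]_m) (x : ext L m) :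
  wedge (ext_vec u) x + wedge (ext_vec v) x = wedge (ext_vec (u + v)) x.
Proof. by rewrite linearD wedgeDl. Qed.

(** The action of v = (w, t) on the first factor of X x X, transported to the
    exterior algebra of V; [row_mx t w] is the linear form (v, .). *)
Lemma Phi_left (w t : 'rV[L]_N) z :
  Phi (wedge (ext_vec (row_mx w 0)) z + contract (row_mx t w) z) =
  wedge (ext_vec (row_mx w 0)) (Phi z) + contract (row_mx t 0) (Phi z).
Proof.
rewrite (raddfD Phi) /= Phi_vec Phi_contract row_mx0 contract0l addr0 [contract _ _ + _]addrC addrA.
by rewrite wedge_vecD add_row_mx addr0 addNr.
Qed.

(** The action of v = (w, t) on the second factor, as it appears after tau,
    transported to the exterior algebra of V. *)
Lemma Phi_right (w t : 'rV[L]_N) z :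
  Phi (contract (row_mx t w) z - wedge (ext_vec (row_mx 0 t)) z) =
  wedge (ext_vec (row_mx 0 w)) (Phi z) - contract (row_mx 0 t) (Phi z).
Proof.
rewrite (raddfB Phi) /= Phi_vec Phi_contract oppr0 row_mx0 linear0 wedge0l add0r addrAC.
have -> : row_mx t t = row_mx t 0 + row_mx 0 t by rewrite add_row_mx addr0 add0r.
by rewrite contractDl opprD addrA subrr add0r addrC.
Qed.

Lemma Phi_cre_ker k z : Phi z = 0 -> Phi (cre k z) = 0.
Proof.
move=> z0; rewrite -wedge_delta -[delta_mx 0 k]hsubmxK Phi_vec z0.
by rewrite !linear0 addr0.
Qed.

Lemma mu_push_inj z : mu_push z = 0 -> z = 0.
Proof.
move=> /(congr1 (ext_map (block_mx 1%:M 1%:M 0 1%:M))); rewrite linear0 ext_map_comp.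
rewrite mulmx_block !mulmx0 !mul0mx !mulmx1 !addr0 add0r subrr -scalar_mx_block.
by rewrite ext_map1.
Qed.

(** The kernel is stable under exterior multiplication, by [Phi_vec], so if it is
    nonzero it contains the top form; but the top form is not sent to 0. *)
Lemma Phi_inj z : Phi z = 0 -> z = 0.
Proof.
move=> z0; apply: contrapT => nz.
have [a a0] := top_of_cre_closed Phi_cre_ker z0 nz.
rewrite linearZ /= => /eqP; rewrite scaler_eq0 (negPf a0) /= => /eqP.
rewrite PhiE => /mu_push_inj.
have -> : ext_basis L [set: 'I_(N + N)]%SET =
    ext_prod (ext_basis L [set: 'I_N]%SET) (ext_basis L [set: 'I_N]%SET).
  apply/ffunP => K; rewrite (sum_set_surj K) ext_prodE !ffunE.
  have -> : [set: 'I_(N + N)]%SET = sum_set [set: 'I_N]%SET [set: 'I_N]%SET.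
    by apply: sum_setP => i; rewrite ?mem_sum_set_l ?mem_sum_set_r !inE.
  by rewrite sum_set_eq -mulnb natrM.
rewrite id_tensor_prod /= phi_poincare_top => /ffunP/(_ (sum_set [set: 'I_N]%SET finset.set0)).
rewrite ext_prodE !ffunE !eqxx mulr1 => /eqP; by rewrite oner_eq0.
Qed.

Lemma phiK z : phi L N (Phi z) = z.
Proof.
have k0 : lker (linfun Phi) == 0%VS.
  by apply/lker0P => u v; rewrite !lfunE => /eqP; rewrite -subr_eq0 -linearB => /eqP/Phi_inj/eqP; rewrite subr_eq0 => /eqP.
by have := lker0_lfunK k0 z; rewrite lfunE.
Qed.

Lemma PhiK z : Phi (phi L N z) = z.
Proof.
have k0 : lker (linfun Phi) == 0%VS.
  by apply/lker0P => u v; rewrite !lfunE => /eqP; rewrite -subr_eq0 -linearB => /eqP/Phi_inj/eqP; rewrite subr_eq0 => /eqP.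
by have := lker0_lfunVK k0 z; rewrite lfunE.
Qed.

Lemma phi_eq0 z : phi L N z = 0 -> z = 0.
Proof. by move=> h; rewrite -(PhiK z) h linear0. Qed.

End Fourier.

Local Open Scope classical_set_scope.

(** * Linear spans *)

Section LinearSpan.
Variables (L : fieldType) (U : lmodType L).
Implicit Types (A B : set U) (x y : U).

Lemma lspan_ind A (P : U -> Prop) :
  P 0 -> (forall a x y, A x -> P y -> P (a *: x + y)) -> forall x, lspan A x -> P x.
Proof.
move=> P0 Pl x [r hr ->]; elim: r hr => [|p r IH] hr; first by rewrite big_nil.
rewrite big_cons; apply: Pl; first exact: hr (mem_head _ _).
by apply: IH => q qr; apply: hr; rewrite inE qr orbT.
Qed.

Lemma lspan0 A : lspan A 0.
Proof. by exists [::] => //; rewrite big_nil. Qed.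

Lemma lspan_cons A a x y : A x -> lspan A y -> lspan A (a *: x + y).
Proof.
move=> Ax [r hr ->]; exists ((a, x) :: r); last by rewrite big_cons.
by move=> p; rewrite inE => /predU1P[->|/hr].
Qed.

Lemma lspan_gen A x : A x -> lspan A x.
Proof. by move=> Ax; rewrite -[x]addr0 -{1}[x]scale1r; apply: lspan_cons => //; apply: lspan0. Qed.

Lemma lspan_lin A a x y : lspan A x -> lspan A y -> lspan A (a *: x + y).
Proof.
move=> hx hy; elim/lspan_ind: hx => [|b u v Au IH]; first by rewrite scaler0 add0r.
by rewrite scalerDr scalerA -addrA; apply: lspan_cons.
Qed.

Lemma lspan_sub A B : (forall x, A x -> lspan B x) -> lspan A `<=` lspan B.
Proof.
move=> AB x; elim/lspan_ind => [|a u v Au IH]; first exact: lspan0.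
by apply: lspan_lin => //; apply: AB.
Qed.

End LinearSpan.

(** * The Clifford action on spinors *)

Section Spinors.
Variables (L : numFieldType) (N : nat).
Implicit Types (s t : ext L N) (v w : 'rV[L]_(N + N)).

Fact tau_is_linear : linear (@tau L N).
Proof.
move=> a x y; apply/ffunP => I; rewrite !(ext_addE, ext_scaleE, ffunE).
by rewrite mulrDr mulrCA.
Qed.
HB.instance Definition _ :=
  GRing.isLinear.Build L (ext L N) (ext L N) *:%R (@tau L N) tau_is_linear.

(** Reversing n + 1 factors is moving the last one to the front, past n others,
    and reversing the remaining n. *)
Lemma tau_sign n : (-1) ^+ (n.+1 * n)./2 = (-1) ^+ n * (-1) ^+ (n * n.-1)./2 :> L.
Proof.
case: n => [|n]; first by rewrite /= mul1r.
rewrite -[n.+1.-1]/n.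
have -> : (n.+2 * n.+1 = n.+1.*2 + n.+1 * n)%N.
  by rewrite -addn2 mulnDl mul2n [(n * _)%N]mulnC addnC.
by rewrite halfD odd_double doubleK add0n exprD.
Qed.

Lemma tau_cre i s : tau (cre i s) = cre i (tau (parity s)).
Proof.
apply/ffunP => I; rewrite !ffunE; case: ifP => iI; last by rewrite mulr0.
rewrite (cardsD1 i) iI add1n tau_sign; ring.
Qed.

Lemma tau_ann i s : tau (ann i s) = - ann i (tau (parity s)).
Proof.
apply/ffunP => I; rewrite !ffunE; case: ifP => iI; first by rewrite mulr0 oppr0.
rewrite cardsU1 iI add1n tau_sign exprS.
set c := (-1) ^+ #|I|; have cc : c * c = 1 by rewrite -expr2 sqrr_sign.
rewrite -[LHS]mul1r -[X in X * _ = _]cc; ring.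
Qed.

Lemma tauK : involutive (@tau L N).
Proof. by move=> x; apply/ffunP => I; rewrite !ffunE mulrA -expr2 sqrr_sign mul1r. Qed.

Lemma parity_spinor_act v s : parity (spinor_act v s) = - spinor_act v (parity s).
Proof. by rewrite /spinor_act linearD /= parity_vec parity_contract opprD. Qed.

Lemma tau_spinor_act v s : tau (spinor_act v s) =
  wedge (ext_vec (lsubmx v)) (tau (parity s)) - contract (rsubmx v) (tau (parity s)).
Proof.
rewrite /spinor_act linearD /= wedge_vecE contractE !linear_sum.
rewrite wedge_vecE contractE -sumrN; congr (_ + _); apply: eq_bigr => i _.
  by rewrite linearZ /= tau_cre.
by rewrite linearZ /= tau_ann scalerN.
Qed.

(** Reversal turns left multiplications and contractions into right ones, which
    differ from the left ones by the parity involution and, for contractions, by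
    one more sign. *)
Lemma tau_spinor_eq0 v s : spinor_act v s = 0 ->
  wedge (ext_vec (lsubmx v)) (tau s) - contract (rsubmx v) (tau s) = 0.
Proof.
by move=> h; rewrite -[s]parityK -tau_spinor_act -[spinor_act _ _]opprK -parity_spinor_act h !linear0.
Qed.

Fact spinor_act_is_linear v : linear (spinor_act v).
Proof.
by move=> a x y; rewrite /spinor_act !linearP /= scalerDr addrACA.
Qed.
HB.instance Definition _ v :=
  GRing.isLinear.Build L (ext L N) (ext L N) *:%R (spinor_act v) (spinor_act_is_linear v).

Lemma spinor_actDl v w s : spinor_act (v + w) s = spinor_act v s + spinor_act w s.
Proof. by rewrite /spinor_act !linearD /= wedgeDl contractDl addrACA. Qed.

Lemma spinor_actZl a v s : spinor_act (a *: v) s = a *: spinor_act v s.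
Proof. by rewrite /spinor_act !linearZ /= wedgeZl contractZl scalerDr. Qed.

Lemma contract_contract m (u w : 'rV[L]_m) x :
  contract u (contract w x) = - contract w (contract u x).
Proof.
rewrite [in LHS](contractE w) [in RHS](contractE w) linear_sum -sumrN.
apply: eq_bigr => i _; rewrite linearZ /= -scalerN; congr (_ *: _).
rewrite !contractE linear_sum -sumrN; apply: eq_bigr => k _.
by rewrite linearZ /= ann_anticomm scalerN.
Qed.

Lemma pairingVE v w :
  pairingV v w = (rsubmx v *m (lsubmx w)^T) 0 0 + (rsubmx w *m (lsubmx v)^T) 0 0.
Proof.
rewrite /pairingV mxE addrC [RHS]addrC; congr (_ + _).
  by rewrite -[in LHS](trmxK (lsubmx v)) -trmx_mul mxE.
by rewrite -[in LHS](trmxK (lsubmx w)) -trmx_mul mxE.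
Qed.

(** The polarized Clifford relation, for orthogonal vectors. *)
Lemma spinor_act_comm v w s : pairingV v w = 0 ->
  spinor_act v (spinor_act w s) = - spinor_act w (spinor_act v s).
Proof.
rewrite pairingVE => vw; apply/eqP; rewrite -addr_eq0; apply/eqP; rewrite /spinor_act !linearD /=.
rewrite !contract_vec [wedge (ext_vec (lsubmx w)) (wedge _ _)]vec_anticomm.
rewrite [contract (rsubmx w) (contract _ _)]contract_contract.
transitivity (((rsubmx v *m (lsubmx w)^T) 0 0 + (rsubmx w *m (lsubmx v)^T) 0 0) *: s);
  last by rewrite vw scale0r.
rewrite scalerDl.
set a := wedge _ (wedge _ s); set b := contract _ (contract _ s).
set c := wedge _ (contract (rsubmx w) s); set e := wedge _ (contract (rsubmx v) s).
set f := _ *: s; set g := _ *: s.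
by move: a b c e f g => a b c e f g; apply/ffunP => I; rewrite !ffunE; ring.
Qed.

Lemma spinor_act_sqr v s : pairingV v v = 0 -> spinor_act v (spinor_act v s) = 0.
Proof.
move=> h; have /eqP := @spinor_act_comm v v s h.
by rewrite -subr_eq0 opprK -mulr2n -scaler_nat scaler_eq0 pnatr_eq0 => /eqP.
Qed.

(** Starting from any nonzero spinor, apply the given vectors one after the
    other, skipping those that already annihilate it: each vector kills what it
    has been applied to, and keeps doing so since the operators anticommute. *)
Lemma isotropic_spinor_exists (vs : seq 'rV[L]_(N + N)) :
  (forall v w, v \in vs -> w \in vs -> pairingV v w = 0) ->
  exists2 s : ext L N, s <> 0 & forall v, v \in vs -> spinor_act v s = 0.
Proof.
elim: vs => [|v vs IH] iso.
  exists (ext_one L N) => // /ffunP/(_ finset.set0); rewrite !ffunE eqxx => /eqP.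
  by rewrite oner_eq0.
have [|s s0 hs] := IH; first by move=> u w uv wv; apply: iso; rewrite inE ?uv ?wv orbT.
have vv := iso v v (mem_head _ _) (mem_head _ _).
have [e|/eqP ne] := eqVneq (spinor_act v s) 0.
  by exists s => // w; rewrite inE => /predU1P[->|/hs].
exists (spinor_act v s) => // w; rewrite inE => /predU1P[->|wv]; first exact: spinor_act_sqr.
rewrite spinor_act_comm ?hs ?linear0 ?oppr0 //.
by apply: iso; rewrite !inE ?eqxx ?wv ?orbT.
Qed.

End Spinors.

(** * The component of lowest degree *)

Section LowestPart.
Variables (L : numFieldType) (m : nat).
Implicit Types (A I J : {set 'I_m}) (x y z : ext L m).

Lemma sg_neq0 i I : sg L i I != 0.
Proof. by rewrite /sg prodf_seq_neq0; apply/allP => k _; rewrite signr_eq0 implybT. Qed.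

(** The first condition says that every monomial of y contains A.  In lowest
    degree the second one reduces to [ann k y = 0] for k outside A, so the
    monomials of lowest degree are contained in A. *)
Lemma lowest_part A y :
  (forall i, i \in A -> cre i y = 0) ->
  (forall k, k \notin A -> exists a : 'rV[L]_m, ann k y + wedge (ext_vec a) y = 0) ->
  (forall J, y J != 0 -> A \subset J) /\ (y A = 0 -> y = 0).
Proof.
move=> hA hnA.
have sA J : y J != 0 -> A \subset J.
  move=> yJ; apply/subsetP => i iA; apply: contraT => iJ.
  have /ffunP/(_ (i |: J)%SET) := hA i iA; rewrite !ffunE setU11 setU1K // => /eqP.
  by rewrite mulf_eq0 (negPf (sg_neq0 _ _)) (negPf yJ).
split=> // yA0; apply: contrapT => ny.
have [I0 yI0] : exists I, y I != 0.
  apply/existsP; apply: contraPT ny; rewrite negb_exists => /forallP h; apply.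
  by apply/ffunP => I; rewrite [RHS]ffunE; have := h I; rewrite negbK => /eqP.
have [J yJ minJ] := @arg_minnP _ I0 (fun I : {set 'I_m} => y I != 0) (fun I : {set 'I_m} => #|I|) yI0.
have AJ := sA J yJ.
have nAJ : ~~ (J \subset A).
  by apply: contra yJ => JA; rewrite (_ : J = A) ?yA0 //; apply/eqP; rewrite eqEsubset JA AJ.
have [k kJ kA] := subsetPn nAJ.
(* The product with a only involves coefficients of y in degrees below that of J. *)
have [a /ffunP/(_ (J :\ k)%SET)] := hnA k kA.
rewrite ext_addE wedge_vecE ext_sumE big1 => [|i _]; last first.
  rewrite ext_scaleE ffunE; case: ifP => iJ; last by rewrite mulr0.
  rewrite (_ : y _ = 0) ?mulr0 //; apply/eqP; apply: contraT => /minJ.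
  by rewrite leqNgt (cardsD1 k J) kJ (cardsD1 i (J :\ k)%SET) iJ !add1n ltnS leqnSn.
rewrite addr0 [RHS]ffunE ffunE !inE eqxx setD1K // => /eqP.
by rewrite mulf_eq0 (negPf (sg_neq0 _ _)) (negPf yJ).
Qed.

Fact ext_part_is_linear k : linear (@ext_part L m k).
Proof.
move=> a x y; apply/ffunP => I; rewrite !(ext_addE, ext_scaleE, ffunE).
by case: ifP => _; rewrite ?(mulr0, addr0, ext_addE, ext_scaleE).
Qed.
HB.instance Definition _ k :=
  GRing.isLinear.Build L (ext L m) (ext L m) *:%R (@ext_part L m k) (ext_part_is_linear k).

Lemma ext_part_top A y : (forall J, y J != 0 -> A \subset J) ->
  ext_part #|A| y = y A *: ext_basis L A.
Proof.
move=> h; apply/ffunP => J; rewrite ext_scaleE !ffunE.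
have [->|nJ] := eqVneq J A; first by rewrite eqxx mulr1.
rewrite mulr0; case: eqP => // cJ; apply/eqP; apply: contraNT nJ => /h AJ.
by rewrite eq_sym eqEcard AJ cJ leqnn.
Qed.

Lemma ext_part_low A y k : (forall J, y J != 0 -> A \subset J) -> (k < #|A|)%N ->
  ext_part k y = 0.
Proof.
move=> h kA; apply/ffunP => J; rewrite !ffunE; case: eqP => // cJ.
apply/eqP; apply: contraTT kA => /h/subset_leq_card.
by rewrite cJ -leqNgt.
Qed.

Lemma ext_part_id n x : (forall K, x K != 0 -> #|K| = n) -> ext_part n x = x.
Proof.
move=> h; apply/ffunP => K; rewrite ffunE; case: eqP => // nK; apply/esym/eqP.
by apply: contra_notT nK => /h.
Qed.

Lemma ext_part_neq n k x : (forall K, x K != 0 -> #|K| = n) -> k != n -> ext_part k x = 0.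
Proof.
move=> h nk; apply/ffunP => K; rewrite !ffunE; case: eqP => // cK; apply/eqP.
by apply: contraNT nk => /h; rewrite cK => ->.
Qed.

Lemma wedge_vec_degree n (v : 'rV[L]_m) x : (forall K, x K != 0 -> #|K| = n) ->
  forall K, wedge (ext_vec v) x K != 0 -> #|K| = n.+1.
Proof.
move=> h K; rewrite wedge_vecE ext_sumE => nz.
have [i ni] : exists i : 'I_m, (v 0 i *: cre i x) K != 0.
  apply/existsP; apply: contraNT nz; rewrite negb_exists => /forallP e.
  by rewrite big1 // => i _; have := e i; rewrite negbK => /eqP.
move: ni; rewrite ext_scaleE ffunE; case: ifP => iK; last by rewrite mulr0 eqxx.
by rewrite !mulf_eq0 => /norP[_ /norP[_ /h]]; rewrite (cardsD1 i K) iK => ->.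
Qed.

Lemma wedge_seq_degree (s : seq 'rV[L]_m) K : wedge_seq s K != 0 -> #|K| = size s.
Proof.
elim: s K => [|v s IH] K; last exact: wedge_vec_degree.
by rewrite ffunE; case: (eqVneq K finset.set0) => [->|]; rewrite ?cards0 ?eqxx.
Qed.

End LowestPart.

Lemma ext_map_part (L : numFieldType) m p (M : 'M[L]_(m, p)) k x :
  ext_part k (ext_map M x) = ext_map M (ext_part k x).
Proof.
elim/ext_basis_ind: x => [a x y IH IH'|I].
  by rewrite !linearP /= IH IH'.
have h (K : {set 'I_m}) : ext_basis L I K != 0 -> #|K| = #|I|.
  by rewrite ffunE; case: (eqVneq K I) => [->|]; rewrite ?eqxx.
have h' (K : {set 'I_p}) : ext_map M (ext_basis L I) K != 0 -> #|K| = #|I|.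
  by rewrite ext_map_basis => /wedge_seq_degree ->; rewrite size_map cardE.
have [->|nk] := eqVneq k #|I|; first by rewrite (ext_part_id h) (ext_part_id h').
by rewrite (ext_part_neq h nk) (ext_part_neq h' nk) linear0.
Qed.

(** * The product of two pure spinors *)

Section PureSpinors.
Variables (L : numFieldType) (N : nat).
Hypothesis evenN : ~~ odd N.
Implicit Types (s t : ext L N) (v w : 'rV[L]_(N + N)) (z : ext L (N + N)).
Variables W W' : set 'rV[L]_(N + N).

Let ann_line (U : set 'rV[L]_(N + N)) : set (ext L N) :=
  [set s | forall v, U v -> spinor_act v s = 0].

Let line := @phi L N @` tensor (ann_line W) (@tau L N @` ann_line W').

(** The row of coefficients of the linear form (v, .) for the pairing of V. *)
Definition swap v : 'rV[L]_(N + N) := row_mx (rsubmx v) (lsubmx v).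

(** The equations inherited by phi(s (x) tau t) from those satisfied by a spinor
    s annihilated by W and a spinor t annihilated by W', see [twisted_prod]. *)
Definition twisted z : Prop :=
  (forall v, W v ->
     wedge (ext_vec (row_mx (lsubmx v) 0)) z + contract (swap v) z = 0) /\
  (forall v, W' v ->
     contract (swap v) z - wedge (ext_vec (row_mx 0 (rsubmx v))) z = 0).

Lemma twistedP a z z' : twisted z -> twisted z' -> twisted (a *: z + z').
Proof.
move=> [h1 h2] [h1' h2']; split=> v Wv.
  by rewrite !linearP /= addrACA -scalerDr h1 // h1' // scaler0 addr0.
by rewrite !linearP /= addrACA -scalerDr h2 // h2' // scaler0 addr0.
Qed.

Lemma ext_prod_vec_l (w : 'rV[L]_N) s t :
  ext_prod (wedge (ext_vec w) s) t = wedge (ext_vec (row_mx w 0)) (ext_prod s t).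
Proof.
rewrite vec_row_mx [X in _ + X]big1 => [|i _]; last by rewrite mxE scale0r.
rewrite addr0 wedge_vecE ext_prod_suml; apply: eq_bigr => i _.
by rewrite ext_prodZl ext_prod_cre_l.
Qed.

Lemma ext_prod_contract_l (u : 'rV[L]_N) s t :
  ext_prod (contract u s) t = contract (row_mx u 0) (ext_prod s t).
Proof.
rewrite contract_row_mx [X in _ + X]big1 => [|i _]; last by rewrite mxE scale0r.
rewrite addr0 contractE ext_prod_suml; apply: eq_bigr => i _.
by rewrite ext_prodZl ext_prod_ann_l.
Qed.

Lemma ext_prod_vec_r (w : 'rV[L]_N) s t :
  ext_prod (parity s) (wedge (ext_vec w) t) = wedge (ext_vec (row_mx 0 w)) (ext_prod s t).
Proof.
rewrite vec_row_mx big1 => [|i _]; last by rewrite mxE scale0r.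
rewrite add0r wedge_vecE linear_sum; apply: eq_bigr => i _.
by rewrite linearZ /= ext_prod_cre_r.
Qed.

Lemma ext_prod_contract_r (u : 'rV[L]_N) s t :
  ext_prod (parity s) (contract u t) = contract (row_mx 0 u) (ext_prod s t).
Proof.
rewrite contract_row_mx big1 => [|i _]; last by rewrite mxE scale0r.
rewrite add0r contractE linear_sum; apply: eq_bigr => i _.
by rewrite linearZ /= ext_prod_ann_r.
Qed.

Lemma twisted_prod s t : ann_line W s -> ann_line W' t -> twisted (phi L N (ext_prod s (tau t))).
Proof.
move=> hs ht; split=> v Wv; apply: (Phi_inj evenN).
  rewrite (Phi_left evenN) (PhiK evenN) -ext_prod_vec_l -ext_prod_contract_l.
  by rewrite -ext_prodDl -/(spinor_act v s) hs // /ext_prod linear0 wedge0l.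
rewrite (Phi_right evenN) (PhiK evenN) -ext_prod_vec_r -ext_prod_contract_r.
by rewrite -raddfB /= (tau_spinor_eq0 (ht v Wv)) linear0.
Qed.

Lemma twisted_line z : line z -> twisted z.
Proof.
move=> [z0 hz <-]; elim/lspan_ind: hz => [|a u u' [s [_ [hs [t ht <-] ->]]] IH].
  by rewrite linear0; split=> v _; rewrite !linear0 ?oppr0 addr0.
by rewrite linearP; apply: twistedP => //; apply: twisted_prod.
Qed.

Variables (P : 'M[L]_(N + N)) (A : {set 'I_(N + N)}).
Hypothesis Pu : P \in unitmx.
Hypothesis meetP : forall v, W v /\ W' v <-> forall i, (v *m invmx P) 0 i != 0 -> i \in A.
Hypothesis joinP : forall k, k \notin A ->
  exists2 v, W v \/ W' v & swap v *m P^T = delta_mx 0 k.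

(** For v in both W and W' the two equations differ by v /\ z = 0, and by
    [joinP] the remaining coordinate forms are of the form (v, .) with v in W or
    in W'; so in the coordinates given by P, [lowest_part] applies. *)
Lemma twisted_lowest z : twisted z ->
  let y := ext_map (invmx P) z in
  (forall J, y J != 0 -> A \subset J) /\ (y A = 0 -> z = 0).
Proof.
move=> [h1 h2] y.
have [|k kA|hA hy] := @lowest_part L _ A y.
- move=> i iA; have [Wi W'i] : W (row i P) /\ W' (row i P).
    apply/meetP => k; rewrite -row_mul mulmxV // row1 mxE eqxx /=.
    by case: (eqVneq k i) => [->|]; rewrite ?eqxx.
  (* Subtract the two equations satisfied by row i. *)
  have e : wedge (ext_vec (row i P)) z = 0.
    have := congr2 (fun a b => a - b) (h1 _ Wi) (h2 _ W'i).
    rewrite subr0 opprB addrAC addrA addrAC addrK wedge_vecD add_row_mx addr0 add0r hsubmxK.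
    by [].
  by rewrite -wedge_delta -row1 -(mulmxV Pu) row_mul -ext_map_vec e linear0.
- have [v Wv ev] := joinP kA.
  have ez : contract (delta_mx 0 k) y = ext_map (invmx P) (contract (swap v) z).
    rewrite ext_map_contract -ev -mulmxA -trmx_mul mulVmx // trmx1 mulmx1.
    by [].
  rewrite -contract_delta ez; case: Wv => Wv.
    exists (row_mx (lsubmx v) 0 *m invmx P).
    by rewrite -ext_map_vec -raddfD addrC h1 // raddf0.
  exists (- (row_mx 0 (rsubmx v) *m invmx P)); rewrite linearN -scaleN1r wedgeZl scaleN1r.
  by rewrite -ext_map_vec -raddfB h2 // raddf0.
split=> // /hy y0; by rewrite -(ext_map1 z) -(mulVmx Pu) -ext_map_comp -/y y0 linear0.
Qed.

Let eA := ext_map P (ext_basis L A).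

Lemma ext_mapKV z : ext_map P (ext_map (invmx P) z) = z.
Proof. by rewrite ext_map_comp mulVmx // ext_map1. Qed.

Lemma ext_mapVK z : ext_map (invmx P) (ext_map P z) = z.
Proof. by rewrite ext_map_comp mulmxV // ext_map1. Qed.

Lemma twisted_part z : twisted z ->
  ext_part #|A| z = ext_map (invmx P) z A *: eA.
Proof.
move=> /twisted_lowest[h _].
by rewrite -{1}(ext_mapKV z) ext_map_part (ext_part_top h) linearZ.
Qed.

Lemma twisted_filtration z : twisted z -> @ext_filtration L (N + N) #|A| z.
Proof.
move=> /twisted_lowest[h _] K; apply: contraNT; rewrite -ltnNge => KA.
have : ext_part #|K| z = 0.
  by rewrite -(ext_mapKV z) ext_map_part (ext_part_low h KA) linear0.
by move=> /ffunP/(_ K); rewrite !ffunE eqxx => ->.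
Qed.

(** A product of #|A| vectors supported on A has degree #|A| and is supported on
    subsets of A, so that only the monomial of A itself can occur. *)
Lemma ext_power_line : ext_power #|A| (W `&` W') = [set a *: eA | a in [set: L]].
Proof.
have hU v : (W `&` W')%classic v <-> forall i, (v *m invmx P) 0 i != 0 -> i \in A.
  exact: meetP.
apply/seteqP; split=> [x|x [a _ <-]].
  elim/lspan_ind => [|c _ y [sq [szs hs] <-] [a _ <-]]; first by exists 0; rewrite ?scale0r.
  suff [b ->] : exists b, wedge_seq sq = b *: eA.
    by exists (c * b + a) => //; rewrite scalerDl scalerA.
  exists (ext_map (invmx P) (wedge_seq sq) A).
  rewrite -linearZ -[LHS]ext_mapKV; congr ext_map; apply/ffunP => J.
  rewrite ext_scaleE ffunE; have [->|nJ] := eqVneq J A; first by rewrite mulr1.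
  rewrite mulr0; apply/eqP; apply: contraNT nJ; rewrite ext_map_seq => nz.
  have cJ : #|J| = #|A| by rewrite (wedge_seq_degree nz) size_map szs.
  rewrite eqEcard cJ leqnn andbT; clear cJ.
  elim: sq {szs} hs J nz => [|v sq IHs] hs J /=.
    by rewrite ffunE; case: (eqVneq J finset.set0) => [->|]; rewrite ?finset.sub0set ?eqxx.
  rewrite wedge_vecE ext_sumE => nz.
  have [i ni] : exists i, ((v *m invmx P) 0 i *: cre i (wedge_seq [seq v *m invmx P | v <- sq])) J != 0.
    apply/existsP; apply: contraNT nz; rewrite negb_exists => /forallP e.
    by rewrite big1 // => i _; have := e i; rewrite negbK => /eqP.
  move: ni; rewrite ext_scaleE ffunE; case: ifP => iJ; last by rewrite mulr0 eqxx.
  rewrite !mulf_eq0 => /norP[ni /norP[_ ne]].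
  have iA : i \in A by apply: (proj1 (hU v)) ni; apply: hs; rewrite mem_head.
  rewrite -(setD1K iJ) subUset sub1set iA /=; apply: IHs ne => u us; apply: hs.
  by rewrite inE us orbT.
rewrite -[_ *: _]addr0; apply: lspan_cons; last exact: lspan0.
exists [seq row i P | i <- enum A]; last first.
  by rewrite /eA ext_map_basis.
split; first by rewrite size_map cardE.
move=> v /mapP[i iA ->]; apply/hU => k; rewrite -row_mul mulmxV // row1 mxE eqxx /=.
by case: (eqVneq k i) => [->|]; rewrite ?eqxx // -mem_enum.
Qed.

Lemma eA_neq0 : eA <> 0.
Proof.
move=> /(congr1 (ext_map (invmx P))); rewrite ext_mapVK linear0 => /ffunP/(_ A).
by rewrite !ffunE eqxx => /eqP; rewrite oner_eq0.
Qed.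

(** The product of the two spinors is nonzero, and any two elements of [line]
    are proportional because the coefficient of e_A determines them. *)
Lemma pure_spinor_line s0 t0 : s0 <> 0 -> t0 <> 0 -> ann_line W s0 -> ann_line W' t0 ->
  [/\ is_line line, line `<=` @ext_filtration L (N + N) #|A|,
      is_line (ext_power #|A| (W `&` W'))
    & @ext_part L (N + N) #|A| @` line = ext_power #|A| (W `&` W')].
Proof.
move=> sn tn hs ht.
pose z0 := phi L N (ext_prod s0 (tau t0)).
have lz a : line (a *: z0).
  exists (a *: ext_prod s0 (tau t0)); last by rewrite linearZ.
  rewrite -[_ *: _]addr0; apply: lspan_cons; last exact: lspan0.
  by exists s0, (tau t0); split=> //; exists t0.
have z0n : z0 <> 0.
  move=> /(phi_eq0 evenN) e.
  have [I nI] : exists I, s0 I != 0.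
    apply/existsP; apply: contraPT sn; rewrite negb_exists => /forallP h; apply.
    by apply/ffunP => I; rewrite [RHS]ffunE; have := h I; rewrite negbK => /eqP.
  apply: tn; rewrite -[t0]tauK (_ : tau t0 = 0) ?linear0 //.
  apply/ffunP => J; have /ffunP/(_ (sum_set I J)) := e; rewrite ext_prodE !ffunE => /eqP.
  by rewrite mulf_eq0 (negPf nI) /= => /eqP.
have tz0 : twisted z0 by rewrite -(scale1r z0); apply: twisted_line.
pose c z := ext_map (invmx P) z A.
have c0 : c z0 != 0 by apply/negP => /eqP /(twisted_lowest tz0).2.
have lineE : line = [set a *: z0 | a in [set: L]].
  apply/seteqP; split=> z; last by move=> [a _ <-].
  move=> /twisted_line tz; exists (c z / c z0) => //; apply/esym/eqP; rewrite -subr_eq0.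
  have tw : twisted ((- (c z / c z0)) *: z0 + z) by apply: twistedP.
  rewrite addrC -scaleNr; apply/eqP/(twisted_lowest tw).2.
  by rewrite linearP ext_addE ext_scaleE mulNr mulfVK // addNr.
split.
- by exists z0.
- by move=> z /twisted_line; apply: twisted_filtration.
- by rewrite ext_power_line; exists eA => //; apply: eA_neq0.
- rewrite ext_power_line; apply/seteqP; split=> x.
    by move=> [z /twisted_line tz <-]; rewrite twisted_part //; exists (c z).
  move=> [a _ <-]; exists ((a / c z0) *: z0) => //.
  by rewrite linearZ /= twisted_part // scalerA divfK.
Qed.

End PureSpinors.

(** * Diagonalizing the action of a number field *)

Section EigenBasis.
Variables (R : realType) (K : fieldExtType rat).
Local Notation C := (R[i]).
Local Notation QC := (map_poly (ratr : rat -> C)).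
Local Notation ev a q := ((map_poly (GRing.in_alg K) q).[a]).

Lemma rmorphism_eq (A B : nzRingType) (f g : {rmorphism A -> B}) : f =1 g -> f = g.
Proof.
case: f g => [f [[mf1] [mf2]]] [g [[mg1] [mg2]]] /= /funext fg; subst g.
by rewrite (Prop_irrelevance mf1 mg1) (Prop_irrelevance mf2 mg2).
Qed.

Lemma primitive_element : exists a : K,
  (forall t, exists q : {poly rat}, t = ev a q) /\
  (exists p : {poly rat}, [/\ p \is monic, irreducible_poly p, separable_poly p, ev a p = 0 &
     size p = (\dim {:K}).+1]).
Proof.
have ch0 : [pchar K] =i pred0 by move=> x; rewrite pchar_lalg pchar_num.
have sep : separable 1%AS {:K}%AS by apply/separableP => y _; apply: pcharf0_separable.
pose a := separable_generator 1%AS {:K}%AS.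
have Ea : ({:K} = <<1; a>>)%VS by apply: eq_adjoin_separable_generator => //; apply: sub1v.
exists a; split=> [t|].
  have : (t \in <<1; a>>)%VS by rewrite -Ea memvf.
  by case/Fadjoin_polyP => q /polyOver1P[q' ->] ->; exists q'.
have /polyOver1P[p ep] := minPolyOver 1%AS a.
have sp : size p = (\dim {:K}).+1.
  rewrite -(size_map_poly (GRing.in_alg K)) -ep size_minPoly.
  by have /(congr1 (fun U => \dim U)) := Ea; rewrite dim_Fadjoin dimv1 muln1 => ->.
exists p; split=> //.
- by rewrite -(map_monic (GRing.in_alg K)) -ep monic_minPoly.
- split=> [|q sq qp]; first by rewrite sp ltnS adim_gt0.
  have qo : map_poly (GRing.in_alg K) q \is a polyOver 1%VS by apply/polyOver1P; exists q.
  have := @minPoly_irr _ _ 1%AS a _ qo; rewrite ep dvdp_map => /(_ qp) /orP[|].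
    by rewrite eqp_map.
  move=> /eqp_size; rewrite size_map_poly size_poly1 => e.
  by rewrite e in sq.
- by rewrite -(separable_map (GRing.in_alg K)) -ep; apply: pcharf0_separable.
- by apply/eqP; have := root_minPoly 1%AS a; rewrite ep.
Qed.

(** A complex root of q is a common root of p and q, hence p divides q; then
    induct on the degree. *)
Lemma power_of_irreducible (p q : {poly rat}) : irreducible_poly p -> p \is monic ->
  q \is monic -> (forall x : C, root (QC q) x -> root (QC p) x) ->
  exists k, q = p ^+ k.
Proof.
move=> ip mp; have [n] := ubnP (size q); elim: n q => // n IH q sq mq h.
have [s1|s1] := eqVneq (size q) 1.
  by exists 0; apply/eqP; rewrite expr0 -eqp_monic ?monic1 // -size_poly_eq1 s1.
have [x rx] : exists x, root (QC q) x.
  by apply/closed_rootP; rewrite size_map_poly.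
have ncop : ~~ coprimep p q.
  apply/negP => /Bezout_eq1_coprimepP[[u v] /= e].
  have /(congr1 (fun f => f.[x])) : QC (u * p + v * q) = QC 1 by rewrite e.
  rewrite rmorphD !rmorphM rmorph1 !hornerE (rootP (h x rx)) (rootP rx) !mulr0 addr0.
  by move/esym/eqP; rewrite oner_eq0.
have pq : p %| q.
  have [_ /(_ _ ncop (dvdp_gcdl p q))] := ip.
  by move/eqp_dvdl => <-; apply: dvdp_gcdr.
have [q' eq'] := dvdpP _ _ pq.
have p0 : p != 0 by rewrite monic_neq0.
have mq' : q' \is monic by rewrite -(monicMr q' mp) -eq'.
have sq' : (size q' < n)%N.
  apply: leq_trans (_ : (size q <= n)%N); last by rewrite -ltnS.
  rewrite eq' size_Mmonic ?monic_neq0 //; have [sp _] := ip.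
  by case: (size p) sp => [|[|k]] // _; rewrite !addnS /= ltnS leq_addr.
have [y ry|k ek] := IH q' sq' mq'; first by apply: h; rewrite eq' rmorphM rootM ry.
by exists k.+1; rewrite eq' ek exprSr.
Qed.

Variables (n' d : nat).
Local Notation m := n'.+1.
Variable rho : K -> 'M[rat]_m.
Hypothesis rhoD : forall s t, rho (s + t) = rho s + rho t.
Hypothesis rhoM : forall s t, rho (s * t) = rho s *m rho t.
Hypothesis rho1 : rho 1 = 1%:M.
Hypothesis hm : m = (d * \dim {:K})%N.

Local Notation toC := (map_mx (ratr : rat -> C)).

Lemma rhoZ c t : rho (c *: t) = c *: rho t.
Proof.
have rhoB : zmod_morphism rho.
  by move=> x y; apply: (addIr (rho y)); rewrite -rhoD !subrK.
exact: rat_linear.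
Qed.

Lemma rho0 : rho 0 = 0.
Proof. by have := rhoZ 0 0; rewrite !scale0r. Qed.

(** An eigenvector of [rho a] is an eigenvector of all polynomials in it. *)
Lemma rho_ev (a : K) (q : {poly rat}) (v : 'rV[C]_m) (x : C) :
  v *m toC (rho a) = x *: v -> v *m toC (rho (ev a q)) = (QC q).[x] *: v.
Proof.
move=> hv; elim/poly_ind: q => [|q c IH].
  by rewrite !rmorph0 !horner0 scale0r rho0 map_mx0 mulmx0.
rewrite !rmorphD !rmorphM /= !map_polyX !map_polyC /= !hornerMXaddC rhoD rhoM /= rhoZ rho1.
rewrite map_mxD map_mxM map_mxZ map_mx1 mulmxDr mulmxA IH -scalemxAl hv scalerA scalerDl.
by rewrite -scalemxAr mulmx1.
Qed.

(** Let a generate K, with minimal polynomial p.  Over C, p has simple roots, so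
    [rho a] is diagonalizable, and its eigenvectors are eigenvectors of all of K
    with eigenvalue an embedding.  The characteristic polynomial of [rho a] is
    rational with the same complex roots as p, hence a power of p, namely the
    d-th one by degree; so each root of p is an eigenvalue of multiplicity d. *)
Theorem eigenbasis : exists (P : 'M[C]_m) (sig : 'I_m -> embK R K),
  [/\ P \in unitmx,
      forall i t, row i P *m toC (rho t) = sig i t *: row i P
    & forall s : embK R K, #|[set i | `[< sig i = s >]]%SET| = d].
Proof.
have [a [gen [p [mp ip sepp pa sp]]]] := primitive_element.
have horner_ev q : horner_mx (rho a) q = rho (ev a q).
  elim/poly_ind: q => [|q c IH].
    by rewrite !rmorph0 horner0 rho0.
  rewrite !rmorphD !rmorphM /= horner_mx_X horner_mx_C map_polyX map_polyC hornerMXaddC.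
  by rewrite rhoD rhoM IH /= rhoZ rho1 scalemx1.
have [rs ers] := closed_field_poly_normal (QC p).
have lc1 : lead_coef (QC p) = 1 by apply/eqP; rewrite -monicE map_monic.
rewrite lc1 scale1r in ers.
have urs : uniq rs by rewrite -separable_prod_XsubC -ers separable_map.
have [P Pu /diagonalizable_forPex[D /(simmxP Pu) PD]] :
    exists2 P : 'M_m, P \in unitmx & similar_diag P (toC (rho a)).
  apply/diagonalizableP; exists rs => //; rewrite -ers; apply: mxminpoly_min.
  by rewrite -map_horner_mx horner_ev pa rho0 map_mx0.
have rowPa i : row i P *m toC (rho a) = D 0 i *: row i P.
  by rewrite -row_mul PD; rewrite mul_diag_mx; apply/rowP => k; rewrite !mxE.
have rowP0 i : row i P != 0.
  apply/negP => /eqP /(congr1 (mulmx^~ (invmx P))); rewrite mul0mx -row_mul mulmxV // row1.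
  by move/rowP/(_ i); rewrite !mxE !eqxx => /eqP; rewrite oner_eq0.
have sig_ex i : exists s : embK R K, forall t, row i P *m toC (rho t) = s t *: row i P.
  have [|f hf] := @choice K C (fun t c => row i P *m toC (rho t) = c *: row i P).
    by move=> t; have [q ->] := gen t; eexists; apply: rho_ev; apply: rowPa.
  have fI x y : x *: row i P = y *: row i P -> x = y.
    by move=> /eqP; rewrite -subr_eq0 -scalerBl scaler_eq0 (negPf (rowP0 i)) orbF subr_eq0 => /eqP.
  have fB : zmod_morphism f.
    move=> s t; apply: fI; apply: (addIr (f t *: row i P)).
    by rewrite -!hf -mulmxDr -map_mxD -rhoD subrK scalerBl -!hf subrK.
  have fM : monoid_morphism f.
    split; first by apply: fI; rewrite -hf rho1 map_mx1 mulmx1 scale1r.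
    by move=> s t; apply: fI; rewrite -hf rhoM map_mxM mulmxA hf -scalemxAl hf scalerA.
  pose s : {rmorphism K -> C} := HB.pack f (GRing.isZmodMorphism.Build _ _ f fB) (GRing.isMonoidMorphism.Build _ _ f fM).
  by exists s.
have [sig hsig] := choice sig_ex.
have root_ev (s : embK R K) q : s (ev a q) = (QC q).[s a].
  elim/poly_ind: q => [|q c IH]; first by rewrite !rmorph0 !horner0 rmorph0.
  rewrite !rmorphD !rmorphM /= !map_polyX !map_polyC /= !hornerMXaddC rmorphD rmorphM IH.
  by rewrite alg_num_field fmorph_rat.
exists P, sig; split=> // s.
have fI i x y : x *: row i P = y *: row i P -> x = y.
  by move=> /eqP; rewrite -subr_eq0 -scalerBl scaler_eq0 (negPf (rowP0 i)) orbF subr_eq0 => /eqP.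
have sigD i : `[< sig i = s >] = (D 0 i == s a).
  apply/asboolP/eqP => [<-|e]; first by apply: (fI i); rewrite -hsig rowPa.
  apply: rmorphism_eq => t; have [q ->] := gen t; rewrite !root_ev -e; congr _.[_].
  by apply: (fI i); rewrite -hsig rowPa.
have echi : QC (char_poly (rho a)) = \prod_(x <- [seq D 0 i | i <- enum 'I_m]) ('X - x%:P).
  rewrite map_char_poly big_map big_enum /=.
  have -> : \prod_(i < m) ('X - (D 0 i)%:P) = char_poly (diag_mx D).
    rewrite char_poly_trig; first by apply: eq_bigr => i _; rewrite mxE eqxx.
    by apply: diag_mx_is_trig.
  have Pu' : \det (map_mx polyC P) != 0.
    by rewrite det_map_mx polyC_eq0 -unitfE -unitmxE.
  have /(congr1 determinant) : map_mx polyC P *m char_poly_mx (toC (rho a)) =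
      char_poly_mx (diag_mx D) *m map_mx polyC P.
    rewrite /char_poly_mx mulmxBr mulmxBl -!map_mxM PD; congr (_ - _).
    by rewrite mul_scalar_mx mul_mx_scalar.
  by rewrite !det_mulmx mulrC => /(mulIf Pu').
have [|k ek] := @power_of_irreducible p (char_poly (rho a)) ip mp (char_poly_monic _).
  move=> x; rewrite echi root_prod_XsubC => /mapP[i _ ->].
  apply/rootP; apply: (fI i); rewrite -(rho_ev _ (rowPa i)) pa rho0.
  by rewrite map_mx0 mulmx0 scale0r.
have kd : k = d.
  have : (size (char_poly (rho a))).-1 = m by rewrite size_char_poly.
  by rewrite ek size_exp sp /= hm mulnC => /eqP; rewrite eqn_pmul2r ?adim_gt0 // => /eqP.
have psa : s a \in rs.
  by rewrite -root_prod_XsubC -ers; apply/rootP; rewrite -root_ev pa rmorph0.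
have mup1 : mup (s a) (QC p) = 1.
  by rewrite ers mu_prod_XsubC count_uniq_mem // psa.
have : mup (s a) (QC (char_poly (rho a))) = d.
  rewrite ek kd rmorphXn; elim: d => [|j IH]; first by rewrite expr0 mupNroot ?root1.
  have p0 : QC p != 0 by rewrite map_poly_eq0 monic_neq0.
  by rewrite exprS mupM ?expf_neq0 // mup1 IH.
rewrite echi mu_prod_XsubC count_map => <-.
rewrite -sum1_card -sum1_count big_enum_cond; apply: eq_bigl => i.
by rewrite inE sigD.
Qed.

End EigenBasis.

Lemma eigenbasis_pos (R : realType) (K : fieldExtType rat) (m d : nat) (rho : K -> 'M[rat]_m) :
  (0 < m)%N -> (forall s t, rho (s + t) = rho s + rho t) ->
  (forall s t, rho (s * t) = rho s *m rho t) -> rho 1 = 1%:M -> m = (d * \dim {:K})%N ->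
  exists (P : 'M[R[i]]_m) (sig : 'I_m -> embK R K),
  [/\ P \in unitmx,
      forall i t, row i P *m map_mx ratr (rho t) = sig i t *: row i P
    & forall s : embK R K, #|[set i | `[< sig i = s >]]%SET| = d].
Proof. by case: m rho => // n' rho _; apply: eigenbasis. Qed.

(** * A CM-field as a quadratic extension *)

Lemma natr_eq0_ext (K : fieldExtType rat) n : (n%:R == 0 :> K) = (n == 0)%N.
Proof. by rewrite -(rmorph_nat (GRing.in_alg K)) fmorph_eq0 pnatr_eq0. Qed.

Section Quadratic.
Variables (R : realType) (K : fieldExtType rat) (F : {subfield K}).
Variable iota : {rmorphism K -> K}.
Hypotheses (hK : CM_field R K) (hF : max_totally_real R F) (hiota : generates_Gal F iota).

(** F contains the totally real field of index 2 given by the CM hypothesis, and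
    differs from K because iota is not the identity. *)
Lemma dim_CM : \dim {:K} = (2 * \dim F)%N.
Proof.
have [_ [E rE dE]] := hK; have [_ /(_ E rE) EF] := hF.
have [fixF [a ia]] := hiota.
have /dvdnP[k ek] : (\dim E %| \dim F)%N by apply: field_dimS.
have ltFK : (\dim F < \dim {:K})%N.
  rewrite ltn_neqAle dimvS ?subvf // andbT; apply/negP => /eqP e.
  have /eqP eF : F == fullv :> {vspace K} by rewrite eqEdim subvf e leqnn.
  by case/negP: ia; apply/eqP/fixF; rewrite eF memvf.
have k1 : k = 1.
  have : (0 < \dim F)%N := adim_gt0 F.
  move: ltFK; rewrite dE ek ltn_mul2r => /andP[_]; case: k {ek} => [|[|k]] //.
by rewrite dE ek k1 mul1n.
Qed.

(** Complete the square in the equation over F of an element moved by iota. *)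
Lemma quadratic_generator : exists d : K,
  [/\ iota d = - d, d != 0, d * d \in F &
      forall t, exists a b, [/\ a \in F, b \in F & t = a + b * d]].
Proof.
have [fixF [a0 ia]] := hiota.
have aF : a0 \notin F by apply/negP => /fixF /eqP; rewrite (negPf ia).
have a0n : a0 != 0 by apply: contraNneq aF => ->; apply: mem0v.
have gen t : exists a b, [/\ a \in F, b \in F & t = a + b * a0].
  have dir : (F :&: (F * <[a0]>) = 0)%VS.
    apply/eqP; rewrite -subv0; apply/subvP => x; rewrite memv_cap memv0 => /andP[xF].
    case/memv_cosetP => y yF ex; rewrite ex mulf_eq0 (negPf a0n) orbF.
    apply: contraT => y0; case/negP: aF.
    by rewrite -(mulKf y0 a0) -ex rpredM // rpredV.
  have full : (F + F * <[a0]> = fullv)%VS.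
    apply/eqP; rewrite eqEdim subvf /= dimv_disjoint_sum // dim_cosetv // dim_CM.
    by rewrite mul2n addnn.
  have : t \in (F + F * <[a0]>)%VS by rewrite full memvf.
  case/memv_addP => a aF1 [_ /memv_cosetP[b bF ->] ->]; by exists a, b.
have [q [p [qF pF e]]] := gen (a0 * a0).
(* The equation is a0 ^ 2 = q + p a0. *)
have pF2 : p / 2%:R \in F by rewrite rpredM // rpredV rpred_nat.
exists (a0 - p / 2%:R).
have dd : (a0 - p / 2%:R) * (a0 - p / 2%:R) \in F.
  have -> : (a0 - p / 2%:R) * (a0 - p / 2%:R) = q + p / 2%:R * (p / 2%:R).
    have -> : (a0 - p / 2%:R) * (a0 - p / 2%:R) =
      a0 * a0 - p * a0 * (2%:R / 2%:R) + p / 2%:R * (p / 2%:R) by ring.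
    rewrite divff ?e; last by rewrite natr_eq0_ext.
    by ring.
  by rewrite rpredD // rpredM.
split=> //.
- have : iota (a0 - p / 2%:R) * iota (a0 - p / 2%:R) = (a0 - p / 2%:R) * (a0 - p / 2%:R).
    by rewrite -rmorphM fixF.
  move/eqP; rewrite -!expr2 eqf_sqr => /orP[|/eqP //].
  by rewrite rmorphB (fixF (p / 2%:R)) // (inj_eq (addIr _)) (negPf ia).
- by apply: contraNneq aF => /eqP; rewrite subr_eq0 => /eqP ->.
- move=> t; have [a [b [aF1 bF1 ->]]] := gen t.
  exists (a + b * (p / 2%:R)), b; split=> //; first by rewrite rpredD // rpredM.
  by ring.
Qed.

Lemma iotaK t : iota (iota t) = t.
Proof.
have [d [id _ _ gen]] := quadratic_generator; have [fixF _] := hiota.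
have [a [b [aF bF ->]]] := gen t.
by rewrite !rmorphD !rmorphM id !rmorphN id opprK !fixF.
Qed.

Lemma quadratic_unique d a b : iota d = - d -> d != 0 ->
  a \in F -> b \in F -> a + b * d = 0 -> a = 0 /\ b = 0.
Proof.
have [fixF _] := hiota => id d0 aF bF e.
have /(congr1 iota) := e; rewrite rmorphD rmorphM rmorph0 id !fixF // mulrN => e'.
have b0 : b = 0.
  have : 2%:R * (b * d) = 0 by rewrite -[RHS](subrr (0 : K)) -{1}e -e'; ring.
  by move/eqP; rewrite !mulf_eq0 natr_eq0_ext (negPf d0) orbF => /eqP.
by split=> //; rewrite b0 mul0r addr0 in e.
Qed.

End Quadratic.

(** * Extension of scalars from F to K *)

Section TensorInd.
Variables (N : nat) (K : fieldExtType rat) (F : {subfield K}).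
Variable etahat : {rmorphism subvs_of F -> 'M[rat]_N}.
Variables (VK : lmodType K) (j : 'rV[rat]_(N + N) -> VK).
Hypothesis hVK : is_tensor_K etahat j.
Variable P : VK -> Prop.
Hypothesis Plin : forall a u v, P u -> P v -> P (a *: u + v).
Hypothesis Pj : forall x, P (j x).

Let S : {pred VK} := fun u => `[< P u >].

(** The elements satisfying P form a submodule containing the image of j.  By
    the universal property the identity of VK factors through it. *)
Fact S_submod_closed : submod_closed S.
Proof.
split; last by move=> a u v /asboolP hu /asboolP hv; apply/asboolP/Plin.
apply/asboolP; have := Plin (-1) (Pj 0) (Pj 0).
by rewrite scaleN1r addNr.
Qed.
HB.instance Definition _ := GRing.isSubmodClosed.Build K VK S S_submod_closed.

Definition subT := {u : VK | u \in S}.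
HB.instance Definition _ := [isSub of subT for @sval VK (fun u => u \in S)].
HB.instance Definition _ := [Choice of subT by <:].
HB.instance Definition _ := [SubChoice_isSubLmodule of subT by <:].

Lemma tensor_ind u : P u.
Proof.
have [[jD jZ] univ] := hVK.
have jS x : j x \in S by apply/asboolP.
pose f x : subT := exist _ (j x) (jS x).
have [|g [gj _]] := univ subT f.
  by split=> [x y|a x]; apply: val_inj; rewrite /= ?linearD ?linearZ /= ?jD ?jZ.
have [h [_ huniq]] := univ VK j (conj jD jZ).
pose vg : {linear VK -> VK} := (\val : subT -> VK) \o g.
have e1 : vg =1 h by apply: huniq => x /=; rewrite gj.
have e2 : (idfun : {linear VK -> VK}) =1 h by apply: huniq.
have <- : val (g u) = u by have := e1 u; rewrite -(e2 u).
exact/asboolP/(valP (g u)).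
Qed.

End TensorInd.

(** An additive map of rational vector spaces is linear, so injectivity implies
    surjectivity by dimension. *)
Lemma rat_additive_inj_surj n (f : 'rV[rat]_n -> 'rV[rat]_n) :
  (forall x y, f (x - y) = f x - f y) -> (forall x, f x = 0 -> x = 0) ->
  forall y, exists x, f x = y.
Proof.
move=> fB fI y.
have fZ := rat_linear (fB : zmod_morphism f).
pose fl : {linear 'rV[rat]_n -> 'rV[rat]_n} := HB.pack f
  (GRing.isZmodMorphism.Build _ _ f fB) (GRing.isScalable.Build _ _ _ _ f fZ).
have k0 : lker (linfun fl) == 0%VS.
  apply/lker0P => u v; rewrite !lfunE /= => /eqP; rewrite -subr_eq0 -fB => /eqP/fI/eqP.
  by rewrite subr_eq0 => /eqP.
by exists ((linfun fl)^-1%VF y); have := lker0_lfunVK k0 y; rewrite lfunE.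
Qed.

(** * The action of K on the rational cohomology *)

Section WeilStructure.
Variables (R : realType) (K : fieldExtType rat) (F : {subfield K}).
Variable iota : {rmorphism K -> K}.
Hypotheses (hK : CM_field R K) (hF : max_totally_real R F) (hiota : generates_Gal F iota).
Variables (N : nat) (etahat : {rmorphism subvs_of F -> 'M[rat]_N}).
Variable bF : 'rV[rat]_(N + N) -> 'rV[rat]_(N + N) -> subvs_of F.
Hypothesis hbF : is_F_form etahat bF.
Variables (VK : lmodType K) (j : 'rV[rat]_(N + N) -> VK).
Hypothesis hVK : is_tensor_K etahat j.
Variable iotaV : VK -> VK.
Hypothesis hiotaVD : forall u v, iotaV (u + v) = iotaV u + iotaV v.
Hypothesis hiotaV : forall t x, iotaV (t *: j x) = iota t *: j x.
Variable bK : VK -> VK -> K.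
Hypothesis hbKl : forall t u v w, bK (t *: u + v) w = t * bK u w + bK v w.
Hypothesis hbKr : forall t u v w, bK w (t *: u + v) = t * bK w u + bK w v.
Hypothesis hbK : forall x y, bK (j x) (j y) = vsval (bF x y).
Variables (Cl : algType K) (c : {linear VK -> Cl}).
Hypothesis hCl : is_clifford_algebra (fun u => bK u u / 2%:R) c.
Variables (g0 : Cl) (W : set VK).
Hypothesis hg0 : spin_group c g0.
Hypothesis hW : W = vector_rep_image c g0 (H1dual_K j).
Hypothesis hWiota : W `&` (iotaV @` W) = [set 0].
Variable eta : K -> 'M[rat]_(N + N).
Hypothesis heta : forall t w x, W w -> j x = w + iotaV w ->
     j (x *m eta t) = t *: w + iotaV (t *: w).

Local Notation M := (N + N)%N.
Implicit Types (x y z : 'rV[rat]_M) (u v w : VK).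

Let fixF a : a \in F -> iota a = a. Proof. by have [h _] := hiota; apply: h. Qed.
Let iK := iotaK hK hF hiota.

Let jD x y : j (x + y) = j x + j y. Proof. by have [[h _] _] := hVK. Qed.
Let jA a x : j (actV etahat a x) = vsval a *: j x. Proof. by have [[_ h] _] := hVK. Qed.
Let j0 : j 0 = 0. Proof. by apply: (addrI (j 0)); rewrite -jD !addr0. Qed.
Let jN x : j (- x) = - j x. Proof. by apply: (addrI (j x)); rewrite -jD !subrr j0. Qed.

Let bK0l w : bK 0 w = 0.
Proof.
have := hbKl 1 0 0 w; rewrite scaler0 addr0 mul1r => /eqP.
by rewrite -{1}[bK 0 w]addr0 (inj_eq (addrI _)) eq_sym => /eqP.
Qed.
Let bK0r w : bK w 0 = 0.
Proof.
have := hbKr 1 0 0 w; rewrite scaler0 addr0 mul1r => /eqP.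
by rewrite -{1}[bK w 0]addr0 (inj_eq (addrI _)) eq_sym => /eqP.
Qed.
Let bKDl u v w : bK (u + v) w = bK u w + bK v w.
Proof. by have := hbKl 1 u v w; rewrite scale1r mul1r. Qed.
Let bKDr u v w : bK w (u + v) = bK w u + bK w v.
Proof. by have := hbKr 1 u v w; rewrite scale1r mul1r. Qed.
Let bKZl t u w : bK (t *: u) w = t * bK u w.
Proof. by have := hbKl t u 0 w; rewrite addr0 bK0l addr0. Qed.
Let bKZr t u w : bK w (t *: u) = t * bK w u.
Proof. by have := hbKr t u 0 w; rewrite addr0 bK0r addr0. Qed.

Let bK_sym u v : bK u v = bK v u.
Proof.
elim/(tensor_ind hVK): u => [a u u' IH IH'|x]; first by rewrite hbKl hbKr IH IH'.
elim/(tensor_ind hVK): v => [a u u' IH IH'|y]; first by rewrite hbKl hbKr IH IH'.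
by rewrite !hbK; have [-> _ _ _] := hbF.
Qed.

Let iota0 : iotaV 0 = 0. Proof. by have := hiotaV 0 0; rewrite !scale0r rmorph0 scale0r. Qed.
Let iotaJ x : iotaV (j x) = j x. Proof. by have := hiotaV 1 x; rewrite rmorph1 !scale1r. Qed.

Let iotaZ t u : iotaV (t *: u) = iota t *: iotaV u.
Proof.
move: t; elim/(tensor_ind hVK): u => [a u u' IH IH'|x] t; last by rewrite hiotaV iotaJ.
rewrite scalerDr scalerA !hiotaVD !IH IH' rmorphM scalerDr scalerA.
by [].
Qed.

Let iotaVK u : iotaV (iotaV u) = u.
Proof.
elim/(tensor_ind hVK): u => [a u u' IH IH'|x]; last by rewrite !iotaJ.
by rewrite !hiotaVD !iotaZ iK IH IH'.
Qed.

Let iotaN u : iotaV (- u) = - iotaV u.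
Proof. by rewrite -scaleN1r iotaZ rmorphN1 scaleN1r. Qed.

Let iota_bK u v : bK (iotaV u) (iotaV v) = iota (bK u v).
Proof.
elim/(tensor_ind hVK): u => [a u u' IH IH'|x].
  by rewrite hiotaVD iotaZ !bKDl !bKZl IH IH' rmorphD rmorphM.
elim/(tensor_ind hVK): v => [a u u' IH IH'|y].
  by rewrite hiotaVD iotaZ !bKDr !bKZr IH IH' rmorphD rmorphM.
by rewrite !iotaJ hbK fixF // subvsP.
Qed.

Let tr0 : tr_rat (0 : subvs_of F) = 0.
Proof. by rewrite /tr_rat big1 // => i _; rewrite mul0r linear0. Qed.

Lemma pairingV_nondeg x : (forall y, pairingV x y = 0) -> x = 0.
Proof.
move=> h; rewrite -[x]hsubmxK; have -> : rsubmx x = 0.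
  apply/rowP => i; have := h (row_mx (delta_mx 0 i) 0); rewrite pairingVE row_mxKl row_mxKr mul0mx.
  rewrite [X in _ + X]mxE addr0 mxE (bigD1 i) //= big1 ?addr0 => [|k nk].
    by rewrite !mxE !eqxx mulr1.
  by rewrite !mxE eqxx (negPf nk) mulr0.
have -> : lsubmx x = 0.
  apply/rowP => i; have := h (row_mx 0 (delta_mx 0 i)); rewrite pairingVE row_mxKl row_mxKr trmx0 mulmx0.
  rewrite [X in X + _]mxE add0r mxE (bigD1 i) //= big1 ?addr0 => [|k nk].
    by rewrite !mxE !eqxx mul1r.
  by rewrite !mxE eqxx (negPf nk) mul0r.
exact: row_mx0.
Qed.

Let bF_nondeg x : (forall y, bF x y = 0) -> x = 0.
Proof.
move=> h; apply: pairingV_nondeg => y; have [_ _ _ <-] := hbF.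
by rewrite h tr0.
Qed.

(** Multiply b by its inverse: the trace of 1 is the degree of F, not 0. *)
Let tr_nondeg (b : subvs_of F) : (forall a, tr_rat (a * b) = 0) -> b = 0.
Proof.
move=> h; apply/eqP; apply: contraT => b0; have := h b^-1; rewrite mulVf //.
rewrite /tr_rat (eq_bigr (fun _ => 1)) => [|i _]; last first.
  by rewrite mul1r coord_free ?eqxx // (basis_free (vbasisP _)).
rewrite sumr_const card_ord => /eqP; rewrite pnatr_eq0.
by rewrite (gtn_eqF (adim_gt0 _)).
Qed.

(** The trace of a times the form is the pairing of V, up to the action of a, for
    which H^1(X^, Q) is isotropic and stable. *)
Let dual_isotropic (t t' : 'rV[rat]_N) : bF (row_mx 0 t) (row_mx 0 t') = 0.
Proof.
apply: tr_nondeg => a; have [_ _ <- ->] := hbF.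
rewrite /actV mul_row_block !mul0mx mulmx0 !add0r pairingVE.
by rewrite !row_mxKl !row_mxKr trmx0 !mulmx0 mxE addr0.
Qed.

Let H := H1dual_K j.

Let H_isotropic u v : H u -> H v -> bK u v = 0.
Proof.
move=> hu hv; elim/lspan_ind: hu => [|a _ u' [t _ <-] IH]; first exact: bK0l.
rewrite bKDl bKZl IH addr0; elim/lspan_ind: hv => [|b _ v' [t' _ <-] IH']; first by rewrite bK0r mulr0.
by rewrite bKDr bKZr hbK dual_isotropic mulrDr IH' !mulr0 addr0.
Qed.

(** Polarization of the defining relation of the Clifford algebra. *)
Let clif u v : c u * c v + c v * c u = (bK u v)%:A.
Proof.
have [sq _] := hCl.
have := sq (u + v); rewrite linearD mulrDl !mulrDr !sq !bKDl !bKDr (bK_sym v u).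
have -> : (bK u u + bK u v + (bK u v + bK v v)) / 2%:R = bK u u / 2%:R + bK u v * (2%:R / 2%:R) + bK v v / 2%:R by ring.
rewrite divff ?natr_eq0_ext // mulr1 !scalerDl => e.
apply: (addrI ((bK u u / 2%:R)%:A + (bK v v / 2%:R)%:A)).
by rewrite [RHS]addrAC -e [in RHS]addrACA [RHS]addrACA [c v * c u + _]addrC -!addrA; congr (_ + _); rewrite addrCA.
Qed.

Let c_inj u : c u = 0 -> forall v, bK u v = 0.
Proof.
move=> cu v; have := clif u v; rewrite cu mul0r mulr0 addr0 => /esym/eqP.
by rewrite scaler_eq0 oner_eq0 orbF => /eqP.
Qed.

Let g0_cancel (x : Cl) : x * g0 = 0 -> x = 0.
Proof.
have [s [_ _ inv _]] := hg0 => /(congr1 (fun y : Cl => y * clifford_sum c [seq (p.1, rev p.2) | p <- s])).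
by rewrite -mulrA inv mulr1 mul0r.
Qed.

Variable d : K.
Hypothesis id : iota d = - d.
Hypothesis d0 : d != 0.
Hypothesis gen : forall t, exists a b, [/\ a \in F, b \in F & t = a + b * d].
Hypothesis dd : d * d \in F.

Let span u : exists x y, u = j x + d *: j y.
Proof.
have jF a x : a \in F -> exists y, a *: j x = j y.
  by move=> aF; exists (actV etahat (Subvs aF) x); rewrite jA.
elim/(tensor_ind hVK): u => [t u u' [x [y ->]] [x' [y' ->]]|x]; last first.
  by exists x, 0; rewrite j0 scaler0 addr0.
have [a [b [aF bF' ->]]] := gen t.
have [x1 e1] := jF a x aF; have [x2 e2] := jF (b * (d * d)) y (rpredM bF' dd).
have [y1 f1] := jF a y aF; have [y2 f2] := jF b x bF'.
exists (x1 + x2 + x'), (y1 + y2 + y'); rewrite !jD -e1 -e2 -f1 -f2 !scalerDr !scalerDl !scalerA.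
rewrite [b * (d * d)]mulrA [d * a]mulrC [d * b]mulrC; clear.
by rewrite (AC (2*2*2) ((1*4*5)*(3*2*6))).
Qed.

Let uniq_coef a b : a \in F -> b \in F -> a + b * d = 0 -> a = 0 /\ b = 0.
Proof. exact: quadratic_unique hiota d a b id d0. Qed.

Let bK_pair x y z : bK (j x + d *: j y) (j z) = vsval (bF x z) + vsval (bF y z) * d.
Proof. by rewrite bKDl bKZl !hbK mulrC. Qed.

Let span_uniq x y : j x + d *: j y = 0 -> x = 0 /\ y = 0.
Proof.
move=> e; have h z : bF x z = 0 /\ bF y z = 0.
  have := bK_pair x y z; rewrite e bK0l => /esym /(uniq_coef (subvsP _) (subvsP _)) [h1 h2].
  by split; apply: val_inj; rewrite /= ?h1 ?h2.
by split; apply: bF_nondeg => z; have [] := h z.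
Qed.

Let jI x y : j x = j y -> x = y.
Proof.
move=> e; have [] := @span_uniq (x - y) 0; first by rewrite j0 scaler0 addr0 jD jN e subrr.
by move=> /eqP; rewrite subr_eq0 => /eqP.
Qed.

Let bK_nondeg u : (forall v, bK u v = 0) -> u = 0.
Proof.
have [x [y ->]] := span u => h.
have [h1 h2] : x = 0 /\ y = 0.
  split; apply: bF_nondeg => z; apply: val_inj;
    by have [] := uniq_coef (subvsP (bF x z)) (subvsP (bF y z)) (etrans (esym (bK_pair x y z)) (h _)).
by rewrite h1 h2 j0 scaler0 addr0.
Qed.

Let rep_ex u : exists u', g0 * c u = c u' * g0.
Proof. by have [s [_ _ _ h]] := hg0; apply: h. Qed.

Let r u := sval (cid (rep_ex u)).
Let rP u : g0 * c u = c (r u) * g0. Proof. exact: (svalP (cid (rep_ex u))). Qed.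

(** The vector representation of g0 is a well-defined linear map r, because g0 is
    right cancellable and c is injective, the form on VK being nondegenerate. *)
Let rep_uniq u u' : g0 * c u = c u' * g0 -> u' = r u.
Proof.
rewrite rP => e; apply/eqP; rewrite -subr_eq0; apply/eqP; apply: bK_nondeg; apply: c_inj.
by apply: g0_cancel; rewrite linearB mulrBl e subrr.
Qed.

Let r_lin a u v : r (a *: u + v) = a *: r u + r v.
Proof.
by apply/esym/rep_uniq; rewrite !linearP /= mulrDr mulrDl -scalerAl -scalerAr !rP.
Qed.

(** Conjugation by g0 preserves the scalar [clif] associates to two vectors. *)
Let r_isometry u v : bK (r u) (r v) = bK u v.
Proof.
have h u' v' : c (r u') * c (r v') * g0 = g0 * (c u' * c v').
  by rewrite -mulrA -rP mulrA -rP mulrA.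
have e : (bK (r u) (r v))%:A * g0 = (bK u v)%:A * g0.
  transitivity (g0 * (bK u v)%:A); first by rewrite -!clif mulrDl mulrDr !h.
  by rewrite -scalerAl mul1r -scalerAr mulr1.
have /g0_cancel : ((bK (r u) (r v) - bK u v)%:A : Cl) * g0 = 0 by rewrite scalerBl mulrBl e subrr.
by move/eqP; rewrite scaler_eq0 oner_eq0 orbF subr_eq0 => /eqP.
Qed.

Let r_inj u : r u = 0 -> u = 0.
Proof.
by move=> ru; apply: bK_nondeg => v; rewrite -r_isometry ru bK0l.
Qed.

Let WP w : W w <-> exists2 u, H u & w = r u.
Proof.
rewrite hW; split=> [[u Hu e]|[u Hu ->]]; last by exists u => //; apply: rP.
by exists u => //; apply: rep_uniq.
Qed.

Let W_lin a u v : W u -> W v -> W (a *: u + v).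
Proof.
move=> /WP[u' Hu ->] /WP[v' Hv ->]; apply/WP; exists (a *: u' + v'); last by rewrite r_lin.
exact: lspan_lin.
Qed.

Let r0 : r 0 = 0. Proof. by have := r_lin (-1) 0 0; rewrite !scaleN1r !addNr. Qed.

Let W0 : W 0. Proof. by apply/WP; exists 0; rewrite ?r0 //; apply: lspan0. Qed.

Let WZ a u : W u -> W (a *: u).
Proof. by move=> Wu; rewrite -[_ *: _]addr0; apply: W_lin. Qed.

Let WB u v : W u -> W v -> W (u - v).
Proof. by move=> Wu Wv; rewrite addrC -scaleN1r; apply: W_lin. Qed.

Let W_isotropic u v : W u -> W v -> bK u v = 0.
Proof.
by move=> /WP[u' Hu ->] /WP[v' Hv ->]; rewrite r_isometry H_isotropic.
Qed.

Let W_iota u v : W u -> W v -> u = iotaV v -> u = 0.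
Proof.
move=> Wu Wv e; have : (W `&` (iotaV @` W)) u by split=> //; exists v.
by rewrite hWiota.
Qed.

Let hh (v : 'rV[rat]_(N + N)) : VK := j (row_mx 0 (lsubmx v)) + d *: j (row_mx 0 (rsubmx v)).

Let jB x y : j (x - y) = j x - j y. Proof. by rewrite jD jN. Qed.

Let H_hh x : H (hh x).
Proof.
rewrite /hh addrC; apply: lspan_lin; apply: lspan_gen; by eexists.
Qed.

Let hhB x y : hh (x - y) = hh x - hh y.
Proof.
have e (a b : 'rV[rat]_N) : row_mx 0 (a - b) = row_mx 0 a - row_mx 0 b :> 'rV[rat]_(N + N).
  by rewrite opp_row_mx add_row_mx oppr0 addr0.
by rewrite /hh !linearB /= !e !jB scalerBr opprD addrACA.
Qed.

Let hh_inj x : hh x = 0 -> x = 0.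
Proof.
have e (a : 'rV[rat]_N) : row_mx 0 a = 0 :> 'rV[rat]_(N + N) -> a = 0.
  by move=> /(congr1 rsubmx); rewrite row_mxKr linear0.
by move=> /span_uniq[/e h1 /e h2]; rewrite -[x]hsubmxK h1 h2 row_mx0.
Qed.

Let rB u v : r (u - v) = r u - r v.
Proof. by rewrite addrC -scaleN1r r_lin scaleN1r addrC. Qed.

(** Count dimensions over Q.  Every vector of VK is j x + d j y for a unique pair
    of vectors x, y of V, whereas W is the injective image under r of the pairs of
    vectors of H^1(X^, Q).  So [G], which is injective since W meets iota W in 0
    only, has source and target of the same dimension. *)
Let W_plus u : exists w1 w2, [/\ W w1, W w2 & u = w1 + iotaV w2].
Proof.
pose G (p : 'rV[rat]_(M + M)) := r (hh (lsubmx p)) + iotaV (r (hh (rsubmx p))).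
pose kap (p : 'rV[rat]_(M + M)) := j (lsubmx p) + d *: j (rsubmx p).
have kapB p q : kap (p - q) = kap p - kap q.
  by rewrite /kap !linearB /= !jB scalerBr opprD addrACA.
have kapI p : kap p = 0 -> p = 0.
  by move=> /span_uniq[h1 h2]; rewrite -[p]hsubmxK h1 h2 row_mx0.
have GB p q : G (p - q) = G p - G q.
  by rewrite /G !linearB /= !hhB !rB hiotaVD iotaN opprD addrACA.
have WH x : W (r (hh x)) by apply/WP; exists (hh x).
have GI p : G p = 0 -> p = 0.
  move=> /eqP; rewrite addr_eq0 -iotaN => /eqP e.
  have h1 : r (hh (lsubmx p)) = 0.
    by apply: W_iota e => //; rewrite -scaleN1r; apply: WZ.
  have h2 : r (hh (rsubmx p)) = 0.
    by move: e; rewrite h1 => /(congr1 iotaV); rewrite iotaVK iota0 => /eqP; rewrite eq_sym oppr_eq0 => /eqP.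
  by rewrite -[p]hsubmxK (hh_inj (r_inj h1)) (hh_inj (r_inj h2)) row_mx0.
have kapS v : exists q, v = kap q.
  by have [x [y ->]] := span v; exists (row_mx x y); rewrite /kap row_mxKl row_mxKr.
have [f hf] := choice (fun p => kapS (G p)).
have fB p q : f (p - q) = f p - f q.
  apply/eqP; rewrite -subr_eq0; apply/eqP/kapI.
  by rewrite !kapB -!hf GB subrr.
have fI p : f p = 0 -> p = 0.
  by move=> fp0; apply: GI; rewrite hf fp0 /kap !linear0 j0 scaler0 addr0.
have [q0 eq0] := kapS u; have [p fp] := rat_additive_inj_surj fB fI q0.
by exists (r (hh (lsubmx p))), (r (hh (rsubmx p))); split=> //; rewrite eq0 -fp -hf.
Qed.

Let W_dec x : exists2 w, W w & j x = w + iotaV w.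
Proof.
have [w1 [w2 [W1 W2 e]]] := W_plus (j x).
have e12 : w1 - w2 = iotaV (w1 - w2).
  rewrite hiotaVD iotaN; have := iotaJ x; rewrite e hiotaVD iotaVK => e'.
  by apply/eqP; rewrite subr_eq addrAC e' addrK.
have /eqP := W_iota (WB W1 W2) (WB W1 W2) e12; rewrite subr_eq0 => /eqP e1.
by exists w1 => //; rewrite e e1.
Qed.

(** Write j x = w + iota w and j y = u + iota u, with w and u in W.  As W and
    iota W are isotropic, both sides of the last formula are the traces of
    t (w, iota u) + iota(t) (iota w, u). *)
Lemma weil_action :
  [/\ forall s t, eta (s + t) = eta s + eta t,
      forall s t, eta (s * t) = eta s *m eta t,
      eta 1 = 1%:M
    & forall t x y, pairingV (x *m eta t) y = pairingV x (y *m eta (iota t))].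
Proof.
have mx_eq (A B : 'M[rat]_M) : (forall x : 'rV_M, x *m A = x *m B) -> A = B.
  by move=> h; apply/row_matrixP => i; rewrite !rowE.
split.
- move=> s t; apply: mx_eq => x; apply: jI; have [w Ww e] := W_dec x.
  rewrite mulmxDr jD !(heta _ Ww e) scalerDl hiotaVD.
  by rewrite addrACA.
- move=> s t; apply: mx_eq => x; apply: jI; have [w Ww e] := W_dec x.
  rewrite mulmxA (heta _ Ww e) (heta t (WZ s Ww) (heta s Ww e)).
  by rewrite scalerA [t * s]mulrC.
- apply: mx_eq => x; apply: jI; have [w Ww e] := W_dec x.
  by rewrite (heta _ Ww e) scale1r mulmx1 e.
- move=> t x y; have [_ _ _ tr] := hbF; rewrite -!tr; congr tr_rat; apply: val_inj.
  rewrite /= -!hbK; have [w Ww ew] := W_dec x; have [u Wu eu] := W_dec y.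
  rewrite (heta _ Ww ew) (heta _ Wu eu) ew eu !bKDl !bKDr !iotaZ !bKZl !bKZr iK.
  have iso a b : W a -> W b -> bK (iotaV a) (iotaV b) = 0.
    by move=> Wa Wb; rewrite iota_bK W_isotropic // rmorph0.
  by rewrite !iso // !(W_isotropic Ww Wu); ring.
Qed.

End WeilStructure.

(** * Embeddings and CM-types *)

Section Embeddings.
Variables (R : realType) (K : fieldExtType rat) (F : {subfield K}).
Variable iota : {rmorphism K -> K}.
Hypotheses (hK : CM_field R K) (hF : max_totally_real R F) (hiota : generates_Gal F iota).

Lemma restriction_exists (sigma : embK R K) :
  exists s : embF R F, forall a, sigma (vsval a) = (s a)%:C%C.
Proof.
have [tr _] := hF.
pose sF : {rmorphism subvs_of F -> R[i]} := sigma \o vsval.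
have re (a : subvs_of F) : sigma (vsval a) = (complex.Re (sigma (vsval a)))%:C%C.
  by rewrite RRe_real //; apply: (tr sF a).
pose f (a : subvs_of F) : R := complex.Re (sigma (vsval a)).
have fE a : real_complex R (f a) = sigma (vsval a) by rewrite [RHS]re.
have fB : zmod_morphism f.
  by move=> a b; apply: complexI; rewrite [RHS]rmorphB /= !fE !rmorphB.
have fM : monoid_morphism f.
  by split=> [|a b]; apply: complexI; rewrite ?[RHS]rmorph1 ?[RHS]rmorphM /= !fE ?rmorph1 ?rmorphM.
pose s : {rmorphism subvs_of F -> R} := HB.pack f
  (GRing.isZmodMorphism.Build _ _ f fB) (GRing.isMonoidMorphism.Build _ _ f fM).
by exists s.
Qed.

Lemma restriction_unique (s s' : embF R F) (sigma : embK R K) :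
  (forall a, sigma (vsval a) = (s a)%:C%C) -> (forall a, sigma (vsval a) = (s' a)%:C%C) ->
  s = s'.
Proof.
by move=> h h'; apply: rmorphism_eq => a; apply: complexI; rewrite -h h'.
Qed.

Definition conj_emb (sigma : embK R K) : embK R K := sigma \o iota.

Lemma conj_emb_restr (sigma : embK R K) (a : subvs_of F) :
  conj_emb sigma (vsval a) = sigma (vsval a).
Proof. by have [fixF _] := hiota; rewrite /= fixF // subvsP. Qed.

Lemma conj_emb_neq (sigma : embK R K) : conj_emb sigma <> sigma.
Proof.
have [_ [a ia]] := hiota => /(congr1 (fun s : embK R K => s a)) /= /fmorph_inj e.
by rewrite e eqxx in ia.
Qed.

(** With K = F(d) and d * d in F, an embedding is determined on F and by the sign
    of the image of d. *)
Lemma embeddings_over (s : embF R F) (sigma sigma' : embK R K) :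
  (forall a, sigma (vsval a) = (s a)%:C%C) -> (forall a, sigma' (vsval a) = (s a)%:C%C) ->
  sigma' = sigma \/ sigma' = conj_emb sigma.
Proof.
have [d [id d0 dd gen]] := quadratic_generator hK hF hiota => h h'.
have [fixF _] := hiota.
have eF a : a \in F -> sigma' a = sigma a.
  by move=> aF; have := h' (Subvs aF); rewrite -h.
have /eqP : sigma' d ^+ 2 = sigma d ^+ 2 by rewrite !expr2 -!rmorphM eF.
rewrite eqf_sqr => /orP[] /eqP e; [left|right]; apply: rmorphism_eq => t;
  have [a [b [aF bF ->]]] := gen t.
  by rewrite !rmorphD !rmorphM e !eF.
by rewrite /= !rmorphD !rmorphM id e !rmorphN !eF // !fixF.
Qed.

(** Send d to a complex square root of the image of d * d. *)
Lemma extension_exists (s : embF R F) :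
  exists sigma : embK R K, forall a, sigma (vsval a) = (s a)%:C%C.
Proof.
have [d [id d0 dd gen]] := quadratic_generator hK hF hiota.
have gen' t : exists p : subvs_of F * subvs_of F, t = vsval p.1 + vsval p.2 * d.
  by have [a [b [aF bF ->]]] := gen t; exists (Subvs aF, Subvs bF).
have [p hp] := choice gen'.
have pu t (a b : subvs_of F) : t = vsval a + vsval b * d -> p t = (a, b).
  move=> e; have e0 : vsval ((p t).1 - a) + vsval ((p t).2 - b) * d = 0.
    by rewrite !rmorphB mulrBl addrACA -opprD -hp -e subrr.
  have [] := quadratic_unique hiota id d0 (subvsP _) (subvsP _) e0.
  rewrite !rmorphB /= => /eqP; rewrite subr_eq0 => /eqP /val_inj <- /eqP.
  by rewrite subr_eq0 => /eqP /val_inj <-; case: (p t).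
pose rho : R[i] := sqrtC (s (Subvs dd))%:C%C.
have rr : rho * rho = (s (Subvs dd))%:C%C by rewrite -expr2 sqrtCK.
pose f (t : K) : R[i] := (s (p t).1)%:C%C + (s (p t).2)%:C%C * rho.
have fE t (a b : subvs_of F) : t = vsval a + vsval b * d -> f t = (s a)%:C%C + (s b)%:C%C * rho.
  by move=> /pu e; rewrite /f e.
have fB : zmod_morphism f.
  move=> t u; rewrite (fE (t - u) ((p t).1 - (p u).1) ((p t).2 - (p u).2)).
    by rewrite /f !rmorphB; ring.
  by rewrite {1}(hp t) {1}(hp u) !rmorphB /=; ring.
have fM : monoid_morphism f.
  split; first by rewrite (fE 1 1 0) ?rmorph1 ?rmorph0 ?mul0r ?addr0.
  move=> t u; rewrite (fE (t * u) ((p t).1 * (p u).1 + (p t).2 * (p u).2 * Subvs dd)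
    ((p t).1 * (p u).2 + (p t).2 * (p u).1)).
    by rewrite /f !rmorphD !rmorphM /= -rr; ring.
  by rewrite {1}(hp t) {1}(hp u) !rmorphD !rmorphM /=; ring.
pose sigma : {rmorphism K -> R[i]} := HB.pack f
  (GRing.isZmodMorphism.Build _ _ f fB) (GRing.isMonoidMorphism.Build _ _ f fM).
exists sigma => a; rewrite -[LHS]/(f (vsval a)) (fE _ a 0) ?rmorph0 ?mul0r ?addr0 //.
Qed.

(** Away from the restriction s0 of sigma, let the second type be the conjugate
    of the first. *)
Lemma CM_type_meeting_at (sigma : embK R K) : exists (T T' : embF R F -> embK R K) s0,
  [/\ is_CM_type T, is_CM_type T', [set s | T s = T' s] = [set s0] & T s0 = sigma].
Proof.
have [T0 hT0] := choice extension_exists.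
have [s0 hs0] := restriction_exists sigma.
pose T s := if `[< s = s0 >] then sigma else T0 s.
pose T' s := if `[< s = s0 >] then sigma else conj_emb (T0 s).
exists T, T', s0; split.
- by move=> s a; rewrite /T; case: asboolP => [->|_].
- by move=> s a; rewrite /T'; case: asboolP => [->|_] //; rewrite conj_emb_restr.
- apply/seteqP; split=> s /=; rewrite /T /T'; last by move=> ->; rewrite asboolT.
  by case: asboolP => // _ e; case: (@conj_emb_neq (T0 s)).
- by rewrite /T asboolT.
Qed.

End Embeddings.

(** * Change of scalars *)

Section BaseChange.
Variable L : numFieldType.
Local Notation er := (@ext_ratr L _).
Local Notation f := (ratr : rat -> L).

Lemma ext_ratrE m (x : ext rat m) I : er x I = f (x I).
Proof. by rewrite ffunE. Qed.

Lemma ext_ratrP m a (x y : ext rat m) : er (a *: x + y) = f a *: er x + er y.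
Proof.
apply/ffunP => I; rewrite !(ext_addE, ext_scaleE, ext_ratrE).
by rewrite rmorphD rmorphM.
Qed.

Lemma ext_ratr0 m : er (0 : ext rat m) = 0.
Proof. by apply/ffunP => I; rewrite !ffunE rmorph0. Qed.

Lemma ext_ratrD m (x y : ext rat m) : er (x + y) = er x + er y.
Proof. by have := ext_ratrP 1 x y; rewrite rmorph1 !scale1r. Qed.

Lemma ext_ratrZ m a (x : ext rat m) : er (a *: x) = f a *: er x.
Proof. by have := ext_ratrP a x 0; rewrite ext_ratr0 !addr0. Qed.

Lemma ext_ratr_sum m (T : Type) (r : seq T) (P : pred T) (g : T -> ext rat m) :
  er (\sum_(t <- r | P t) g t) = \sum_(t <- r | P t) er (g t).
Proof. by elim/big_rec2: _ => [|t a b _ <-]; rewrite ?ext_ratr0 ?ext_ratrD. Qed.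

Lemma ext_ratr_basis m (I : {set 'I_m}) : er (ext_basis rat I) = ext_basis L I.
Proof. by apply/ffunP => J; rewrite !ffunE; case: eqP; rewrite ?rmorph0 ?rmorph1. Qed.

Lemma ext_ratr_cre m i (x : ext rat m) : er (cre i x) = cre i (er x).
Proof.
apply/ffunP => I; rewrite ext_ratrE !ffunE; case: ifP => _; last by rewrite rmorph0.
rewrite rmorphM; congr (_ * _).
by rewrite /sg rmorph_prod; apply: eq_bigr => k _; rewrite rmorph_sign.
Qed.

Lemma ext_ratr_wedge m (x y : ext rat m) : er (wedge x y) = wedge (er x) (er y).
Proof.
elim/ext_ind: x => [a x x' IH IH'||i x IH].
- by rewrite wedgeDl wedgeZl !ext_ratrP IH IH' wedgeDl wedgeZl.
- by rewrite ext_ratr_basis !wedge1x.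
- by rewrite wedge_cre !ext_ratr_cre IH wedge_cre.
Qed.

Lemma ext_ratr_vec m (v : 'rV[rat]_m) : er (ext_vec v) = ext_vec (map_mx f v).
Proof.
rewrite ext_ratr_sum; apply: eq_bigr => i _.
by rewrite ext_ratrZ ext_ratr_basis mxE.
Qed.

Lemma ext_ratr_map m p (M : 'M[rat]_(m, p)) x :
  er (ext_map M x) = ext_map (map_mx f M) (er x).
Proof.
elim/ext_ind: x => [a x x' IH IH'||i x IH].
- by rewrite linearP !ext_ratrP IH IH' linearP.
- by rewrite ext_ratr_basis !ext_map_one ext_ratr_basis.
- by rewrite ext_map_cre ext_ratr_wedge ext_ratr_vec IH ext_ratr_cre ext_map_cre map_row.
Qed.

Section Phi.
Variable N : nat.

Lemma ext_ratr_pull1 (x : ext rat N) : er (pull1 x) = pull1 (er x).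
Proof. by rewrite /pull1 ext_ratr_map map_row_mx map_mx1 map_mx0. Qed.

Lemma ext_ratr_pull2 (x : ext rat N) : er (pull2 x) = pull2 (er x).
Proof. by rewrite /pull2 ext_ratr_map map_row_mx map_mx1 map_mx0. Qed.

Lemma ext_ratr_prod (x y : ext rat N) : er (ext_prod x y) = ext_prod (er x) (er y).
Proof. by rewrite /ext_prod ext_ratr_wedge ext_ratr_pull1 ext_ratr_pull2. Qed.

Lemma ext_ratr_id_tensor (g : {linear ext rat N -> ext rat N})
    (h : {linear ext L N -> ext L N}) z :
  (forall x, er (g x) = h (er x)) -> er (id_tensor g z) = id_tensor h (er z).
Proof.
move=> gh; elim/ext_prod_ind: z => [a z z' IH IH'|x y].
  by rewrite linearP !ext_ratrP IH IH' linearP.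
by rewrite ext_ratr_prod !id_tensor_prod ext_ratr_prod gh.
Qed.

Lemma ext_ratr_tau (x : ext rat N) : er (tau x) = tau (er x).
Proof. by apply/ffunP => I; rewrite ext_ratrE !ffunE rmorphM rmorph_sign. Qed.

Lemma ext_ratr_phi_poincare (x : ext rat N) : er (phi_poincare x) = phi_poincare (er x).
Proof.
have push z : er (push2 z) = push2 (er z) by apply/ffunP => J; rewrite ext_ratrE !ffunE.
rewrite /phi_poincare push ext_ratr_wedge ext_ratr_pull1; congr (push2 (wedge _ _)).
have c1 : er (c1_poincare rat N) = c1_poincare L N.
  rewrite ext_ratr_sum; apply: eq_bigr => i _.
  by rewrite ext_ratr_wedge ext_ratr_pull1 ext_ratr_pull2 ext_ratr_vec map_delta_mx.
rewrite ext_ratr_sum; apply: eq_bigr => k _; rewrite ext_ratrZ fmorphV rmorph_nat; congr (_ *: _).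
elim: (k : nat) => [|l IH] /=; first exact: ext_ratr_basis.
by rewrite ext_ratr_wedge IH c1.
Qed.

Lemma ext_ratr_Phi z : er (Phi z) = Phi (er z) :> ext L (N + N).
Proof.
rewrite !PhiE /mu_push ext_ratr_map map_block_mx map_mxN map_mx1 map_mx0; congr ext_map.
by apply: ext_ratr_id_tensor; apply: ext_ratr_phi_poincare.
Qed.

(** phi is the inverse of an isomorphism that commutes with base change. *)
Lemma ext_ratr_phi (evenN : ~~ odd N) z : er (phi rat N z) = phi L N (er z).
Proof. by rewrite -[in RHS](PhiK evenN z) ext_ratr_Phi phiK. Qed.

End Phi.

(** The projection along S onto a complement is rational, so it extends to C and
    kills the complex span of S; it therefore kills x. *)
Lemma rational_descent m (S : {vspace ext rat m}) x :
  lspan (er @` [set` S]) (er x) -> x \in S.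
Proof.
pose g y := y - projv S y.
have gD y y' : g (y + y') = g y + g y' by rewrite /g linearD opprD addrACA.
have gZ a y : g (a *: y) = a *: g y by rewrite /g linearZ scalerBr.
(* The extension of g to the exterior algebra over L. *)
pose G (y : ext L m) : ext L m := \sum_(I : {set 'I_m}) y I *: er (g (ext_basis rat I)).
have GP a y y' : G (a *: y + y') = a *: G y + G y'.
  rewrite /G scaler_sumr -big_split; apply: eq_bigr => I _ /=.
  by rewrite ext_addE ext_scaleE scalerDl scalerA.
have G0 : G 0 = 0 by rewrite /G big1 // => I _; rewrite ffunE scale0r.
have Ger y : G (er y) = er (g y).
  elim/ext_basis_ind: y => [a y y' IH IH'|I].
    by rewrite ext_ratrP GP IH IH' gD gZ ext_ratrP.
  rewrite ext_ratr_basis /G (bigD1 I) //= ffunE eqxx scale1r big1 ?addr0 // => J nJ.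
  by rewrite ffunE (negPf nJ) scale0r.
move=> h; have : G (er x) = 0.
  elim/lspan_ind: h => [|a _ u [y yS <-] IH] //.
  by rewrite GP IH addr0 Ger /g projv_id // subrr ext_ratr0 scaler0.
rewrite Ger => /ffunP gx0; have -> : x = projv S x.
  apply/eqP; rewrite -subr_eq0; apply/eqP/ffunP => I.
  have /eqP := gx0 I; rewrite ext_ratrE [X in _ == X]ffunE fmorph_eq0 => /eqP.
  by rewrite [X in _ -> _ = X]ffunE.
exact: memv_proj.
Qed.

End BaseChange.

(** * The pairing as a matrix *)

Section Swap.
Variables (L : numFieldType) (N : nat).
Implicit Types (x y : 'rV[L]_(N + N)).

Definition swap_mx : 'M[L]_(N + N) := block_mx 0 1%:M 1%:M 0.

Lemma swapE x : swap x = x *m swap_mx.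
Proof.
by rewrite -[x in RHS]hsubmxK mul_row_block !mulmx0 !mulmx1 addr0 add0r.
Qed.

Lemma swapK x : swap (swap x) = x.
Proof. by rewrite /swap row_mxKl row_mxKr hsubmxK. Qed.

Lemma swap_mx_sqr : swap_mx *m swap_mx = 1%:M.
Proof.
by rewrite mulmx_block !mul0mx !mulmx0 !mulmx1 !addr0 !add0r -scalar_mx_block.
Qed.

Lemma pairingV_swap x y : pairingV x y = (x *m swap_mx *m y^T) 0 0.
Proof.
rewrite -swapE -[y in RHS]hsubmxK tr_row_mx mul_row_col pairingVE [RHS]mxE; congr (_ + _).
have -> : lsubmx x *m (rsubmx y)^T = (rsubmx y *m (lsubmx x)^T)^T by rewrite trmx_mul trmxK.
by rewrite [RHS]mxE.
Qed.

Lemma pairingV_adjoint (E E' : 'M[L]_(N + N)) :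
  (forall x y, pairingV (x *m E) y = pairingV x (y *m E')) ->
  E *m swap_mx = swap_mx *m E'^T.
Proof.
move=> h; apply/matrixP => i k.
have ent (A : 'M[L]_(N + N)) : A i k = ((delta_mx 0 i : 'rV[L]_(N + N)) *m A *m (delta_mx 0 k : 'rV[L]_(N + N))^T) 0 0.
  by rewrite -rowE mxE (bigD1 k) //= big1 => [|l nl]; rewrite !mxE ?eqxx ?(negPf nl) ?mulr0 ?mulr1 ?addr0.
rewrite ent [RHS]ent; have := h (delta_mx 0 i) (delta_mx 0 k).
by rewrite !pairingV_swap trmx_mul !mulmxA.
Qed.

End Swap.

(** * Pure spinors of CM-types *)

Section WeilType.
Variables (R : realType) (K : fieldExtType rat) (F : {subfield K}).
Variable iota : {rmorphism K -> K}.
Hypotheses (hK : CM_field R K) (hF : max_totally_real R F) (hiota : generates_Gal F iota).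
Variables (N d : nat).
Hypothesis evenN : ~~ odd N.
Variable eta : K -> 'M[rat]_(N + N).
Hypothesis eta_adj : forall t x y, pairingV (x *m eta t) y = pairingV x (y *m eta (iota t)).
Local Notation C := (R[i]).
Local Notation toC := (map_mx (ratr : rat -> C)).
Variables (P : 'M[C]_(N + N)) (sig : 'I_(N + N) -> embK R K).
Hypothesis Pu : P \in unitmx.
Hypothesis hP : forall i t, row i P *m toC (eta t) = sig i t *: row i P.
Hypothesis hsig : forall s : embK R K, #|[set i | `[< sig i = s >]]%SET| = d.
Implicit Types (v w : 'rV[C]_(N + N)) (T : embF R F -> embK R K).

Lemma eta_diagonal t : P *m toC (eta t) = diag_mx (\row_i sig i t) *m P.
Proof.
by apply/row_matrixP => i; rewrite row_mul hP mul_diag_mx; apply/rowP => k; rewrite !mxE.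
Qed.

Lemma coord_eta v t i :
  (v *m toC (eta t) *m invmx P) 0 i = (v *m invmx P) 0 i * sig i t.
Proof.
have -> : v *m toC (eta t) *m invmx P = v *m invmx P *m diag_mx (\row_i sig i t).
  by rewrite -[in LHS](mulmxKV Pu v) -!mulmxA (mulmxA P) eta_diagonal -!mulmxA mulmxV // mulmx1.
by rewrite mul_mx_diag !mxE.
Qed.

Lemma coord_sum v : v = \sum_i (v *m invmx P) 0 i *: row i P.
Proof. by rewrite -mulmx_sum_row mulmxKV. Qed.

Lemma VsigmaP (s : embK R K) v :
  Vsigma eta s v <-> forall i, (v *m invmx P) 0 i != 0 -> sig i = s.
Proof.
split=> [h i ci|h t].
  apply: rmorphism_eq => t; apply: (mulfI ci); rewrite -coord_eta h.
  by rewrite -scalemxAl mxE mulrC.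
rewrite [in LHS](coord_sum v) [in RHS](coord_sum v) mulmx_suml scaler_sumr.
apply: eq_bigr => i _; rewrite -scalemxAl hP !scalerA.
by have [->|/h ->] := eqVneq ((v *m invmx P) 0 i) 0; rewrite ?mul0r ?mulr0 // mulrC.
Qed.

Lemma Vsigma_row i : Vsigma eta (sig i) (row i P).
Proof.
apply/VsigmaP => k; rewrite -row_mul mulmxV // row1 mxE eqxx /=.
by case: (eqVneq k i) => [->|]; rewrite ?eqxx.
Qed.

Lemma W_coordP T v : W_ eta T v <-> forall i, (v *m invmx P) 0 i != 0 -> exists s, T s = sig i.
Proof.
split.
  elim/lspan_ind => [|a x y [s _ /VsigmaP hx] IH] i; first by rewrite mul0mx mxE eqxx.
  rewrite mulmxDl -scalemxAl !mxE => h.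
  have [e|/hx ->] := eqVneq ((x *m invmx P) 0 i) 0; last by exists s.
  by apply: IH; apply: contraNneq h => e'; move: e e'; rewrite !mxE => -> ->; rewrite mulr0 addr0.
move=> h; rewrite (coord_sum v); elim/big_rec: _ => [|i x _ Wx]; first exact: lspan0.
have [->|/h [s es]] := eqVneq ((v *m invmx P) 0 i) 0; first by rewrite scale0r add0r.
by apply: lspan_cons => //; exists s => //; rewrite es; apply: Vsigma_row.
Qed.

Local Notation J := (swap_mx C N).

Lemma eta_swap t : toC (eta t) *m J = J *m (toC (eta (iota t)))^T.
Proof.
have JC : map_mx (ratr : rat -> C) (swap_mx rat N) = J.
  by rewrite map_block_mx !map_mx0 !map_mx1.
have /(congr1 (map_mx (ratr : rat -> C))) := pairingV_adjoint (eta_adj t).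
by rewrite !map_mxM JC map_trmx.
Qed.

Lemma pairingV_eta t v w :
  pairingV (v *m toC (eta t)) w = pairingV v (w *m toC (eta (iota t))).
Proof. by rewrite !pairingV_swap -!mulmxA (mulmxA (toC _)) eta_swap trmx_mul !mulmxA. Qed.

(** Move [eta t] from one side of the pairing to the other. *)
Lemma pairing_rows i k : pairingV (row i P) (row k P) != 0 -> sig i = conj_emb iota (sig k).
Proof.
move=> nz; apply: rmorphism_eq => t; apply: (mulIf nz).
have := pairingV_eta t (row i P) (row k P); rewrite !hP !pairingV_swap linearZ /=.
by rewrite -!scalemxAl -scalemxAr !mxE.
Qed.

(** The vector v for which (v, .) is the k-th coordinate form of the basis P. *)
Definition dual_vec k : 'rV[C]_(N + N) := swap (delta_mx 0 k *m (invmx P)^T).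

Lemma dual_vecE k : swap (dual_vec k) *m P^T = delta_mx 0 k.
Proof. by rewrite swapK -mulmxA -trmx_mul mulmxV // trmx1 mulmx1. Qed.

(** The k-th coordinate form is an eigenvector of the transpose of the action,
    and the pairing exchanges the action with its transpose twisted by iota. *)
Lemma dual_vec_conj k : Vsigma eta (conj_emb iota (sig k)) (dual_vec k).
Proof.
move=> t; rewrite /dual_vec swapE.
have JE : J *m toC (eta t) = (toC (eta (iota t)))^T *m J.
  rewrite -[LHS]mulmx1 -(swap_mx_sqr C N) -!mulmxA (mulmxA (toC _)) eta_swap.
  by rewrite (mulmxA J (J *m _)) (mulmxA J J) swap_mx_sqr mul1mx.
have EP s : toC (eta s) *m invmx P = invmx P *m diag_mx (\row_i sig i s).
  by rewrite -[LHS]mul1mx -(mulVmx Pu) -!mulmxA (mulmxA P) eta_diagonal -!mulmxA mulmxV // mulmx1.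
rewrite -mulmxA JE mulmxA -(mulmxA (delta_mx 0 k)) -trmx_mul EP trmx_mul tr_diag_mx.
rewrite mulmxA -[in LHS]rowE row_diag_mx mxE -!scalemxAl.
by [].
Qed.

Lemma CM_type_inj T T' s s' : is_CM_type T -> is_CM_type T' -> T s = T' s' -> s = s'.
Proof.
move=> hT hT' e; apply: (@restriction_unique _ _ _ s s' (T s)) => a; first exact: hT.
by rewrite e hT'.
Qed.

(** W_T is isotropic: two eigenvectors of W_T that are not orthogonal have
    conjugate embeddings, with the same restriction to F, hence equal since T
    takes one value there; but no embedding is its own conjugate. *)
Lemma W_spinor_exists T : is_CM_type T ->
  exists2 x : ext C N, x <> 0 & spinor_line eta T x.
Proof.
move=> hT; pose I := [seq i <- enum 'I_(N + N) | `[< exists s, T s = sig i >]].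
have [|x x0 hx] := @isotropic_spinor_exists C N [seq row i P | i <- I].
  move=> _ _ /mapP[i iI ->] /mapP[k kI ->].
  move: iI kI; rewrite !mem_filter => /andP[/asboolP[s es] _] /andP[/asboolP[s' es'] _].
  apply/eqP; apply: contraT => /pairing_rows e.
  have ss : s = s'.
    apply: (@restriction_unique _ _ _ s s' (T s)) => a; first exact: hT.
    by rewrite es e conj_emb_restr // -es' hT.
  by case: (@conj_emb_neq _ _ _ iota hiota (sig k)); rewrite -e -es ss es'.
exists x => // v /W_coordP hv; rewrite (coord_sum v).
apply: (big_ind (fun w => spinor_act w x = 0)) => [|u w hu hw|i _].
- by rewrite /spinor_act !linear0 wedge0l contract0l addr0.
- by rewrite spinor_actDl hu hw addr0.
rewrite spinor_actZl; have [->|/hv ei] := eqVneq ((v *m invmx P) 0 i) 0; first by rewrite scale0r.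
rewrite hx ?scaler0 //; apply/mapP; exists i => //.
by rewrite mem_filter mem_enum andbT; apply/asboolP.
Qed.

(** The basis vectors spanning W_T meet W_T'. *)
Definition meet_idx T T' : {set 'I_(N + N)} :=
  [set i | `[< exists s, T s = sig i /\ T' s = sig i >]]%SET.

Lemma meet_idxP T T' i :
  reflect (exists s, T s = sig i /\ T' s = sig i) (i \in meet_idx T T').
Proof. by rewrite inE; apply: asboolP. Qed.

Lemma W_meetP T T' : is_CM_type T -> is_CM_type T' -> forall v,
  W_ eta T v /\ W_ eta T' v <-> forall i, (v *m invmx P) 0 i != 0 -> i \in meet_idx T T'.
Proof.
move=> hT hT' v; split=> [[/W_coordP h1 /W_coordP h2] i ci|h].
  have [s es] := h1 i ci; have [s' es'] := h2 i ci; apply/meet_idxP; exists s.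
  by split=> //; rewrite (CM_type_inj hT hT' (etrans es (esym es'))).
by split; apply/W_coordP => i /h/meet_idxP[s [e1 e2]]; exists s.
Qed.

(** Let k be outside the meet and s the restriction of its embedding.  The
    types take one of two conjugate values at s, and not both that of k, so one
    of W_T and W_T' contains the eigenspace in which the dual vector lies. *)
Lemma W_joinP T T' : is_CM_type T -> is_CM_type T' -> forall k, k \notin meet_idx T T' ->
  exists2 v, W_ eta T v \/ W_ eta T' v & swap v *m P^T = delta_mx 0 k.
Proof.
move=> hT hT' k kA; exists (dual_vec k); last exact: dual_vecE.
have [s hs] := restriction_exists hF (sig k).
have inW U : U s = conj_emb iota (sig k) -> W_ eta U (dual_vec k).
  by move=> e; apply: lspan_gen; exists s => //; rewrite e; apply: dual_vec_conj.
case: (embeddings_over hK hF hiota hs (hT s)) => [e1|/inW]; last by left.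
case: (embeddings_over hK hF hiota hs (hT' s)) => [e2|/inW]; last by right.
by case/meet_idxP: kA; exists s.
Qed.

Lemma card_meet_idx T T' k : is_CM_type T -> is_CM_type T' -> card_meet T T' k ->
  #|meet_idx T T'| = (d * k)%N.
Proof.
move=> hT hT' /card_set_bijP[f [fS fI fs]].
have [res hres] := choice (restriction_exists hF).
have resT U s : is_CM_type U -> res (U s) = s.
  by move=> hU; apply: (@restriction_unique _ _ _ _ _ (U s)) => a; rewrite -?hres ?hU.
rewrite -sum1_card.
(* Sort the indices by the restriction of their embedding, one of the k places
   where T and T' agree, numbered by f. *)
transitivity (\sum_(i in meet_idx T T') \sum_(a < k) (f (res (sig i)) == a))%N.
  apply: eq_bigr => i /meet_idxP[s [e1 e2]].
  have fk : (f (res (sig i)) < k)%N by apply: fS; rewrite -e1 resT //= e1 e2.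
  rewrite (bigD1 (Ordinal fk)) //= eqxx big1 ?addn0 // => a na.
  by rewrite eq_sym -val_eqE in na; rewrite (negPf na).
rewrite exchange_big; transitivity (\sum_(a < k) d)%N; last first.
  by rewrite sum_nat_const card_ord mulnC.
apply: eq_bigr => a _.
have [s [es fsa]] : exists s, T s = T' s /\ f s = a by have [s ? <-] := fs a (ltn_ord a); exists s.
rewrite -(hsig (T s)) -sum1_card.
transitivity (\sum_(i in meet_idx T T' | f (res (sig i)) == a) 1)%N.
  by rewrite big_mkcondr; apply: eq_bigr => i _; case: eqP.
apply: eq_bigl => i.
rewrite !inE; apply/andP/asboolP => [[/asboolP[s' [e1 e2]] /eqP]|e].
  rewrite -e1 resT // => fs'; congr T; apply: fI; last by rewrite fs' fsa.
    by rewrite in_setE /= e1 e2.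
  by rewrite in_setE.
split; first by apply/asboolP; exists s; rewrite e.
by rewrite e resT // fsa.
Qed.

Lemma spinor_product_line T T' k :
  is_CM_type T -> is_CM_type T' -> card_meet T T' k ->
  let line := @phi C N @` tensor (spinor_line eta T) (@tau C N @` spinor_line eta T') in
  [/\ is_line line, line `<=` @ext_filtration C (N + N) (d * k),
      is_line (ext_power (d * k) (W_ eta T `&` W_ eta T'))
    & @ext_part C (N + N) (d * k) @` line = ext_power (d * k) (W_ eta T `&` W_ eta T')].
Proof.
move=> hT hT' cTT; rewrite -(card_meet_idx hT hT' cTT).
have [s s0 hs] := W_spinor_exists hT; have [t t0 ht] := W_spinor_exists hT'.
exact: (@pure_spinor_line C N evenN _ _ P _ Pu (W_meetP hT hT') (W_joinP hT hT') s t).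
Qed.

Variable BB1 : {vspace ext rat (N + N)}.
Hypothesis hBB1 : lspan (@ext_ratr C (N + N) @` [set` BB1]) =
  lspan [set z | exists T T' : embF R F -> embK R K,
    [/\ is_CM_type T, is_CM_type T', card_meet T T' 1
      & tensor (spinor_line eta T) (spinor_line eta T') z]].

Let phi_tau (L : numFieldType) (z : ext L (N + N)) : ext L (N + N) :=
  phi L N (id_tensor (@tau L N) z).

Lemma phi_tau_is_linear (L : numFieldType) : linear (@phi_tau L).
Proof. by move=> a x y; rewrite /phi_tau !linearP. Qed.

Lemma phi_tau_ratr z : ext_ratr C (phi_tau z) = phi_tau (ext_ratr C z).
Proof.
rewrite /phi_tau (ext_ratr_phi C evenN); congr (phi _ _ _).
by apply: ext_ratr_id_tensor; apply: ext_ratr_tau.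
Qed.

Lemma id_tensor_tau_tensor (A B : set (ext C N)) z :
  tensor A B z -> tensor A (@tau C N @` B) (id_tensor (@tau C N) z).
Proof.
elim/lspan_ind => [|a _ y [x1 [x2 [Ax Bx ->]]] IH]; first by rewrite linear0; apply: lspan0.
rewrite linearP /= id_tensor_prod; apply: lspan_cons => //.
by exists x1, (tau x2); split=> //; exists x2.
Qed.

Lemma id_tensor_tau_tensorV (A B : set (ext C N)) z :
  tensor A (@tau C N @` B) z -> exists2 z', tensor A B z' & z = id_tensor (@tau C N) z'.
Proof.
elim/lspan_ind => [|a _ y [x1 [_ [Ax [x2 Bx <-] ->]]] [y' hy ->]].
  by exists 0; [apply: lspan0|rewrite linear0].
exists (a *: ext_prod x1 x2 + y'); last by rewrite linearP /= id_tensor_prod.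
by apply: lspan_cons => //; exists x1, x2.
Qed.

Lemma BB1_filtration z : z \in BB1 -> @ext_filtration rat (N + N) d (phi_tau z).
Proof.
move=> zB; have : @ext_filtration C (N + N) d (phi_tau (ext_ratr C z)).
  have : lspan (@ext_ratr C (N + N) @` [set` BB1]) (ext_ratr C z).
    by apply: lspan_gen; exists z.
  rewrite hBB1; elim/lspan_ind => [|a u y [T [T' [hT hT' c1 hu]]] IH] I.
    by rewrite /phi_tau !linear0 ffunE eqxx.
  rewrite phi_tau_is_linear ext_addE ext_scaleE => nz.
  have [e|/IH//] := eqVneq (phi_tau y I) 0; move: nz; rewrite e addr0 mulf_eq0 => /norP[_].
  have [_ hf _ _] := spinor_product_line hT hT' c1; rewrite muln1 in hf.
  by apply: hf; exists (id_tensor (@tau C N) u) => //; apply: id_tensor_tau_tensor.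
rewrite -phi_tau_ratr => h I; have := h I; rewrite ext_ratrE fmorph_eq0.
by [].
Qed.

Lemma card_meet1_W T T' s0 : is_CM_type T -> is_CM_type T' ->
  [set s | T s = T' s] = [set s0] -> W_ eta T `&` W_ eta T' = Vsigma eta (T s0).
Proof.
move=> hT hT' e; have e0 : T s0 = T' s0.
  by have : [set s0] s0 by []; rewrite -e.
apply/seteqP; split=> v; first move=> /(W_meetP hT hT') h.
  apply/VsigmaP => i /h/meet_idxP[s [e1 e2]].
  have es : [set s0] s by rewrite -e /= e1 e2.
  by rewrite -e1 es.
move=> /VsigmaP h; apply/(W_meetP hT hT') => i /h es; apply/meet_idxP; exists s0.
by rewrite -e0 es.
Qed.

(** Both sides are rational and their complex spans are generated by the lines
    of the top exterior powers of the V_sigma: on the left, by the pairs of types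
    meeting in one point, one pair for each sigma by [CM_type_meeting_at]. *)
Lemma BB1_image : [set ext_part d (phi_tau z) | z in [set` BB1]] = HW R eta d.
Proof.
apply/seteqP; split=> x.
  move=> [z zB <-]; split.
    by move=> I; rewrite ffunE; case: (eqVneq #|I| d) => //; rewrite eqxx.
  have -> : ext_ratr C (ext_part d (phi_tau z)) = ext_part d (phi_tau (ext_ratr C z)).
    by rewrite -phi_tau_ratr; apply/ffunP => I; rewrite ext_ratrE !ffunE; case: ifP; rewrite ?rmorph0.
  have : lspan (@ext_ratr C (N + N) @` [set` BB1]) (ext_ratr C z).
    by apply: lspan_gen; exists z.
  rewrite hBB1; elim/lspan_ind => [|a u y [T [T' [hT hT' c1 hu]]] IH].
    by rewrite /phi_tau !linear0; apply: lspan0.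
  rewrite phi_tau_is_linear linearP; apply: lspan_lin => //=.
  have [_ _ _ hf] := spinor_product_line hT hT' c1; rewrite muln1 in hf.
  have [s0 es0] : exists s0, [set s | T s = T' s] = [set s0].
    have /card_set_bijP[f [fS fI fs]] := c1.
    have [s es _] := fs 0%N isT; exists s; apply/seteqP; split=> s' /=; last by move=> ->.
    move=> es'; apply: fI; rewrite ?in_setE //.
    have := fS _ es'; have := fS _ es; rewrite /= !ltnS !leqn0 => /eqP -> /eqP ->.
    by [].
  apply: lspan_gen; exists (T s0) => //.
  rewrite -(card_meet1_W hT hT' es0) -hf; exists (phi_tau u) => //.
  by exists (id_tensor (@tau C N) u) => //; apply: id_tensor_tau_tensor.
move=> [dx hx].
pose g : ext rat (N + N) -> ext rat (N + N) := fun z => ext_part d (phi_tau z).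
have glin : linear g by move=> a u v; rewrite /g phi_tau_is_linear linearP.
pose gl : {linear ext rat (N + N) -> ext rat (N + N)} := HB.pack g
  (GRing.isLinear.Build _ _ _ _ g glin).
suff /memv_imgP[z zB ->] : x \in (linfun gl @: BB1)%VS by exists z; [exact: zB|rewrite lfunE].
apply: (@rational_descent C); move: hx; apply: lspan_sub => y [s _].
have [T [T' [s0 [hT hT' es0 eT]]]] := CM_type_meeting_at hK hF hiota s.
have c1 : card_meet T T' 1 by rewrite /card_meet es0; apply: card_set1.
have [_ _ _ hf] := spinor_product_line hT hT' c1; rewrite muln1 in hf.
rewrite -eT -(card_meet1_W hT hT' es0) -hf => -[_ [u /id_tensor_tau_tensorV[z hz ->] <-] <-].
have : lspan (@ext_ratr C (N + N) @` [set` BB1]) z.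
  by rewrite hBB1; apply: lspan_gen; exists T, T'.
rewrite -/(phi_tau z); elim/lspan_ind => [|a _ v [b bB <-] IH].
  by rewrite /phi_tau !linear0; apply: lspan0.
rewrite phi_tau_is_linear linearP; apply: lspan_cons => //=.
have gb : g b \in (linfun gl @: BB1)%VS by rewrite -[g b]/(gl b) -lfunE memv_img.
exists (g b); first exact: gb.
by rewrite -phi_tau_ratr; apply/ffunP => I; rewrite ext_ratrE !ffunE; case: ifP; rewrite ?rmorph0.
Qed.

End WeilType.

Theorem lemma10p1p3
  (R : realType)
  (* the CM-field *)
  (K : fieldExtType rat) (hK : CM_field R K)
  (F : {subfield K}) (hF : max_totally_real R F)
  (iota : {rmorphism K -> K}) (hiota : generates_Gal F iota)
  (* the abelian variety with its F-action *)
  (d n : nat) (hd0 : (0 < d)%N) (hd : ~~ odd d)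
  (hn : (4 * n = d * \dim {:K})%N)
  (X : abelian_variety R n)
  (etahat : {rmorphism subvs_of F -> 'M[rat]_(n.*2)})
  (hetahat : injective etahat)
  (hEnd : forall a, in_EndQ X (etahat a))
  (bF : 'rV[rat]_(n.*2 + n.*2) -> 'rV[rat]_(n.*2 + n.*2) -> subvs_of F)
  (hbF : is_F_form etahat bF)
  (* V_Q (x)_F K, with the action of iota and the K-bilinear form *)
  (VK : lmodType K) (j : 'rV[rat]_(n.*2 + n.*2) -> VK)
  (hVK : is_tensor_K etahat j)
  (iotaV : VK -> VK)
  (hiotaVD : forall u v, iotaV (u + v) = iotaV u + iotaV v)
  (hiotaV : forall t x, iotaV (t *: j x) = iota t *: j x)
  (bK : VK -> VK -> K)
  (hbKl : forall t u v w, bK (t *: u + v) w = t * bK u w + bK v w)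
  (hbKr : forall t u v w, bK w (t *: u + v) = t * bK w u + bK w v)
  (hbK : forall x y, bK (j x) (j y) = vsval (bF x y))
  (* the spin group element and W *)
  (Cl : algType K) (c : {linear VK -> Cl})
  (hCl : is_clifford_algebra (fun u => bK u u / 2%:R) c)
  (g0 : Cl) (hg0 : spin_group c g0)
  (W : set VK) (hW : W = vector_rep_image c g0 (H1dual_K j))
  (hWiota : W `&` (iotaV @` W) = [set 0])
  (* the K-action on V_Q *)
  (eta : K -> 'M[rat]_(n.*2 + n.*2))
  (heta : forall t w x, W w -> j x = w + iotaV w ->
     j (x *m eta t) = t *: w + iotaV (t *: w))
  (* B and BB_1 *)
  (B : {vspace ext rat (n.*2)}) (hBev : [set` B] `<=` @ext_even rat (n.*2))
  (hB : lspan (@ext_ratr R[i] (n.*2) @` [set` B]) =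
        lspan (\bigcup_(T in @is_CM_type R K F) spinor_line eta T))
  (BB1 : {vspace ext rat (n.*2 + n.*2)})
  (hBB1sub : [set` BB1] `<=` tensor [set` B] [set` B])
  (hBB1 : lspan (@ext_ratr R[i] (n.*2 + n.*2) @` [set` BB1]) =
          lspan [set z | exists T T' : embF R F -> embK R K,
            [/\ is_CM_type T, is_CM_type T', card_meet T T' 1
              & tensor (spinor_line eta T) (spinor_line eta T') z]]) :
  (forall (T T' : embF R F -> embK R K) (k : nat),
     is_CM_type T -> is_CM_type T' -> card_meet T T' k ->
     let line := @phi R[i] (n.*2) @`
       tensor (spinor_line eta T) (@tau R[i] (n.*2) @` spinor_line eta T') in
     [/\ is_line line,
         line `<=` @ext_filtration R[i] (n.*2 + n.*2) (d * k),
         is_line (ext_power (d * k) (W_ eta T `&` W_ eta T'))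
       & @ext_part R[i] (n.*2 + n.*2) (d * k) @` line =
         ext_power (d * k) (W_ eta T `&` W_ eta T')]) /\
  let phi_tau := fun z : ext rat (n.*2 + n.*2) =>
    phi rat (n.*2) (id_tensor (@tau rat (n.*2)) z) in
  (forall z, z \in BB1 ->
     @ext_filtration rat (n.*2 + n.*2) d (phi_tau z)) /\
  [set ext_part d (phi_tau z) | z in [set` BB1]] = HW R eta d.
Proof.
have dimK0 : (0 < \dim {:K})%N := adim_gt0 {:K}%AS.
have n0 : (0 < n)%N.
  rewrite lt0n; apply/eqP => n0; move/esym/eqP: hn.
  by rewrite n0 muln0 muln_eq0 !eqn0Ngt hd0 dimK0.
have N0 : (0 < n.*2)%N by rewrite double_gt0.
have hN : (n.*2 + n.*2 = d * \dim {:K})%N by rewrite addnn -!mul2n mulnA.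
have evenN : ~~ odd n.*2 by rewrite odd_double.
have [delta [idelta delta0 deltaF gen]] := quadratic_generator hK hF hiota.
have [etaD etaM eta1 adj] := weil_action hK hF hiota hbF hVK hiotaVD hiotaV hbKl hbKr hbK
  hCl hg0 hW hWiota heta idelta delta0 gen deltaF.
have [P [sig [Pu hP hsig]]] : exists (P : 'M[R[i]]_(n.*2 + n.*2)) (sig : 'I_(n.*2 + n.*2) -> embK R K),
    [/\ P \in unitmx, forall i t, row i P *m map_mx ratr (eta t) = sig i t *: row i P
      & forall s : embK R K, #|[set i | `[< sig i = s >]]%SET| = d].
  by apply: eigenbasis_pos => //; rewrite addn_gt0 N0.
split=> [T T' k hT hT' hk|phi_tau].
  exact: (spinor_product_line hK hF hiota evenN adj Pu hP hsig hT hT' hk).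
split=> [z zB|].
  exact: (BB1_filtration hK hF hiota evenN adj Pu hP hsig hBB1 zB).
exact: (BB1_image hK hF hiota evenN adj Pu hP hsig hBB1).
Qed.
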